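(* Let $\lambda\in\mathbb{C}$ and $|t|<1$. Then the multivariable hypergeometric function ${}^{(k)}E^{(r)}$ satisfies $$\sum_{n=0}^{\infty}\frac{(\lambda)_n}{n!}\,{}^{(k)}E^{(r)}\left(\lambda+n,\beta_{k+1},\dots,\beta_r;\gamma_1,\dots,\gamma_r;x_1,\dots,x_r\right)t^n$$ $$=(1-t)^{-\lambda}\,{}^{(k)}E^{(r)}\left(\lambda,\beta_{k+1},\dots,\beta_r;\gamma_1,\dots,\gamma_r;\frac{x_1}{(1-t)^{\rho}},\dots,\frac{x_k}{(1-t)^{\rho}},\frac{x_{k+1}}{1-t},\dots,\frac{x_r}{1-t}\right).$$
   Context: The Pochhammer symbol is $(\lambda)_\nu=\Gamma(\lambda+\nu)/\Gamma(\lambda)$ for $\lambda\in\mathbb{C}\setminus\{0,-1,-2,\dots\}$; moreover $(\lambda)_0=1$ and $(\lambda)_n=\lambda(\lambda+1)\cdots(\lambda+n-1)$ for every positive integer $n$ and every $\lambda\in\mathbb{C}$. Let $r\ge 1$ and $0\le k\le r$ be integers and $\rho\ge 0$. The multivariable hypergeometric function ${}^{(k)}E^{(r)}$ (depending on $\rho$) with complex parameters $\alpha,\beta_{k+1},\dots,\beta_r,\gamma_1,\dots,\gamma_r$ and complex variables $x_1,\dots,x_r$ is $${}^{(k)}E^{(r)}(\alpha,\beta_{k+1},\dots,\beta_r;\gamma_1,\dots,\gamma_r;x_1,\dots,x_r):=\sum_{m_1,\dots,m_r=0}^{\infty}(\alpha)_{\rho(m_1+\dots+m_k)+m_{k+1}+\dots+m_r}\frac{(\beta_{k+1})_{m_{k+1}}\cdots(\beta_r)_{m_r}}{(\gamma_1)_{m_1}\cdots(\gamma_r)_{m_r}}\frac{x_1^{m_1}}{m_1!}\cdots\frac{x_r^{m_r}}{m_r!},$$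 where $\rho(\sqrt{|x_1|}+\dots+\sqrt{|x_k|})+|x_{k+1}|+\dots+|x_r|<1$. Identities are understood for parameters and variables for which the functions occurring in them are defined (Pochhammer symbols defined, denominators nonzero, arguments satisfying this condition, defining series convergent). Powers of $1-t$ are principal.
   Formalization: The convergence of the outer series over n on the left-hand side is assumed; it does not follow from |t|<1 and the argument conditions (e.g. k=0, r=1, λ=β=γ=1, x=1/2, t=-9/10 makes it diverge). *)

(* Defs.v *)
From HB Require Import structures.
From mathcomp Require Import all_boot all_order all_algebra finmap.
From mathcomp Require Import complex.
From mathcomp Require Import all_classical all_reals all_analysis.
From mathcomp Require Import summability.

Set Implicit Arguments.
Unset Strict Implicit.
Unset Printing Implicit Defensive.

Import Order.TTheory GRing.Theory Num.Theory.
Import numFieldNormedType.Exports.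

Local Open Scope classical_set_scope.
Local Open Scope ring_scope.
Local Open Scope complex_scope.

(* The topology and norm on the complex numbers are those that a numFieldType
   carries as a normed module over itself; R[i] only gets them through the
   regular-module alias ^o. *)
Notation Cplx R := (R[i])^o (only parsing).

Section ComplexFunctions.
Variable R : realType.
Implicit Types (z w a : Cplx R) (n : nat).

Definition cabs z : R := ComplexField.Normc.normc z.

Definition cexp z : Cplx R :=
  (expR (complex.Re z))%:C
  * (cos (complex.Im z) +i* sin (complex.Im z)).

(* Principal argument of z != 0, with values in ]-pi, pi]. *)
Definition carg z : R :=
  let u := acos (complex.Re z / cabs z) in
  if 0 <= complex.Im z then u else - u.

Definition cln z : Cplx R := ln (cabs z) +i* carg z.

(* Principal value of z ^ w for z != 0. *)
Definition cpow z w : Cplx R := cexp (w * cln z).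

Definition nonpos_int z : Prop := exists n, z = - n%:R.

(* Euler's limit n! n^z / (z (z + 1) ... (z + n)), which exists and is Gamma(z)
   for every z that is not a nonpositive integer; no meaning is attached to the
   value at the poles. *)
Definition cGamma z : Cplx R :=
  limn (fun n => n`!%:R * cpow n%:R z / \prod_(j < n.+1) (z + j%:R) : Cplx R).

Definition rising a n : Cplx R := \prod_(j < n) (a + j%:R).

(* (a)_nu for real nu >= 0: the product a (a + 1) ... (a + nu - 1), for any a,
   when nu is a natural number, and Gamma(a + nu) / Gamma(a) otherwise. *)
Definition poch a (nu : R) : Cplx R :=
  if nu \is a Num.nat then rising a (Num.truncn nu)
  else cGamma (a + nu%:C) / cGamma a.

Definition poch_defined a (nu : R) : Prop :=
  nu \is a Num.nat \/ (~ nonpos_int a /\ ~ nonpos_int (a + nu%:C)).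

End ComplexFunctions.

(* Variables and parameters are indexed from 0, so the first k variables are
   the x i with i < k, and beta i is ignored for i < k. *)
Section HypergeometricE.
Variables (R : realType) (r k : nat) (rho : R).
Implicit Types (a : Cplx R) (beta gamma x : 'I_r -> Cplx R).
Implicit Types (m : {ffun 'I_r -> nat}).

Definition hyperE_index m : R :=
  rho * (\sum_(i < r | (i < k)%N) m i)%:R
  + (\sum_(i < r | (k <= i)%N) m i)%:R.

Definition hyperE_term a beta gamma x m : Cplx R :=
  poch a (hyperE_index m)
  * ((\prod_(i < r | (k <= i)%N) rising (beta i) (m i))
     / \prod_(i < r) rising (gamma i) (m i))
  * \prod_(i < r) (x i ^+ m i / (m i)`!%:R).

Definition hyperE_region x : Prop :=
  rho * (\sum_(i < r | (i < k)%N) Num.sqrt (cabs (x i)))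
  + \sum_(i < r | (k <= i)%N) cabs (x i) < 1.

(* Multiple series are summed unconditionally, as limits of finite sums along
   the finite sets of multi-indices ordered by inclusion. *)
Definition hyperE a beta gamma x : Cplx R :=
  summability.sum (hyperE_term a beta gamma x).

Definition hyperE_defined a beta gamma x : Prop :=
  [/\ forall m, poch_defined a (hyperE_index m),
      forall i n, rising (gamma i) n != 0,
      hyperE_region x
    & cvg (partial_sum (hyperE_term a beta gamma x) @ totally)].

(* x_i / (1 - t)^rho for the first k variables, x_i / (1 - t) for the others. *)
Definition hyperE_rescale x (t : Cplx R) : 'I_r -> Cplx R := fun i =>
  if (i < k)%N then x i / cpow (1 - t) rho%:C else x i / (1 - t).

End HypergeometricE.

(* Main.v *)
Require Import Defs.
From mathcomp Require Import all_boot all_order all_algebra finmap.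
From mathcomp Require Import complex.
From mathcomp Require Import all_classical all_reals all_analysis.
From mathcomp Require Import summability.
From mathcomp Require Import ring lra zify.

Set Implicit Arguments.
Unset Strict Implicit.
Unset Printing Implicit Defensive.

Import Order.TTheory GRing.Theory Num.Theory.
Import numFieldNormedType.Exports.

Local Open Scope classical_set_scope.
Local Open Scope ring_scope.
Local Open Scope complex_scope.

(** Why the identity holds.  Let A_m be the term of index m of the series E at
    lambda and x, let N_m be its real index, and a_m = lambda + N_m.  Since
    (lambda)_n (lambda + n)_N = (lambda)_N (lambda + N)_n (rising_poch_swap),
    the left-hand side is the power series sum_n p_n t^n with
    p_n = sum_m A_m (a_m)_n / n!, the n-th Taylor coefficient at 0 of
      F(z) = sum_m A_m (1 - z)^(- a_m),
    and the right-hand side is F(t) (hyperE_term_rescale).  So a power series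
    that converges at t must be shown to have the value F(t) there.

    Exchanging the two sums only works for small t: sum_n is dominated by a
    multiple of (1 - |t|)^(- N_m), while F is only known to converge where
    |1 - z| >= s for some s with s <= |1 - t| and s < 1, and t may lie well
    outside the disc |z| <= 1 - s.  The equality is therefore carried from 0
    to t by analytic continuation along the path z(tau) = 1 - (1 - t)^tau.
    This path is the right one: |1 - z(tau)| = |1 - t|^tau > s for tau < 1,
    and |z(tau)| <= 1 - (1 - |t|)^tau < |t| because the power series of
    1 - (1 - z)^tau has nonnegative coefficients (cabs_ppath).  Hence it runs
    inside the disc of convergence of the power series and inside the domain
    of F.  Continuation is done on Taylor coefficients: the coefficients of
    both functions at a point determine those at a nearby point by the same
    re-expansion formula (taylor_shift for the power series, ptaylor_step for
    F, which rests on the binomial theorem binomial_series), so all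
    coefficients agree along the path for tau < 1 (taylor_ppath).  Letting tau
    tend to 1, the power series side converges by Abel's theorem, the path
    arriving within a Stolz angle (ppath_stolz, abel_stolz), and the other
    side by dominated convergence (power_series_continuation).

    It remains to find s.  If |1 - t| < 1, the convergence of the series at
    the rescaled variables says that s = |1 - t| will do.  If |1 - t| >= 1,
    one needs that sum_m |A_m| c^(N_m) is finite for some c > 1, and this is
    where the strict inequality defining the region is used
    (region_summable).  Bounding Gamma by its growth along arithmetic
    progressions and the term by a multinomial coefficient, the series is
    dominated by a geometric one when rho <= 2.  When rho > 2 and one of the
    first k variables is nonzero, the terms of a convergent series would be
    unbounded, unless lambda is a nonpositive integer, in which case the
    indices of the nonzero terms are bounded. *)

(** * The modulus of a complex number *)

Section Modulus.
Variable R : realType.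
Notation C := (Cplx R).
Implicit Types (z w : C) (e : R).

Lemma normC_cabs z : `|z| = (cabs z)%:C.
Proof. by []. Qed.

Lemma cabs_ge0 z : 0 <= cabs z.
Proof. by case: z => a b; exact: sqrtr_ge0. Qed.

Lemma cabs0 : cabs (0 : C) = 0.
Proof. by rewrite /cabs ComplexField.Normc.normc0. Qed.

Lemma cabs1 : cabs (1 : C) = 1.
Proof. by rewrite /cabs ComplexField.Normc.normc1. Qed.

Lemma cabsM z w : cabs (z * w) = cabs z * cabs w.
Proof. exact: ComplexField.Normc.normcM. Qed.

Lemma cabsV z : cabs (z^-1) = (cabs z)^-1.
Proof. exact: ComplexField.Normc.normcV. Qed.

Lemma cabsN z : cabs (- z) = cabs z.
Proof. exact: normcN. Qed.

Lemma cabsD z w : cabs (z + w) <= cabs z + cabs w.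
Proof. exact: le_normcD. Qed.

Lemma cabsBC z w : cabs (z - w) = cabs (w - z).
Proof. by rewrite -cabsN opprB. Qed.

Lemma cabsB z w : cabs (z - w) <= cabs z + cabs w.
Proof. by rewrite -(cabsN w) cabsD. Qed.

Lemma cabsB_ge z w : cabs z - cabs w <= cabs (z - w).
Proof. by rewrite lerBlDr -{1}(subrK w z) cabsD. Qed.

Lemma cabsX z n : cabs (z ^+ n) = cabs z ^+ n.
Proof. by elim: n => [|n IH]; rewrite ?expr0 ?cabs1 // !exprS cabsM IH. Qed.

Lemma cabs_eq0 z : (cabs z == 0) = (z == 0).
Proof.
apply/eqP/eqP => [|->]; last exact: cabs0.
exact: ComplexField.Normc.eq0_normc.
Qed.

Lemma cabs_gt0 z : (0 < cabs z) = (z != 0).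
Proof. by rewrite lt_def cabs_eq0 cabs_ge0 andbT. Qed.

Lemma cabs_real e : cabs (e%:C : C) = `|e|.
Proof. by rewrite /cabs /= expr0n addr0 sqrtr_sqr. Qed.

Lemma cabs_nat n : cabs (n%:R : C) = n%:R.
Proof.
have -> : (n%:R : C) = (n%:R : R)%:C by rewrite rmorph_nat.
by rewrite cabs_real ger0_norm.
Qed.

Lemma cabs_Re z : `|complex.Re z| <= cabs z.
Proof.
case: z => a b /=; rewrite /cabs /= -sqrtr_sqr ler_wsqrtr //.
by rewrite lerDl sqr_ge0.
Qed.

Lemma cabs_Im z : `|complex.Im z| <= cabs z.
Proof.
case: z => a b /=; rewrite /cabs /= -[leLHS]sqrtr_sqr ler_wsqrtr //.
by rewrite lerDr sqr_ge0.
Qed.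

Lemma cabs_Re_Im z : cabs z <= `|complex.Re z| + `|complex.Im z|.
Proof.
case: z => a b /=.
have := cabsD (a%:C : C) ((0 +i* b) : C); simpc.
by rewrite cabs_real {2}/cabs /= expr0n add0r sqrtr_sqr.
Qed.

Lemma ReD z w : complex.Re (z + w) = complex.Re z + complex.Re w.
Proof. by case: z w => ? ? []. Qed.

Lemma ImD z w : complex.Im (z + w) = complex.Im z + complex.Im w.
Proof. by case: z w => ? ? []. Qed.

Lemma ReN z : complex.Re (- z) = - complex.Re z.
Proof. by case: z. Qed.

Lemma ImN z : complex.Im (- z) = - complex.Im z.
Proof. by case: z. Qed.

Lemma ReZ e z : complex.Re (e%:C * z) = e * complex.Re z.
Proof. by case: z => ? ?; simpc. Qed.

Lemma ImZ e z : complex.Im (e%:C * z) = e * complex.Im z.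
Proof. by case: z => ? ?; simpc. Qed.

Lemma cabs_sum (I : Type) (s : seq I) (P : pred I) (f : I -> C) :
  cabs (\sum_(i <- s | P i) f i) <= \sum_(i <- s | P i) cabs (f i).
Proof.
elim/big_rec2: _ => [|i y x _ h]; first by rewrite cabs0.
by rewrite (le_trans (cabsD _ _)) // lerD2l.
Qed.

Lemma cabs_prod (I : Type) (s : seq I) (P : pred I) (f : I -> C) :
  cabs (\prod_(i <- s | P i) f i) = \prod_(i <- s | P i) cabs (f i).
Proof.
elim/big_rec2: _ => [|i y x _ h]; first by rewrite cabs1.
by rewrite cabsM h.
Qed.

Lemma Re_sum (I : Type) (s : seq I) (P : pred I) (f : I -> C) :
  complex.Re (\sum_(i <- s | P i) f i) = \sum_(i <- s | P i) complex.Re (f i).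
Proof. by elim/big_rec2: _ => //= i y x _ h; rewrite ReD h. Qed.

Lemma Im_sum (I : Type) (s : seq I) (P : pred I) (f : I -> C) :
  complex.Im (\sum_(i <- s | P i) f i) = \sum_(i <- s | P i) complex.Im (f i).
Proof. by elim/big_rec2: _ => //= i y x _ h; rewrite ImD h. Qed.

Lemma cvg_cabsP (T : Type) (F : set_system T) (FF : Filter F) (f : T -> C) z :
  f @ F --> z <-> forall e, 0 < e -> \forall x \near F, cabs (f x - z) < e.
Proof.
split=> [/cvgrPdist_lt h e e0|h].
  have := h (e%:C) _; rewrite ltcR => /(_ e0).
  by apply: filterS => x; rewrite normC_cabs ltcR cabsBC.
apply/cvgrPdist_lt => eps; case: eps => a b.
rewrite ltcE /= => /andP[/eqP -> a0].
by apply: filterS (h a a0) => x; rewrite normC_cabs ltcR cabsBC.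
Qed.

Lemma cabs_small_eq0 z : (forall e, 0 < e -> cabs z <= e) -> z = 0.
Proof.
move=> h; apply/eqP; rewrite -cabs_eq0 eq_le cabs_ge0 andbT.
by apply/ler_addgt0Pl => e e0; rewrite addr0 h.
Qed.

Lemma near_unique (T : Type) (F : set_system T) (FF : ProperFilter F)
    (f : T -> C) z w :
  (forall e, 0 < e -> \forall x \near F, cabs (f x - z) < e) ->
  (forall e, 0 < e -> \forall x \near F, cabs (f x - w) < e) -> z = w.
Proof.
move=> hz hw; apply/eqP; rewrite -subr_eq0; apply/eqP/cabs_small_eq0 => e e0.
have e2 : 0 < e / 2 by rewrite divr_gt0.
have [x [h1 h2]] := @filter_ex _ F FF _ (@filterI _ F _ _ _ (hz _ e2) (hw _ e2)).
have -> : z - w = (f x - w) - (f x - z) by ring.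
by rewrite (le_trans (cabsB _ _)) // [leRHS](splitr e) lerD // ltW.
Qed.

End Modulus.

(** * Unconditional sums of complex families *)

Section Sums.
Variable R : realType.
Notation C := (Cplx R).

Lemma fsum_subset (I : choiceType) (f : I -> R) (A B : {fset I}) :
  (forall i, 0 <= f i) -> (A `<=` B)%fset ->
  \sum_(i <- A) f i <= \sum_(i <- B) f i.
Proof.
move=> f0 AB; rewrite [leRHS](big_fsetID _ (mem A)) /=.
have -> : [fset x in B | x \in A]%fset = A.
  by apply/fsetP => x; rewrite !inE /= andbC; apply: andb_idr => /(fsubsetP AB).
by rewrite lerDl sumr_ge0.
Qed.

Lemma fsum_split (V : zmodType) (I : choiceType) (f : I -> V)
    (A B : {fset I}) : (A `<=` B)%fset ->
  \sum_(i <- B) f i = \sum_(i <- A) f i + \sum_(i <- (B `\` A)%fset) f i.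
Proof.
move=> AB; rewrite (big_fsetID _ (mem A)) /=; congr (_ + _).
  apply: eq_fbigl => x; rewrite !inE /= andbC.
  by apply: andb_idr => /(fsubsetP AB).
by apply: eq_fbigl => x; rewrite !inE /= andbC.
Qed.

Definition has_sum (I : choiceType) (f : I -> C) (S : C) :=
  forall e : R, 0 < e ->
  exists A : {fset I}, forall B : {fset I}, (A `<=` B)%fset ->
  cabs (\sum_(i <- B) f i - S) < e.

Definition bounded_sums (I : choiceType) (f : I -> R) :=
  exists M : R, forall A : {fset I}, \sum_(i <- A) f i <= M.

Definition absum (I : choiceType) (f : I -> C) :=
  bounded_sums (fun i => cabs (f i)).

Definition tsum (I : choiceType) (f : I -> C) : C := summability.sum f.

Lemma partial_sumE (I : choiceType) (f : I -> C) (A : {fset I}) :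
  partial_sum f A = \sum_(i <- A) f i.
Proof. by rewrite /partial_sum big_seq_fsetE. Qed.

Lemma has_sumP (I : choiceType) (f : I -> C) (S : C) :
  has_sum f S <-> partial_sum f @ totally --> S.
Proof.
have FT := @totally_filter I.
split=> [h|/cvg_cabsP h e e0].
  apply/cvg_cabsP => e /h [A hA]; exists A => // B /= AB.
  by rewrite partial_sumE hA.
have [A _ hA] := h e e0; exists A => B AB.
by rewrite -partial_sumE; exact: hA.
Qed.

Lemma has_sum_tsum (I : choiceType) (f : I -> C) (S : C) :
  has_sum f S -> tsum f = S.
Proof.
have FT := @totally_filter I.
by move/has_sumP => h; apply: (cvg_lim _ h); exact: norm_hausdorff.
Qed.

Lemma has_sum_unique (I : choiceType) (f : I -> C) (S S' : C) :
  has_sum f S -> has_sum f S' -> S = S'.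
Proof. by move=> /has_sum_tsum <- /has_sum_tsum. Qed.

Lemma has_sum_ext (I : choiceType) (f g : I -> C) (S : C) :
  f =1 g -> has_sum f S -> has_sum g S.
Proof. by move=> /funext ->. Qed.

Lemma has_sum_cvgn (I : choiceType) (f : I -> C) :
  cvg (partial_sum f @ totally) -> has_sum f (tsum f).
Proof. by move=> h; apply/has_sumP. Qed.

Lemma bounded_sums_le (I : choiceType) (f g : I -> R) :
  (forall i, f i <= g i) -> bounded_sums g -> bounded_sums f.
Proof.
move=> fg [M hM]; exists M => A; apply: le_trans (hM A).
by apply: ler_sum => i _.
Qed.

Lemma bounded_sumsZ (I : choiceType) (f : I -> R) (c : R) :
  0 <= c -> bounded_sums f -> bounded_sums (fun i => c * f i).
Proof.
move=> c0 [M hM]; exists (c * M) => A.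
by rewrite -mulr_sumr ler_wpM2l.
Qed.

Lemma bounded_sums_tail (I : choiceType) (f : I -> R) (e : R) :
  (forall i, 0 <= f i) -> bounded_sums f -> 0 < e ->
  exists A : {fset I}, forall B, \sum_(i <- (B `\` A)%fset) f i < e.
Proof.
move=> f0 [M hM] e0.
pose E := [set y | exists A : {fset I}, y = \sum_(i <- A) f i].
have supE : has_sup E.
  split; first by exists (\sum_(i <- (fset0 : {fset I})) f i); exists fset0.
  by exists M => _ [A ->].
have [_ [A ->] hA] := sup_adherent e0 supE.
exists A => B.
have /(ub_le_sup supE.2) : E (\sum_(i <- (A `|` B)%fset) f i) by exists (A `|` B)%fset.
rewrite (fsum_split f (fsubsetUl A B)).
have -> : ((A `|` B) `\` A = B `\` A)%fset.
  by rewrite fsetDUl fsetDv fset0U.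
by move: hA; lra.
Qed.

Lemma has_sum_real_ge0 (I : choiceType) (f : I -> R) :
  (forall i, 0 <= f i) -> bounded_sums f ->
  exists S, forall e : R, 0 < e ->
  exists A : {fset I}, forall B : {fset I}, (A `<=` B)%fset ->
  `|\sum_(i <- B) f i - S| < e.
Proof.
move=> f0 [M hM].
pose E := [set y | exists A : {fset I}, y = \sum_(i <- A) f i].
have supE : has_sup E.
  split; first by exists (\sum_(i <- (fset0 : {fset I})) f i); exists fset0.
  by exists M => _ [A ->].
exists (sup E) => e e0.
have [_ [A ->] hA] := sup_adherent e0 supE.
exists A => B AB.
have /(ub_le_sup supE.2) h : E (\sum_(i <- B) f i) by exists B.
have := fsum_subset f0 AB.
by rewrite ler0_norm; lra.
Qed.

Lemma has_sum_real (I : choiceType) (f : I -> R) :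
  bounded_sums (fun i => `|f i|) ->
  exists S, forall e : R, 0 < e ->
  exists A : {fset I}, forall B : {fset I}, (A `<=` B)%fset ->
  `|\sum_(i <- B) f i - S| < e.
Proof.
move=> hf.
have [S1 h1] : exists S, forall e : R, 0 < e ->
  exists A : {fset I}, forall B : {fset I}, (A `<=` B)%fset ->
  `|\sum_(i <- B) (`|f i| + f i) - S| < e.
  apply: has_sum_real_ge0 => [i|]; first by have := ler_norm (- f i); rewrite normrN; lra.
  apply: bounded_sums_le (bounded_sumsZ (ler0n _ 2) hf) => i.
  by have := ler_norm (f i); lra.
have [S2 h2] := has_sum_real_ge0 (fun i => normr_ge0 (f i)) hf.
exists (S1 - S2) => e e0; have e2 : 0 < e / 2 by rewrite divr_gt0.
have [A1 k1] := h1 _ e2; have [A2 k2] := h2 _ e2.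
exists (A1 `|` A2)%fset => B; rewrite fsubUset => /andP[/k1 l1 /k2 l2].
have -> : \sum_(i <- B) f i = \sum_(i <- B) (`|f i| + f i) - \sum_(i <- B) `|f i|.
  by rewrite -sumrB; apply: eq_bigr => i _; ring.
by move: l1 l2; rewrite !ltr_norml; lra.
Qed.

Lemma absum_has_sum (I : choiceType) (f : I -> C) :
  absum f -> has_sum f (tsum f).
Proof.
move=> hf.
have [S1 h1] : exists S, forall e : R, 0 < e ->
  exists A : {fset I}, forall B : {fset I}, (A `<=` B)%fset ->
  `|\sum_(i <- B) complex.Re (f i) - S| < e.
  by apply/has_sum_real/(bounded_sums_le _ hf) => i; exact: cabs_Re.
have [S2 h2] : exists S, forall e : R, 0 < e ->
  exists A : {fset I}, forall B : {fset I}, (A `<=` B)%fset ->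
  `|\sum_(i <- B) complex.Im (f i) - S| < e.
  by apply/has_sum_real/(bounded_sums_le _ hf) => i; exact: cabs_Im.
suff h : has_sum f (S1 +i* S2) by rewrite (has_sum_tsum h).
move=> e e0; have e2 : 0 < e / 2 by rewrite divr_gt0.
have [A1 k1] := h1 _ e2; have [A2 k2] := h2 _ e2.
exists (A1 `|` A2)%fset => B; rewrite fsubUset => /andP[/k1 l1 /k2 l2].
apply: (le_lt_trans (cabs_Re_Im _)).
rewrite ReD ImD ReN ImN Re_sum Im_sum /=; lra.
Qed.

(** Unconditional convergence in the plane is absolute: finite sums that avoid
    a suitable finite set are bounded, in particular those over the indices
    where the real (or imaginary) part has a given sign. *)
Lemma cvg_absum (I : choiceType) (f : I -> C) :
  cvg (partial_sum f @ totally) -> absum f.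
Proof.
move/has_sum_cvgn => h; have [A hA] := h 1 ltr01.
have bnd (B : {fset I}) : [disjoint A & B]%fset ->
    cabs (\sum_(i <- B) f i) <= 2.
  move=> AB.
  have := hA (A `|` B)%fset (fsubsetUl _ _).
  rewrite (fsum_split f (fsubsetUl A B)).
  have -> : ((A `|` B) `\` A = B)%fset.
    by rewrite fsetDUl fsetDv fset0U; apply/fsetDidPl; rewrite fdisjoint_sym.
  have := hA A (fsubset_refl _).
  set a := \sum_(i <- A) _; set b := \sum_(i <- B) _ => h1 h2.
  have -> : b = (a + b - tsum f) - (a - tsum f) by ring.
  by rewrite (le_trans (cabsB _ _)) //; lra.
have real (g : C -> R) : (forall z, `|g z| <= cabs z) ->
    (forall s : seq I, g (\sum_(i <- s) f i) = \sum_(i <- s) g (f i)) ->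
    forall B : {fset I}, [disjoint A & B]%fset -> \sum_(i <- B) `|g (f i)| <= 4.
  move=> gle gs B AB.
  rewrite (big_fsetID _ (fun i => 0 <= g (f i))) /=.
  set P := [fset x in B | 0 <= g (f x)]%fset.
  set N := [fset x in B | ~~ (0 <= g (f x))]%fset.
  have hP : [disjoint A & P]%fset.
    by apply: fdisjointWr AB; apply/fsubsetP => x; rewrite !inE => /andP[].
  have hN : [disjoint A & N]%fset.
    by apply: fdisjointWr AB; apply/fsubsetP => x; rewrite !inE => /andP[].
  have -> : \sum_(i <- P) `|g (f i)| = g (\sum_(i <- P) f i).
    rewrite gs; apply: eq_big_seq => i; rewrite !inE => /andP[_ ?].
    by rewrite ger0_norm.
  have -> : \sum_(i <- N) `|g (f i)| = - g (\sum_(i <- N) f i).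
    rewrite gs -sumrN; apply: eq_big_seq => i; rewrite !inE => /andP[_].
    by rewrite -ltNge => /ltr0_norm.
  have := gle (\sum_(i <- P) f i); have := gle (\sum_(i <- N) f i).
  have := bnd _ hP; have := bnd _ hN; rewrite !ler_norml; lra.
exists (\sum_(i <- A) cabs (f i) + 8) => B.
rewrite (le_trans (fsum_subset (fun i => cabs_ge0 (f i)) (fsubsetUr A B))) //.
rewrite (fsum_split _ (fsubsetUl A B)) lerD2l.
set D := (_ `\` _)%fset.
have dD : [disjoint A & D]%fset.
  by apply/fdisjointP => x xA; rewrite inE xA.
have h1 := real (@complex.Re R) (@cabs_Re R) (fun s => Re_sum s predT f) D dD.
have h2 := real (@complex.Im R) (@cabs_Im R) (fun s => Im_sum s predT f) D dD.
apply: (@le_trans _ _ (\sum_(i <- D) (`|complex.Re (f i)| + `|complex.Im (f i)|))).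
  by apply: ler_sum => i _; exact: cabs_Re_Im.
by rewrite big_split /=; lra.
Qed.

Lemma has_sum_cabs_le (I : choiceType) (f : I -> C) (S : C) (M : R) :
  has_sum f S -> (forall A : {fset I}, \sum_(i <- A) cabs (f i) <= M) ->
  cabs S <= M.
Proof.
move=> h hM; apply/ler_addgt0Pl => e e0; have [A hA] := h e e0.
have := hA A (fsubset_refl _); have := hM A.
have := cabs_sum A predT f; rewrite cabsBC.
have := cabsB_ge S (\sum_(i <- A) f i).
by lra.
Qed.

Lemma has_sumD (I : choiceType) (f g : I -> C) (S T : C) :
  has_sum f S -> has_sum g T -> has_sum (fun i => f i + g i) (S + T).
Proof.
move=> h1 h2 e e0; have e2 : 0 < e / 2 by rewrite divr_gt0.
have [A1 k1] := h1 _ e2; have [A2 k2] := h2 _ e2.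
exists (A1 `|` A2)%fset => B; rewrite fsubUset => /andP[/k1 l1 /k2 l2].
rewrite big_split /=.
set a := \sum_(i <- B) f i; set b := \sum_(i <- B) g i.
have -> : a + b - (S + T) = (a - S) + (b - T) by ring.
by rewrite (le_lt_trans (cabsD _ _)) // [ltRHS](splitr e) ltrD.
Qed.

Lemma has_sumZ (I : choiceType) (f : I -> C) (S c : C) :
  has_sum f S -> has_sum (fun i => c * f i) (c * S).
Proof.
move=> h e e0.
have d0 : 0 < e / (cabs c + 1).
  by rewrite divr_gt0 // ltr_wpDl // cabs_ge0.
have [A hA] := h _ d0; exists A => B /hA.
rewrite -mulr_sumr -mulrBr cabsM ltr_pdivlMr; last first.
  by rewrite ltr_wpDl // cabs_ge0.
move=> /(le_lt_trans _); apply; rewrite mulrC ler_wpM2l ?cabs_ge0 //; lra.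
Qed.

Lemma has_sum0 (I : choiceType) : has_sum (fun _ : I => 0 : C) 0.
Proof.
by move=> e e0; exists fset0 => B _; rewrite big1 // subrr cabs0.
Qed.

Lemma has_sum_sum (I : choiceType) (J : Type) (s : seq J)
    (f : J -> I -> C) (S : J -> C) :
  (forall j, has_sum (f j) (S j)) ->
  has_sum (fun i => \sum_(j <- s) f j i) (\sum_(j <- s) S j).
Proof.
move=> h; elim: s => [|j s IH].
  rewrite big_nil; apply: has_sum_ext (has_sum0 I) => i.
  by rewrite big_nil.
rewrite big_cons; apply: has_sum_ext (has_sumD (h j) IH) => i.
by rewrite big_cons.
Qed.

Lemma absum_le (I : choiceType) (f : I -> C) (b : I -> R) :
  (forall i, cabs (f i) <= b i) -> bounded_sums b -> absum f.
Proof. exact: bounded_sums_le. Qed.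

Lemma mulr_div_succ_le (y : R) n : 0 <= y -> y / (n%:R + 1) *+ n <= y.
Proof.
move=> y0; rewrite -mulr_natr mulrAC ler_pdivrMr ?ltr_wpDl //.
by rewrite ler_wpM2l // lerDl.
Qed.

(** Tannery's theorem, the discrete form of dominated convergence. *)
Lemma tannery (I : choiceType) (T : Type) (F : set_system T)
    (FF : Filter F) (f : T -> I -> C) (g : I -> C) (b : I -> R) :
  bounded_sums b ->
  (forall t i, cabs (f t i) <= b i) ->
  (forall i, cabs (g i) <= b i) ->
  (forall i (e : R), 0 < e -> \forall t \near F, cabs (f t i - g i) < e) ->
  forall e : R, 0 < e -> \forall t \near F, cabs (tsum (f t) - tsum g) < e.
Proof.
move=> hb fb gb fg e e0.
have b0 i : 0 <= b i by exact: le_trans (cabs_ge0 _) (gb i).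
have e4 : 0 < e / 4 by rewrite divr_gt0.
have [A hA] := bounded_sums_tail b0 hb e4.
have tail (h : I -> C) : (forall i, cabs (h i) <= b i) ->
    cabs (tsum h - \sum_(i <- A) h i) <= e / 4.
  move=> hh; have hs := absum_has_sum (absum_le hh hb).
  apply/ler_addgt0Pl => d d0; have [A' hA'] := hs _ d0.
  have := hA' (A `|` A')%fset (fsubsetUr _ _).
  rewrite (fsum_split h (fsubsetUl A A')).
  have := hA (A `|` A')%fset.
  set D := (_ `\` _)%fset => tD.
  have : cabs (\sum_(i <- D) h i) <= \sum_(i <- D) b i.
    by rewrite (le_trans (cabs_sum _ _ _)) //; apply: ler_sum => i _.
  set x := \sum_(i <- A) _; set y := \sum_(i <- D) _ => h1 h2.
  have -> : tsum h - x = y - (x + y - tsum h) by ring.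
  by rewrite (le_trans (cabsB _ _)) //; lra.
pose d := e / 4 / (#|` A|%:R + 1).
have d0 : 0 < d by rewrite divr_gt0 // ltr_wpDl.
have near_all : \forall t \near F, forall i, i \in (A : seq I) ->
    cabs (f t i - g i) < d.
  elim: (A : seq I) => [|i s IH]; first exact: nearW.
  apply: filterS (filterI (fg i _ d0) IH) => t [h1 h2] j.
  by rewrite inE => /orP[/eqP ->|/h2].
apply: filterS near_all => t ht.
have : cabs (\sum_(i <- A) f t i - \sum_(i <- A) g i) <= e / 4.
  rewrite -sumrB (le_trans (cabs_sum _ _ _)) //.
  apply: (@le_trans _ _ (\sum_(i <- A) d)).
    by rewrite !big_seq; apply: ler_sum => i /ht /ltW.
  by rewrite big_const_seq count_predT iter_addr_0 mulr_div_succ_le // ltW.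
have := tail _ (fb t); have := tail _ gb.
set x := \sum_(i <- A) f t i; set y := \sum_(i <- A) g i => h1 h2 h3.
have -> : tsum (f t) - tsum g = (tsum (f t) - x) + (x - y) - (tsum g - y) by ring.
have := cabsB (tsum (f t) - x + (x - y)) (tsum g - y).
have := cabsD (tsum (f t) - x) (x - y).
by lra.
Qed.

Lemma fset_nat_ub (A : {fset nat}) : exists n, forall m, m \in A -> (m < n)%N.
Proof.
exists (\max_(i <- A) i).+1 => m mA; rewrite ltnS.
by rewrite (big_fsetD1 m) //= leq_maxl.
Qed.

Definition fset_below (n : nat) : {fset nat} := [fset i | i in iota 0 n]%fset.

Lemma in_fset_below n i : (i \in fset_below n) = (i < n)%N.
Proof. by rewrite !inE /= mem_iota. Qed.

Lemma sum_fset_below (V : zmodType) (f : nat -> V) n :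
  \sum_(i <- fset_below n) f i = \sum_(i < n) f i.
Proof.
rewrite -(big_mkord predT) /index_iota subn0; apply: perm_big.
rewrite uniq_perm ?iota_uniq // => i.
by rewrite in_fset_below mem_iota.
Qed.

Lemma bounded_sums_nat (f : nat -> R) (M : R) :
  (forall i, 0 <= f i) -> (forall n, \sum_(i < n) f i <= M) ->
  forall A : {fset nat}, \sum_(i <- A) f i <= M.
Proof.
move=> f0 h A; have [n hn] := fset_nat_ub A.
apply: le_trans (h n); rewrite -sum_fset_below; apply: fsum_subset => //.
by apply/fsubsetP => i /hn; rewrite in_fset_below.
Qed.

Lemma has_sum_nat (f : nat -> C) (S : C) : has_sum f S ->
  forall e : R, 0 < e ->
  \forall n \near \oo, cabs (\sum_(i < n) f i - S) < e.
Proof.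
move=> h e /h [A hA]; have [n hn] := fset_nat_ub A.
exists n => // m /= nm; rewrite -sum_fset_below; apply: hA.
apply/fsubsetP => i /hn; rewrite in_fset_below => h'.
exact: leq_trans nm.
Qed.

Lemma tsum_nat (f : nat -> C) (S : C) : absum f ->
  (forall e : R, 0 < e -> \forall n \near \oo, cabs (\sum_(i < n) f i - S) < e) ->
  tsum f = S.
Proof.
move=> /absum_has_sum /has_sum_nat h1 h2.
by apply: (near_unique (F := \oo) _ h1 h2).
Qed.

(** The partial sums over k of the iterated sum are sums over i of partial
    sums, which converge by Tannery's theorem. *)
Lemma sum_exchange (I : choiceType) (f : I -> nat -> C) (b : I -> R) :
  bounded_sums b ->
  (forall i n, \sum_(k < n) cabs (f i k) <= b i) ->
  [/\ forall k, absum (f ^~ k), absum (fun k => tsum (f ^~ k))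
    & tsum (fun k => tsum (f ^~ k)) = tsum (fun i => tsum (f i))].
Proof.
move=> hb fb.
have b0 i : 0 <= b i by have := fb i 0%N; rewrite big_ord0.
have fkb i k : cabs (f i k) <= b i.
  apply: le_trans (fb i k.+1); rewrite big_ord_recr /= lerDr.
  by apply: sumr_ge0 => j _; exact: cabs_ge0.
have abs1 k : absum (f ^~ k) by exact: absum_le (fun i => fkb i k) hb.
have absi i : absum (f i).
  by exists (b i); apply: bounded_sums_nat (fb i) => k; exact: cabs_ge0.
have [M hM] := hb.
have abs2 : absum (fun k => tsum (f ^~ k)).
  exists M; apply: bounded_sums_nat => [k|n]; first exact: cabs_ge0.
  apply/ler_addgt0Pl => e e0.
  pose d := e / (n%:R + 1).
  have d0 : 0 < d by rewrite divr_gt0 // ltr_wpDl.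
  have [A hA] : exists A : {fset I}, forall k, (k < n)%N ->
      cabs (\sum_(i <- A) f i k - tsum (f ^~ k)) < d.
    have : exists A : {fset I}, forall B : {fset I}, (A `<=` B)%fset ->
        forall k, (k < n)%N -> cabs (\sum_(i <- B) f i k - tsum (f ^~ k)) < d.
      elim: (n) => [|m [A IH]]; first by exists fset0.
      have [A' hA'] := absum_has_sum (abs1 m) d0.
      exists (A `|` A')%fset => B; rewrite fsubUset => /andP[h1 h2] k.
      rewrite ltnS leq_eqVlt => /orP[/eqP ->|]; first exact: hA'.
      exact: IH.
    by move=> [A hA]; exists A; apply: hA; exact: fsubset_refl.
  apply: (@le_trans _ _ (\sum_(k < n) (d + \sum_(i <- A) cabs (f i k)))).
    apply: ler_sum => k _; have := hA k (ltn_ord k).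
    have := cabs_sum A predT (f ^~ k).
    rewrite cabsBC.
    by have := cabsB_ge (tsum (f ^~ k)) (\sum_(i <- A) f i k); lra.
  rewrite big_split /= exchange_big /= lerD //.
    by rewrite sumr_const card_ord mulr_div_succ_le // ltW.
  by apply: le_trans (hM A); apply: ler_sum => i _; exact: fb.
split=> //; apply: tsum_nat => //.
have partial n : \sum_(k < n) tsum (f ^~ k) = tsum (fun i => \sum_(k < n) f i k).
  apply/esym/has_sum_tsum.
  apply: (has_sum_sum (index_enum _) (f := fun (k : 'I_n) i => f i k)) => k.
  exact: absum_has_sum.
move=> e e0.
have := @tannery I nat \oo _ (fun n i => \sum_(k < n) f i k)
  (fun i => tsum (f i)) b hb _ _ _ e e0.
move=> h.
have {}h : \forall t \near \oo,
    cabs (tsum (fun i => \sum_(k < t) f i k) - tsum (fun i => tsum (f i))) < e.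
  apply: h => [n i|i|i d d0].
  - by rewrite (le_trans (cabs_sum _ _ _)).
  - apply: has_sum_cabs_le (absum_has_sum (absi i)) _ => A.
    by apply: bounded_sums_nat (fb i) A => k; exact: cabs_ge0.
  - exact: has_sum_nat (absum_has_sum (absi i)) _ d0.
by apply: filterS h => n; rewrite partial.
Qed.

End Sums.

(** * Second order bounds for sine, cosine and exponential *)

Section RealBounds.
Variable R : realType.
Implicit Types x y : R.

Lemma sin_le_id y : 0 <= y -> sin y <= y.
Proof.
move=> y0.
have h1 (x : R) : x \in `]0, y[ -> is_derive x 1 (@sin R) (cos x) by move=> _; exact: is_derive_sin.
have h2 : {within `[0, y], continuous (@sin R)} by apply: continuous_subspaceT => x; exact: continuous_sin.
have [c _] := MVT_segment y0 h1 h2.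
rewrite sin0 !subr0 => ->.
by rewrite ler_piMl // cos_le1.
Qed.

Lemma norm_sin_le y : `|sin y| <= `|y|.
Proof.
wlog y0 : y / 0 <= y => [h|].
  have [/h //|/ltW y0] := leP 0 y.
  by rewrite -normrN -sinN -(normrN y) h // oppr_ge0.
rewrite ler_norml (ger0_norm y0) sin_le_id // andbT.
have [y1|y1] := leP y 1; last by have := sin_geN1 y; lra.
have : 0 <= sin y by apply: sin_ge0_pi; have := pi_ge2 R; lra.
by lra.
Qed.

Lemma cos_ge_quad y : 1 - cos y <= y ^+ 2 / 2.
Proof.
have := cos_mulr2n (y / 2); have -> : (y / 2) *+ 2 = y by rewrite -mulr_natr; field.
have := cos2Dsin2 (y / 2); have := norm_sin_le (y / 2).
rewrite -ler_sqr ?nnegrE // !real_normK ?num_real // => h1 h2 ->.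
rewrite -mulr_natr; move: h1; rewrite expr_div_n; lra.
Qed.

Lemma norm_sin_sub y : `|y| <= 1 -> `|sin y - y| <= y ^+ 2 / 2.
Proof.
wlog y0 : y / 0 <= y => [h|].
  have [/h //|/ltW y0] := leP 0 y.
  move=> y1; have := h (- y); rewrite oppr_ge0 normrN sinN sqrrN opprK.
  by move=> /(_ y0 y1); rewrite addrC -[y - sin y]opprB normrN.
rewrite ger0_norm // => y1.
pose f (x : R) := sin x - x.
have h1 (x : R) : x \in `]0, y[ -> is_derive x 1 f (cos x - 1).
  by move=> _; apply: is_deriveB.
have h2 : {within `[0, y], continuous f}.
  apply: continuous_subspaceT => x.
  by apply: cvgB; [exact: continuous_sin|exact: cvg_id].
have [c] := MVT_segment y0 h1 h2; rewrite in_itv /= => /andP[c0 cy].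
rewrite /f.
rewrite sin0 !subr0 => ->; rewrite normrM (ger0_norm y0).
have h : `|cos c - 1| <= y / 2.
  have := cos_ge_quad c; have := cos_le1 c => k1 k2.
  by rewrite ler0_norm ?subr_le0 // opprB (le_trans k2) //; nra.
by nra.
Qed.

Lemma expR_quad x : `|x| <= 2^-1 -> `|expR x - 1 - x| <= 2 * x ^+ 2.
Proof.
rewrite ler_norml => /andP[x1 x2].
have h1 := expR_ge1Dx x; have h2 := expR_ge1Dx (- x).
have : expR x * expR (- x) = 1 by rewrite -expRD subrr expR0.
have := expR_gt0 x; move: h1 h2; set a := expR x; set b := expR (- x).
move=> h1 h2 a0 ab; rewrite ger0_norm; last by lra.
have h3 : a * (1 - x) <= 1 by rewrite -[leRHS]ab ler_pM2l.
have x3 : 0 < 1 - x by lra.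
suff : a <= 1 + x + 2 * x ^+ 2 by lra.
rewrite -(ler_pM2r x3) (le_trans h3) //.
have -> : (1 + x + 2 * x ^+ 2) * (1 - x) = 1 + x ^+ 2 * (1 - 2 * x) by ring.
by rewrite lerDl mulr_ge0 ?sqr_ge0 //; lra.
Qed.

End RealBounds.

(** * The complex exponential and the principal logarithm *)

Section Exponential.
Variable R : realType.
Notation C := (Cplx R).
Implicit Types (z w u v : C).

Lemma cexpE (a b : R) :
  cexp ((a +i* b) : C) = (expR a * cos b) +i* (expR a * sin b).
Proof. by rewrite /cexp /=; simpc. Qed.

Lemma cexpD v w : cexp (v + w) = cexp v * cexp w.
Proof.
case: v => a b; case: w => c d.
have -> : ((a +i* b : C) + (c +i* d)) = ((a + c) +i* (b + d)) :> C by [].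
rewrite !cexpE expRD cosD sinD; simpc.
by congr (_ +i* _); ring.
Qed.

Lemma cexp0 : cexp (0 : C) = 1.
Proof. by have := cexpE 0 0; rewrite expR0 cos0 sin0 mulr1 mulr0. Qed.

Lemma cexpNK w : cexp w * cexp (- w) = 1.
Proof. by rewrite -cexpD subrr cexp0. Qed.

Lemma cexp_neq0 w : cexp w != 0.
Proof.
by apply/eqP => h; have /eqP := cexpNK w; rewrite h mul0r eq_sym oner_eq0.
Qed.

Lemma cexpN w : cexp (- w) = (cexp w)^-1.
Proof. by apply: (mulfI (cexp_neq0 w)); rewrite cexpNK divff // cexp_neq0. Qed.

Lemma cexpMn w n : cexp (n%:R * w) = cexp w ^+ n.
Proof.
elim: n => [|n IH]; first by rewrite mul0r cexp0 expr0.
by rewrite -addn1 natrD mulrDl mul1r cexpD IH addn1 exprSr.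
Qed.

Lemma cexp_sum (I : Type) (s : seq I) (P : pred I) (f : I -> C) :
  cexp (\sum_(i <- s | P i) f i) = \prod_(i <- s | P i) cexp (f i).
Proof.
elim/big_rec2: _ => [|i y x _ h]; first exact: cexp0.
by rewrite cexpD h.
Qed.

Lemma cabs_cexp w : cabs (cexp w) = expR (complex.Re w).
Proof.
case: w => a b; rewrite cexpE /cabs /= !exprMn -mulrDr cos2Dsin2 mulr1.
by rewrite sqrtr_sqr ger0_norm // expR_ge0.
Qed.

Lemma cexp_quad w : cabs w <= 2^-1 ->
  cabs (cexp w - 1 - w) <= 8 * cabs w ^+ 2.
Proof.
case: w => a b h.
have ha := le_trans (cabs_Re (a +i* b : C)) h.
have hb := le_trans (cabs_Im (a +i* b : C)) h.
rewrite /= in ha hb.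
have e2 : cabs (a +i* b : C) ^+ 2 = a ^+ 2 + b ^+ 2.
  by rewrite /cabs /= sqr_sqrtr // addr_ge0 // sqr_ge0.
rewrite e2 cexpE; apply: (le_trans (cabs_Re_Im _)).
rewrite !ReD !ImD !ReN !ImN /=.
have h1 := expR_quad ha.
have h2 := cos_ge_quad b; have h3 := cos_le1 b.
have h4 : `|sin b - b| <= b ^+ 2 / 2 by apply: norm_sin_sub; lra.
have h5 := norm_sin_le b.
have h6 : `|expR a - 1| <= 2 * `|a|.
  have q : a ^+ 2 <= `|a| / 2.
    rewrite -(real_normK (num_real a)) expr2 ler_wpM2l //.
  have := ler_normD (expR a - 1 - a) a; rewrite subrK; lra.
have E0 : 0 <= expR a <= 2.
  by rewrite expR_ge0 /=; move: h6; rewrite ler_norml; lra.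
have p1 : `|expR a * cos b - 1 - a| <= 2 * a ^+ 2 + b ^+ 2.
  have -> : expR a * cos b - 1 - a = (expR a - 1 - a) - expR a * (1 - cos b) by ring.
  rewrite (le_trans (ler_normB _ _)) // lerD // normrM.
  rewrite (ger0_norm (expR_ge0 a)) ger0_norm ?subr_ge0 //.
  have k : 0 <= 1 - cos b by rewrite subr_ge0.
  by case/andP: E0 => ? ?; nra.
have p2 : `|expR a * sin b - 0 - b| <= b ^+ 2 / 2 + 2 * `|a| * `|b|.
  rewrite subr0.
  have -> : expR a * sin b - b = (sin b - b) + (expR a - 1) * sin b by ring.
  rewrite (le_trans (ler_normD _ _)) // lerD // normrM.
  by rewrite ler_pM.
have p3 : 2 * `|a| * `|b| <= a ^+ 2 + b ^+ 2.
  rewrite -(real_normK (num_real a)) -(real_normK (num_real b)).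
  have := sqr_ge0 (`|a| - `|b|); rewrite sqrrB -mulr_natr; lra.
have := sqr_ge0 a; have := sqr_ge0 b; lra.
Qed.

Lemma cexp_lip w : cabs w <= 2^-1 -> cabs (cexp w - 1) <= 5 * cabs w.
Proof.
move=> h; have := cexp_quad h; have := cabsD (cexp w - 1 - w) w.
by rewrite subrK; have := cabs_ge0 w; nra.
Qed.

Lemma cexp_period w : cexp w = 1 -> `|complex.Im w| < pi *+ 2 -> w = 0.
Proof.
move=> h.
have : complex.Re w = 0.
  by apply: expR_inj; rewrite -cabs_cexp h cabs1 expR0.
case: w h => a b /[swap] /= ->; rewrite cexpE expR0 !mul1r => -[c1 s0] hb.
have cb2 : sin (b / 2) = 0.
  have := cos_mulr2n (b / 2); have -> : (b / 2) *+ 2 = b by rewrite -mulr_natr; field.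
  rewrite c1 => h; have := cos2Dsin2 (b / 2) => h'.
  by apply/eqP; rewrite -sqrf_eq0; apply/eqP; move: h; rewrite -mulr_natr; lra.
suff -> : b = 0 by [].
move: hb; rewrite -mulr_natr ltr_norml => /andP[b1 b2].
case: (ltgtP b 0) => // b0.
  have : 0 < sin (- (b / 2)) by apply: sin_gt0_pi; lra.
  by rewrite sinN cb2 oppr0 ltxx.
have : 0 < sin (b / 2) by apply: sin_gt0_pi; lra.
by rewrite cb2 ltxx.
Qed.

Lemma cexp_inj_strip v w :
  cexp v = cexp w -> `|complex.Im v - complex.Im w| < pi *+ 2 -> v = w.
Proof.
move=> h hI; apply/eqP; rewrite -subr_eq0; apply/eqP/cexp_period.
  by rewrite cexpD cexpN h divff // cexp_neq0.
by rewrite ImD ImN.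
Qed.

Lemma carg_polar z : z != 0 ->
  cos (carg z) = complex.Re z / cabs z /\ sin (carg z) = complex.Im z / cabs z.
Proof.
move=> z0; have c0 : 0 < cabs z by rewrite cabs_gt0.
have hr : -1 <= complex.Re z / cabs z <= 1.
  have := cabs_Re z; rewrite ler_norml => /andP[h1 h2].
  by rewrite ler_pdivrMr // ler_pdivlMr // mulN1r mul1r h1 h2.
have hcos : cos (acos (complex.Re z / cabs z)) = complex.Re z / cabs z.
  by rewrite acosK // in_itv.
have hsin : sin (acos (complex.Re z / cabs z)) = `|complex.Im z| / cabs z.
  rewrite sin_acos //.
  have -> : 1 - (complex.Re z / cabs z) ^+ 2 = (`|complex.Im z| / cabs z) ^+ 2.
    rewrite !expr_div_n real_normK ?num_real //.
    have e2 : cabs z ^+ 2 = complex.Re z ^+ 2 + complex.Im z ^+ 2.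
      by case: (z) => a b; rewrite /cabs /= sqr_sqrtr // addr_ge0 // sqr_ge0.
    have : cabs z ^+ 2 != 0 by rewrite expf_neq0 // gt_eqF.
    by rewrite e2 => h; field.
  by rewrite sqrtr_sqr ger0_norm // divr_ge0 // ltW.
rewrite /carg; case: lerP => i0; rewrite ?cosN ?sinN hcos hsin; split=> //.
  by rewrite ger0_norm.
by rewrite ltr0_norm // mulNr opprK.
Qed.

Lemma cexp_cln z : z != 0 -> cexp (cln z) = z.
Proof.
move=> z0; have c0 : 0 < cabs z by rewrite cabs_gt0.
rewrite /cln cexpE lnK ?posrE //; have [-> ->] := carg_polar z0.
rewrite ![cabs z * _]mulrC !divfK ?gt_eqF //.
by case: (z).
Qed.

Lemma Re_cln z : complex.Re (cln z) = ln (cabs z).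
Proof. by []. Qed.

Lemma Im_cln_le_pi z : z != 0 -> `|complex.Im (cln z)| <= pi.
Proof.
move=> z0; have c0 : 0 < cabs z by rewrite cabs_gt0.
have hr : -1 <= complex.Re z / cabs z <= 1.
  have := cabs_Re z; rewrite ler_norml => /andP[h1 h2].
  by rewrite ler_pdivrMr // ler_pdivlMr // mulN1r mul1r h1 h2.
rewrite /= /carg; case: ifP => _; rewrite ?normrN ger0_norm ?acos_ge0 //;
  exact: acos_lepi.
Qed.

Lemma Im_cln_lt z : 0 < complex.Re z -> `|complex.Im (cln z)| < pi / 2.
Proof.
move=> r0.
have z0 : z != 0 by apply: contraTneq r0 => ->; rewrite ltxx.
have := Im_cln_le_pi z0; have [hc _] := carg_polar z0.
have : 0 < cos (carg z) by rewrite hc divr_gt0 // cabs_gt0.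
rewrite /= -cos_norm => h1 h2; rewrite ltNge; apply/negP => h3.
have : cos `|carg z| <= cos (pi / 2).
  move: h3; rewrite le_eqVlt => /orP[/eqP -> //|h3].
  rewrite ltW // ltr_cos // in_itv /=; have := pi_ge2 R; lra.
by rewrite cos_pihalf leNgt h1.
Qed.

Lemma cln_unique z v : z != 0 -> cexp v = z ->
  `|complex.Im v| < pi -> cln z = v.
Proof.
move=> z0 h hv; apply: cexp_inj_strip; first by rewrite h cexp_cln.
apply: (le_lt_trans (ler_normB _ _)).
by rewrite mulr2n ler_ltD // Im_cln_le_pi.
Qed.

Lemma clnM z w : 0 < complex.Re z -> 0 < complex.Re w ->
  cln (z * w) = cln z + cln w.
Proof.
move=> hz hw.
have z0 : z != 0 by apply: contraTneq hz => ->; rewrite ltxx.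
have w0 : w != 0 by apply: contraTneq hw => ->; rewrite ltxx.
apply: cln_unique; rewrite ?mulf_neq0 ?cexpD ?cexp_cln // ImD.
have := Im_cln_lt hz; have := Im_cln_lt hw.
have := ler_normD (complex.Im (cln z)) (complex.Im (cln w)).
by lra.
Qed.

Lemma Re_1B_gt0 u : cabs u < 1 -> 0 < complex.Re (1 - u).
Proof.
move=> h; rewrite ReD ReN /=; have := cabs_Re u.
by rewrite ler_norml; lra.
Qed.

Lemma cabs_1B_gt0 u : cabs u < 1 -> 0 < cabs (1 - u).
Proof. by move=> h; have := cabsB_ge 1 u; rewrite cabs1; lra. Qed.

Lemma norm_half_le_sin y : `|y| < pi / 2 -> `|sin y| <= 2^-1 :> R ->
  `|y| <= 2 * `|sin y|.
Proof.
have half : 2^-1 <= sin (1 : R).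
  have := @norm_sin_sub R 1; rewrite normr1 expr1n => /(_ (lexx _)).
  by rewrite ler_norml; lra.
wlog y0 : y / 0 <= y => [h|].
  have [/h //|/ltW y0] := leP 0 y.
  by rewrite -normrN -(normrN (sin y)) -sinN; apply: h; rewrite oppr_ge0.
rewrite (ger0_norm y0) => y1 hs.
have y2 : y <= 1.
  rewrite leNgt; apply/negP => hy.
  have : sin 1 < sin y.
    by rewrite ltr_sin // in_itv /=; have := pi_ge2 R; lra.
  by move: hs; have := ler_norm (sin y); lra.
have := @norm_sin_sub R y; rewrite (ger0_norm y0) => /(_ y2).
rewrite ler_norml => /andP[h1 _]; have := ler_norm (sin y).
by nra.
Qed.

Lemma cln_1B_bound u : cabs u <= 4^-1 ->
  cabs (cln (1 - u)) <= 6 * cabs u.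
Proof.
move=> h; have u1 : cabs u < 1 by lra.
have c0 := cabs_1B_gt0 u1.
have hz : 1 - u != 0 by rewrite -cabs_gt0.
have h1 : 1 - cabs u <= cabs (1 - u) by have := cabsB_ge 1 u; rewrite cabs1.
have h2 : cabs (1 - u) <= 1 + cabs u by have := cabsB 1 u; rewrite cabs1.
have u0 := cabs_ge0 u.
have hRe : `|complex.Re (cln (1 - u))| <= 2 * cabs u.
  rewrite Re_cln ler_norml; apply/andP; split.
    rewrite -ler_expR lnK ?posrE //; apply: le_trans h1.
    have := expR_ge1Dx (2 * cabs u).
    have : expR (- (2 * cabs u)) * expR (2 * cabs u) = 1.
      by rewrite -expRD addNr expR0.
    have := expR_gt0 (- (2 * cabs u)); set a := expR _; set b := expR _.
    by move=> a0 ab hb; nra.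
  rewrite -ler_expR lnK ?posrE //.
  by have := expR_ge1Dx (2 * cabs u); lra.
have hIm : `|complex.Im (cln (1 - u))| <= 4 * cabs u.
  have [_ hs] := carg_polar hz.
  have sb : `|sin (carg (1 - u))| <= 2 * cabs u.
    rewrite hs ImD ImN /= add0r normrM normrN normfV (ger0_norm (ltW c0)).
    rewrite ler_pdivrMr //; have := cabs_Im u => k1.
    by nra.
  have := @norm_half_le_sin (carg (1 - u)) (Im_cln_lt (Re_1B_gt0 u1)).
  by move=> /= k; have := k _; rewrite /=; lra.
by have := cabs_Re_Im (cln (1 - u)); lra.
Qed.

Lemma cln_1B_quad u : cabs u <= 12^-1 ->
  cabs (cln (1 - u) + u) <= 288 * cabs u ^+ 2.
Proof.
move=> h; have u0 := cabs_ge0 u.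
have b := @cln_1B_bound u ltac:(lra).
have hz : 1 - u != 0 by rewrite -cabs_gt0 cabs_1B_gt0 //; lra.
have := @cexp_quad (cln (1 - u)) ltac:(lra).
rewrite cexp_cln // cabsBC.
have -> : cln (1 - u) - (1 - u - 1) = cln (1 - u) + u by ring.
move=> h1; apply: le_trans h1 _.
by have := cabs_ge0 (cln (1 - u)); nra.
Qed.

End Exponential.

(** * Rising factorials and binomial coefficients *)

Section Rising.
Variable R : realType.
Notation C := (Cplx R).

Lemma rising0 (a : C) : rising a 0 = 1.
Proof. by rewrite /rising big_ord0. Qed.

Lemma risingS (a : C) n : rising a n.+1 = rising a n * (a + n%:R).
Proof. by rewrite /rising big_ord_recr. Qed.

Lemma risingD (a : C) n k :
  rising a (n + k) = rising a n * rising (a + n%:R) k.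
Proof.
elim: k => [|k IH]; first by rewrite addn0 rising0 mulr1.
by rewrite addnS !risingS IH -mulrA natrD addrA.
Qed.

(** The coefficient of z^n in (1 - z)^(- a). *)
Definition binc (a : C) n : C := rising a n / n`!%:R.

Definition rrising (b : R) n : R := \prod_(j < n) (b + j%:R).

Lemma rrisingS (b : R) n : rrising b n.+1 = rrising b n * (b + n%:R).
Proof. by rewrite /rrising big_ord_recr. Qed.

Lemma rrising_ge0 (b : R) n : 0 <= b -> 0 <= rrising b n.
Proof. by move=> b0; apply: prodr_ge0 => i _; rewrite addr_ge0. Qed.

Lemma cabs_rising (a : C) n : cabs (rising a n) <= rrising (cabs a) n.
Proof.
rewrite /rising cabs_prod; apply: ler_prod => i _.
by rewrite cabs_ge0 (le_trans (cabsD _ _)) // cabs_nat.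
Qed.

Lemma rising_real (b : R) n : rising (b%:C : C) n = (rrising b n)%:C.
Proof.
elim: n => [|n IH]; first by rewrite rising0 /rrising big_ord0.
by rewrite risingS rrisingS IH rmorphM rmorphD rmorph_nat.
Qed.

Definition rbinc (b : R) n : R := rrising b n / n`!%:R.

Lemma rbinc_ge0 (b : R) n : 0 <= b -> 0 <= rbinc b n.
Proof. by move=> b0; rewrite divr_ge0 ?rrising_ge0. Qed.

Lemma cabs_binc (a : C) n : cabs (binc a n) <= rbinc (cabs a) n.
Proof.
by rewrite /binc cabsM cabsV cabs_nat ler_wpM2r ?invr_ge0 // cabs_rising.
Qed.

Lemma binc_real (b : R) n : binc (b%:C : C) n = (rbinc b n)%:C.
Proof. by rewrite /binc rising_real rmorphM fmorphV rmorph_nat. Qed.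

Lemma fact_neq0 (K : numDomainType) n : n`!%:R != 0 :> K.
Proof. by rewrite pnatr_eq0 -lt0n fact_gt0. Qed.

Lemma fact_gt0R n : 0 < n`!%:R :> R.
Proof. by rewrite ltr0n fact_gt0. Qed.

Lemma bincS (a : C) n : n.+1%:R * binc a n.+1 = (a + n%:R) * binc a n.
Proof.
rewrite /binc risingS factS natrM invfM.
have := fact_neq0 C n; have : n.+1%:R != 0 :> C by rewrite pnatr_eq0.
by move=> h1 h2; field; rewrite h2 addrC natr1 h1.
Qed.

Lemma binc0 (a : C) : binc a 0 = 1.
Proof. by rewrite /binc rising0 fact0 divr1. Qed.

Lemma binc1 (a : C) : binc a 1 = a.
Proof. by rewrite /binc risingS rising0 mul1r addr0 divr1. Qed.

Lemma bincD (a : C) n k :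
  'C(n + k, n)%:R * binc a (n + k) = binc a n * binc (a + n%:R) k.
Proof.
rewrite /binc risingD.
have h : 'C(n + k, n)%:R * (n`!%:R * k`!%:R) = (n + k)`!%:R :> C.
  by rewrite -!natrM -[in RHS](bin_fact (leq_addr k n)) addKn.
rewrite -h; have := fact_neq0 C n; have := fact_neq0 C k.
have : 'C(n + k, n)%:R != 0 :> C by rewrite pnatr_eq0 -lt0n bin_gt0 leq_addr.
by move=> h1 h2 h3; field; rewrite h1 h2 h3.
Qed.

(** The factors (b + n) / (n + 1) exceed a given q > 1 only finitely often, so
    their products over any range are at most a constant times a power of q. *)
Lemma rrising_range (b q : R) : 0 <= b -> 1 < q ->
  exists2 K : R, 0 < K & forall n L,
    rrising (b + n%:R) L * n`!%:R <= K * q ^+ L * (n + L)`!%:R.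
Proof.
move=> b0 q1; have q0 : 0 < q by lra.
pose d n : R := Num.max 1 ((b + n%:R) / (q * n.+1%:R)).
have d1 n : 1 <= d n by rewrite /d le_max lexx.
have dpos n : 0 < d n by exact: lt_le_trans (d1 n).
have [n0 hn0] : exists n0, forall n, (n0 <= n)%N -> d n = 1.
  have [n0 hn] : exists n0, b / (q - 1) < n0%:R.
    exists (Num.truncn (b / (q - 1))).+1.
    exact: truncnS_gt.
  exists n0 => n n0n; apply/max_idPl.
  rewrite ler_pdivrMr ?mulr_gt0 ?ltr0n // mul1r.
  have h : n0%:R <= n%:R :> R by rewrite ler_nat.
  move: hn; rewrite ltr_pdivrMr ?subr_gt0 // => hn.
  have : b <= n%:R * (q - 1).
    by apply: le_trans (ltW hn) _; rewrite ler_wpM2r // subr_ge0 ltW.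
  rewrite -[n.+1]addn1 natrD; nra.
pose D n := \prod_(i < n) d i.
have D1 n : 1 <= D n.
  elim: n => [|n IH]; first by rewrite /D big_ord0.
  by rewrite /D big_ord_recr /= -[leLHS]mulr1 ler_pM.
have Dn0 n : D n <= D n0.
  have mono m k : D m <= D (m + k)%N.
    elim: k => [|k IH]; first by rewrite addn0.
    rewrite addnS /D big_ord_recr /= (le_trans IH) // ler_peMr //.
    by rewrite ltW // (lt_le_trans ltr01).
  have [h|h] := leqP n n0; first by rewrite -(subnKC h).
  have e k : D (n0 + k)%N = D n0.
    elim: k => [|k IH]; first by rewrite addn0.
    by rewrite addnS /D big_ord_recr /= hn0 ?leq_addr // mulr1.
  by rewrite -(subnKC (ltnW h)) e.
exists (D n0) => [|n L]; first exact: lt_le_trans (D1 n0).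
suff h : rrising (b + n%:R) L * n`!%:R * D n <= D (n + L)%N * q ^+ L * (n + L)`!%:R.
  apply: (@le_trans _ _ (rrising (b + n%:R) L * n`!%:R * D n)).
    by rewrite ler_peMr // mulr_ge0 // rrising_ge0 // addr_ge0.
  apply: le_trans h _.
  by rewrite !ler_wpM2r ?exprn_ge0 // ltW.
elim: L => [|L IH].
  by rewrite addn0 /rrising big_ord0 expr0 mulr1 mul1r mulrC.
rewrite rrisingS addnS /D big_ord_recr /= -/(D _) exprS factS natrM.
have -> : rrising (b + n%:R) L * (b + n%:R + L%:R) * n`!%:R * D n =
  (rrising (b + n%:R) L * n`!%:R * D n) * (b + (n + L)%:R) by rewrite natrD; ring.
have -> : D (n + L)%N * d (n + L)%N * (q * q ^+ L) * ((n + L).+1%:R * (n + L)`!%:R)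
  = (D (n + L)%N * q ^+ L * (n + L)`!%:R) * (d (n + L)%N * (q * (n + L).+1%:R)).
  by ring.
apply: ler_pM => //.
- by rewrite !mulr_ge0 ?rrising_ge0 ?addr_ge0 // ltW // (lt_le_trans ltr01).
- by rewrite addr_ge0.
- by rewrite -ler_pdivrMr ?mulr_gt0 ?ltr0n // /d le_max lexx orbT.
Qed.

Lemma geometric_sum_le (s : R) n : 0 <= s -> s < 1 ->
  \sum_(i < n) s ^+ i <= (1 - s)^-1.
Proof.
move=> s0 s1; have h : 0 < 1 - s by lra.
rewrite -[leRHS]mul1r ler_pdivlMr // mulrC.
have := subrX1 s n; have := exprn_ge0 n s0.
by set S := \sum_(i < n) _; nra.
Qed.

End Rising.

(** * Re-expansion of power series *)

Section Taylor.
Variable R : realType.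
Notation C := (Cplx R).
Implicit Types (p : nat -> C) (c h : C).

(** Indexing by the exponent j of the power series, rather than by j - n, makes
    the terms with j < n vanish and spares every shift of index. *)
Definition taylor_term p n c (j : nat) : C := 'C(j, n)%:R * p j * c ^+ (j - n).

(** The n-th Taylor coefficient at c of the sum of the power series. *)
Definition taylor p n c : C := tsum (taylor_term p n c).

Lemma bin_exp_le (x y : R) j n : 0 <= x -> 0 <= y -> (n <= j)%N ->
  'C(j, n)%:R * x ^+ (j - n) * y ^+ n <= (x + y) ^+ j.
Proof.
move=> x0 y0 nj; rewrite exprDn.
rewrite (bigD1 (Ordinal (_ : (n < j.+1)%N))) //=.
rewrite -[X in X <= _]addr0 lerD //.
  by rewrite -mulrA mulr_natl.
by apply: sumr_ge0 => i _; rewrite mulrn_wge0 // mulr_ge0 ?exprn_ge0.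
Qed.

Lemma bounded_sums_taylor p n (s r : R) : 0 <= s -> s < r ->
  bounded_sums (fun j => cabs (p j) * r ^+ j) ->
  bounded_sums (fun j => 'C(j, n)%:R * cabs (p j) * s ^+ (j - n)).
Proof.
move=> s0 sr hp; have rs : 0 < r - s by lra.
have e0 : 0 < (r - s) ^+ n by exact: exprn_gt0.
apply: bounded_sums_le (bounded_sumsZ (ltW (_ : 0 < ((r - s) ^+ n)^-1)) hp).
  move=> j; have [jn|nj] := ltnP j n.
    rewrite bin_small // !mul0r !mulr_ge0 ?invr_ge0 ?exprn_ge0 ?cabs_ge0 //; lra.
  rewrite ler_pdivlMl // mulrC.
  have := bin_exp_le s0 (ltW rs) nj; rewrite subrKC => h.
  have -> : 'C(j, n)%:R * cabs (p j) * s ^+ (j - n) * (r - s) ^+ n =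
    cabs (p j) * ('C(j, n)%:R * s ^+ (j - n) * (r - s) ^+ n) by ring.
  by rewrite ler_wpM2l ?cabs_ge0.
by rewrite invr_gt0.
Qed.

Lemma absum_taylor p n c (r : R) : cabs c < r ->
  bounded_sums (fun j => cabs (p j) * r ^+ j) -> absum (taylor_term p n c).
Proof.
move=> cr /(bounded_sums_taylor n (cabs_ge0 c) cr); apply: absum_le => j.
by rewrite !cabsM cabsX cabs_nat.
Qed.

Lemma bin_bin j n i : (n + i <= j)%N ->
  ('C(j, n + i) * 'C(n + i, n) = 'C(j, n) * 'C(j - n, i))%N.
Proof.
move=> h; have nj : (n <= j)%N by rewrite (leq_trans _ h) ?leq_addr.
have ij : (i <= j - n)%N by rewrite leq_subRL.
have f0 : (0 < n`! * (i`! * (j - n - i)`!))%N by rewrite !muln_gt0 !fact_gt0.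
apply/eqP; rewrite -(eqn_pmul2r f0); apply/eqP.
transitivity j`!.
  rewrite -(bin_fact h) subnDA -[in RHS](bin_fact (leq_addr i n)) addKn; ring.
by rewrite -(bin_fact nj) -(bin_fact ij); ring.
Qed.

Lemma taylor_shift_term p n c h j (m : nat) : (j <= m + n)%N ->
  \sum_(i < m.+1) 'C(n + i, n)%:R * h ^+ i * taylor_term p (n + i) c j =
  taylor_term p n (c + h) j.
Proof.
move=> jm; rewrite /taylor_term.
have [jn|nj] := ltnP j n.
  rewrite bin_small // !mul0r big1 // => i _.
  by rewrite ['C(j, _)]bin_small ?mul0r ?mulr0 // (leq_trans jn) ?leq_addr.
rewrite exprDn mulr_sumr.
have le : ((j - n).+1 <= m.+1)%N by rewrite ltnS leq_subLR addnC.
rewrite [RHS](big_ord_widen _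
  (fun i => 'C(j, n)%:R * p j * (c ^+ (j - n - i) * h ^+ i *+ 'C(j - n, i))) le).
rewrite [RHS]big_mkcond /=; apply: eq_bigr => i _.
rewrite ltnS leq_subRL //; case: ifPn => hi; last first.
  by rewrite ['C(j, _)]bin_small ?mul0r ?mulr0 // ltnNge.
have := bin_bin hi => /(congr1 (fun x => x%:R : C)); rewrite !natrM => e.
rewrite subnDA -[_ * _ *+ _]mulr_natr.
have -> : 'C(n + i, n)%:R * h ^+ i * ('C(j, n + i)%:R * p j * c ^+ (j - n - i)) =
  ('C(j, n + i)%:R * 'C(n + i, n)%:R) * (p j * c ^+ (j - n - i) * h ^+ i) :> C by ring.
by rewrite e; ring.
Qed.

Lemma taylor_term_real (p : nat -> R) n (c : R) j :
  taylor_term (fun j => (p j)%:C : C) n c%:C j =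
  ('C(j, n)%:R * p j * c ^+ (j - n))%:C.
Proof. by rewrite /taylor_term !rmorphM rmorphXn rmorph_nat. Qed.

(** Re-expanding a power series at c + h gives the same Taylor coefficients as
    re-expanding it first at c: the double series obtained from the binomial
    theorem is dominated by the re-expansion of sum_j |p_j| z^j at |c| + |h|. *)
Lemma taylor_shift p n c h (r : R) : cabs c + cabs h < r ->
  bounded_sums (fun j => cabs (p j) * r ^+ j) ->
  absum (fun i => 'C(n + i, n)%:R * h ^+ i * taylor p (n + i) c) /\
  tsum (fun i => 'C(n + i, n)%:R * h ^+ i * taylor p (n + i) c) =
  taylor p n (c + h).
Proof.
move=> chr hp.
have ch0 : 0 <= cabs c + cabs h by rewrite addr_ge0 ?cabs_ge0.
have cr : cabs c < r by have := cabs_ge0 h; lra.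
pose f j i := 'C(n + i, n)%:R * h ^+ i * taylor_term p (n + i) c j.
have partial_le j m :
    \sum_(i < m) cabs (f j i) <=
    'C(j, n)%:R * cabs (p j) * (cabs c + cabs h) ^+ (j - n).
  have -> : 'C(j, n)%:R * cabs (p j) * (cabs c + cabs h) ^+ (j - n) =
      complex.Re (taylor_term (fun j => (cabs (p j))%:C) n
        ((cabs c)%:C + (cabs h)%:C) j).
    by rewrite -rmorphD taylor_term_real /=.
  rewrite -(@taylor_shift_term _ n _ _ j (m + j)); last first.
    by rewrite addnAC leq_addl.
  rewrite Re_sum.
  have le : (m <= (m + j).+1)%N by rewrite -addnS leq_addr.
  have E i : complex.Re ('C(n + i, n)%:R * (cabs h)%:C ^+ i *
      taylor_term (fun j0 => (cabs (p j0))%:C) (n + i) (cabs c)%:C j) =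
      cabs (f j i).
    rewrite /f taylor_term_real -rmorphXn -[X in X * _ * _](rmorph_nat (real_complex R)) -!rmorphM.
    by rewrite /taylor_term !cabsM !cabsX !cabs_nat.
  under [leRHS]eq_bigr do rewrite E.
  rewrite (big_ord_widen _ (fun i => cabs (f j i)) le) big_mkcond /=.
  by apply: ler_sum => i _; case: ifP => // _; exact: cabs_ge0.
have [h1 h2 h3] := sum_exchange (bounded_sums_taylor n ch0 chr hp) partial_le.
have e1 i : tsum (f ^~ i) = 'C(n + i, n)%:R * h ^+ i * taylor p (n + i) c.
  by apply: has_sum_tsum; apply: has_sumZ; exact: absum_has_sum (absum_taylor _ cr hp).
have e2 j : tsum (f j) = taylor_term p n (c + h) j.
  apply: has_sum_tsum => e e0; exists (fset_below j.+1) => B jB.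
  rewrite (fsum_split _ jB) sum_fset_below taylor_shift_term ?leq_addr //.
  rewrite big_seq big1 ?addr0 ?subrr ?cabs0 // => i.
  rewrite in_fsetD in_fset_below -leqNgt => /andP[ij _].
  by rewrite /f /taylor_term ['C(j, _)]bin_small ?mul0r ?mulr0 // ltn_addl.
have -> : (fun i => 'C(n + i, n)%:R * h ^+ i * taylor p (n + i) c) =
    (fun i => tsum (f ^~ i)) by apply/funext => i; rewrite e1.
by split=> //; rewrite h3; congr tsum; apply/funext.
Qed.

Lemma taylor0 p c : taylor p 0 c = tsum (fun j => p j * c ^+ j).
Proof.
by congr tsum; apply/funext => j; rewrite /taylor_term bin0 mul1r subn0.
Qed.

Lemma taylor_at0 p n : taylor p n 0 = p n.
Proof.
apply: has_sum_tsum => e e0; exists (fset_below n.+1) => B jB.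
rewrite (fsum_split _ jB) sum_fset_below big_ord_recr /= big1.
  rewrite add0r {1}/taylor_term binn subnn expr0 mulr1 mul1r.
  rewrite big_seq big1 ?addr0 ?subrr ?cabs0 // => i.
  rewrite in_fsetD in_fset_below -leqNgt => /andP[ij _].
  by rewrite /taylor_term expr0n subn_eq0 leqNgt ij mulr0.
by move=> i _; rewrite /taylor_term bin_small // !mul0r.
Qed.

End Taylor.

(** * The functional equation of the binomial series *)

Section Binomial.
Variable R : realType.
Notation C := (Cplx R).
Implicit Types (a c h u t : C).

Lemma bounded_geometric (s : R) : 0 <= s -> s < 1 ->
  bounded_sums (fun i : nat => s ^+ i).
Proof.
move=> s0 s1; exists (1 - s)^-1; apply: bounded_sums_nat => [i|n].
  exact: exprn_ge0.
exact: geometric_sum_le.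
Qed.

Lemma bounded_rbinc (b r : R) : 0 <= b -> 0 <= r -> r < 1 ->
  bounded_sums (fun j => rbinc b j * r ^+ j).
Proof.
move=> b0 r0 r1.
pose q := 2 / (1 + r).
have q1 : 1 < q by rewrite ltr_pdivlMr; lra.
have qr : q * r < 1 by rewrite /q mulrAC ltr_pdivrMr; lra.
have qr0 : 0 <= q * r by rewrite mulr_ge0 //; lra.
have [K K0 hK] := rrising_range b0 q1.
apply: bounded_sums_le (bounded_sumsZ (ltW K0) (bounded_geometric qr0 qr)) => j.
rewrite exprMn mulrA ler_wpM2r ?exprn_ge0 // /rbinc ler_pdivrMr ?fact_gt0R //.
by have := hK 0%N j; rewrite addr0 fact0 mulr1 add0n.
Qed.

Lemma bounded_binc a (r : R) : 0 <= r -> r < 1 ->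
  bounded_sums (fun j => cabs (binc a j) * r ^+ j).
Proof.
move=> r0 r1; apply: bounded_sums_le (bounded_rbinc (cabs_ge0 a) r0 r1) => j.
by rewrite ler_wpM2r ?exprn_ge0 // cabs_binc.
Qed.

Definition binseries a (z : C) : C := tsum (fun j => binc a j * z ^+ j).

Lemma tsum_behead (f : nat -> C) : absum f -> f 0%N = 0 ->
  tsum f = tsum (fun j => f j.+1).
Proof.
move=> hf f0; apply/esym/tsum_nat.
  have [M hM] := hf; exists M; apply: bounded_sums_nat => [i|n].
    exact: cabs_ge0.
  apply: le_trans (hM (fset_below n.+1)).
  by rewrite sum_fset_below big_ord_recl lerDr cabs_ge0.
move=> e e0; have [n0 _ h] := has_sum_nat (absum_has_sum hf) e0.
exists n0 => // n /= n0n; have := h n.+1 (leqW n0n).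
by rewrite big_ord_recl f0 add0r.
Qed.

(** The differential equation (1 - z) y' = a y of y = (1 - z)^(- a),
    differentiated k times and read on Taylor coefficients at c. *)
Lemma taylor_binc_rec a c k : cabs c < 1 ->
  (1 - c) * (k.+1%:R * taylor (binc a) k.+1 c) =
  (a + k%:R) * taylor (binc a) k c.
Proof.
move=> c1.
have [r cr r1] : exists2 r, cabs c < r & r < 1.
  by exists ((cabs c + 1) / 2); lra.
have hb : bounded_sums (fun j => cabs (binc a j) * r ^+ j).
  by apply: bounded_binc => //; have := cabs_ge0 c; lra.
have hk n := absum_taylor n cr hb.
have hs n := absum_has_sum (hk n).
have shift : taylor (binc a) k.+1 c =
    tsum (fun j => taylor_term (binc a) k.+1 c j.+1).
  by apply: tsum_behead => //; rewrite /taylor_term bin0n !mul0r.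
have e1 : has_sum (fun j => (a + j%:R) * taylor_term (binc a) k c j)
    (k.+1%:R * taylor (binc a) k.+1 c).
  rewrite shift.
  have : has_sum (fun j => taylor_term (binc a) k.+1 c j.+1)
    (tsum (fun j => taylor_term (binc a) k.+1 c j.+1)).
    apply: absum_has_sum; have [M hM] := hk k.+1.
    exists M; apply: bounded_sums_nat => [i|n]; first exact: cabs_ge0.
    apply: le_trans (hM (fset_below n.+1)).
    by rewrite sum_fset_below big_ord_recl lerDr cabs_ge0.
  move/(has_sumZ k.+1%:R); apply: has_sum_ext => j.
  rewrite /taylor_term subSS.
  have := mul_bin_diag j.+1 k => /(congr1 (fun x => x%:R : C)); rewrite !natrM => e.
  have -> : k.+1%:R * ('C(j.+1, k.+1)%:R * binc a j.+1 * c ^+ (j - k)) =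
     (k.+1%:R * 'C(j.+1, k.+1)%:R) * binc a j.+1 * c ^+ (j - k) :> C by ring.
  rewrite -e.
  have -> : j.+1%:R * 'C(j, k)%:R * binc a j.+1 * c ^+ (j - k) =
    'C(j, k)%:R * c ^+ (j - k) * (j.+1%:R * binc a j.+1) :> C by ring.
  by rewrite bincS; ring.
have e2 : has_sum (fun j => (j%:R - k%:R) * taylor_term (binc a) k c j)
    (c * (k.+1%:R * taylor (binc a) k.+1 c)).
  rewrite mulrA.
  apply: has_sum_ext (has_sumZ (c * k.+1%:R) (hs k.+1)) => j.
  rewrite /taylor_term.
  have [jk|kj] := ltnP j k.
    by rewrite !bin_small ?(leqW jk) // !(mul0r, mulr0).
  move: kj; rewrite leq_eqVlt => /orP[/eqP <-|kj].
    by rewrite bin_small ?subrr // !(mul0r, mulr0).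
  have := mul_bin_left j k => /(congr1 (fun x => x%:R : C)); rewrite !natrM.
  rewrite natrB 1?ltnW // => e.
  have -> : c * k.+1%:R * ('C(j, k.+1)%:R * binc a j * c ^+ (j - k.+1)) =
    (k.+1%:R * 'C(j, k.+1)%:R) * binc a j * (c ^+ (j - k.+1) * c) :> C by ring.
  by rewrite e -exprSr -subSn // subSS; ring.
apply: has_sum_unique (has_sumZ (a + k%:R) (hs k)).
rewrite mulrBl mul1r -[- (c * _)]mulN1r.
apply: has_sum_ext (has_sumD e1 (has_sumZ (-1) e2)) => j.
by ring.
Qed.

Lemma taylor_binc a c k : cabs c < 1 ->
  taylor (binc a) k c = binc a k * (1 - c) ^- k * binseries a c.
Proof.
move=> c1; have n0 : 1 - c != 0 by rewrite -cabs_gt0 cabs_1B_gt0.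
elim: k => [|k IH]; first by rewrite taylor0 binc0 expr0 invr1 !mul1r.
have := taylor_binc_rec a k c1; rewrite IH => h.
have k0 : k.+1%:R != 0 :> C by rewrite pnatr_eq0.
apply: (mulfI (mulf_neq0 n0 k0)).
rewrite -mulrA h exprS invfM.
have -> : (1 - c) * k.+1%:R * (binc a k.+1 * ((1 - c)^-1 * (1 - c) ^- k) * binseries a c)
  = ((1 - c) * (1 - c)^-1) * (k.+1%:R * binc a k.+1) * (1 - c) ^- k * binseries a c by ring.
by rewrite divff // bincS; ring.
Qed.

(** By taylor_binc, the re-expansion at c of the binomial series is its value
    at c times the binomial series in h / (1 - c). *)
Lemma binseriesM a c h : cabs c + cabs h < 1 ->
  binseries a (c + h) = binseries a c * binseries a (h / (1 - c)).
Proof.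
move=> ch; have c1 : cabs c < 1 by have := cabs_ge0 h; lra.
have n0 : 1 - c != 0 by rewrite -cabs_gt0 cabs_1B_gt0.
have [r cr r1] : exists2 r, cabs c + cabs h < r & r < 1.
  by exists ((cabs c + cabs h + 1) / 2); lra.
have hb : bounded_sums (fun j => cabs (binc a j) * r ^+ j).
  by apply: bounded_binc => //; have := cabs_ge0 c; have := cabs_ge0 h; lra.
have [h1 h2] := taylor_shift 0 cr hb.
rewrite taylor0 -/(binseries a (c + h)) in h2.
rewrite -h2; apply: has_sum_tsum.
apply: has_sum_ext (has_sumZ (binseries a c) (absum_has_sum _)) => [j|].
  rewrite add0n bin0 mul1r taylor_binc // exprMn exprVn.
  by ring.
have : cabs (h / (1 - c)) < 1.
  rewrite cabsM cabsV ltr_pdivrMr ?cabs_1B_gt0 // mul1r.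
  by have := cabsB_ge 1 c; rewrite cabs1; lra.
move=> u1; apply: absum_le (bounded_binc a (cabs_ge0 _) u1) => j.
by rewrite cabsM cabsX.
Qed.

Lemma binseries_quad a : exists2 K : R, 0 <= K & forall u, cabs u <= 2^-1 ->
  cabs (binseries a u - 1 - a * u) <= K * cabs u ^+ 2.
Proof.
have hh : 0 <= (2^-1 : R) by lra.
have [M hM] := bounded_binc a hh ltac:(lra).
exists (4 * M) => [|u hu].
  by have := hM fset0; rewrite big_seq_fset0; lra.
have habs : absum (fun j => binc a j * u ^+ j).
  apply: absum_le (bounded_binc a (cabs_ge0 u) ltac:(lra)) => j.
  by rewrite cabsM cabsX.
apply/ler_addgt0Pl => e e0.
have [n _ hn] := has_sum_nat (absum_has_sum habs) e0.
have := hn n.+2 (leq_trans (leqnSn _) (leqnSn _)).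
rewrite -/(binseries a u) !big_ord_recl /= expr0 binc0 expr1 binc1 mulr1.
set S := \sum_(i < n) _ => h.
have hS : cabs S <= 4 * M * cabs u ^+ 2.
  apply: le_trans (cabs_sum _ _ _) _.
  apply: (@le_trans _ _ (\sum_(i < n) 4 * (cabs (binc a i.+2) * 2^-1 ^+ i.+2) * cabs u ^+ 2)).
    apply: ler_sum => i _.
    change (cabs (binc a i.+2 * u ^+ i.+2) <=
      4 * (cabs (binc a i.+2) * 2^-1 ^+ i.+2) * cabs u ^+ 2).
    rewrite cabsM cabsX.
    have -> : (i.+2 = 2 + i)%N by [].
    rewrite !exprD.
    have -> : 4 * (cabs (binc a (2 + i)) * (2^-1 ^+ 2 * 2^-1 ^+ i)) * cabs u ^+ 2 =
      cabs (binc a (2 + i)) * (cabs u ^+ 2 * 2^-1 ^+ i) by field.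
    rewrite ler_wpM2l ?cabs_ge0 // ler_wpM2l ?exprn_ge0 ?cabs_ge0 //.
    by rewrite lerXn2r ?nnegrE ?cabs_ge0.
  rewrite -mulr_suml ler_wpM2r ?exprn_ge0 ?cabs_ge0 // -mulr_sumr.
  rewrite ler_wpM2l //; apply: le_trans (hM (fset_below n.+2)).
  rewrite sum_fset_below !big_ord_recl /=.
  have := cabs_ge0 (binc a 0); have := cabs_ge0 (binc a 1) => p1 p0.
  rewrite addrA lerDr addr_ge0 // mulr_ge0 ?exprn_ge0 //.
have -> : binseries a u - 1 - a * u = S - (1 + (a * u + S) - binseries a u) by ring.
by have := cabsB S (1 + (a * u + S) - binseries a u); lra.
Qed.

Lemma near_one_prod (N : nat) (f : nat -> C) (x : R) : 0 <= x ->
  f 0%N = 1 -> (forall i, (i < N)%N -> cabs (f i.+1 - f i) <= cabs (f i) * x) ->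
  cabs (f N - 1) <= (1 + x) ^+ N - 1.
Proof.
move=> x0 f0 hf.
suff : forall i, (i <= N)%N -> cabs (f i - 1) <= (1 + x) ^+ i - 1 by apply.
elim=> [|i IH] iN; first by rewrite f0 expr0 !subrr cabs0.
have := IH (ltnW iN); have := hf i iN.
have := cabsD (f i.+1 - f i) (f i - 1); rewrite addrA subrK.
have := cabsD (f i - 1) 1; rewrite subrK cabs1 exprS.
have := cabs_ge0 (f i); have := cabs_ge0 (f i - 1).
by set y := (1 + x) ^+ i; nra.
Qed.

End Binomial.

(** * The binomial theorem for complex exponents *)

Section BinomialTheorem.
Variable R : realType.
Notation C := (Cplx R).
Implicit Types (a c h u t w : C).

Lemma expR_quad_small (x : R) : 0 <= x -> x <= 2^-1 -> expR x - 1 <= 2 * x.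
Proof.
move=> x0 x1; have := @expR_quad R x; rewrite ger0_norm // => /(_ x1).
rewrite ler_norml => /andP[_]; nra.
Qed.

(** Both factors are known to second order, binseries a u = 1 + a u + O(u^2)
    and (1 - u)^a = 1 - a u + O(u^2), hence the product is 1 + O(u^2). *)
Lemma binseries_cexp_quad a : exists2 K : R, 0 <= K &
  exists2 d : R, 0 < d & forall u, cabs u <= d ->
  cabs (binseries a u * cexp (a * cln (1 - u)) - 1) <= K * cabs u ^+ 2.
Proof.
have [K1 K10 hB] := binseries_quad a.
set A := cabs a; have A0 : 0 <= A by exact: cabs_ge0.
pose d := (12 * (A + 1) * (K1 + 1))^-1.
have d0 : 0 < d by rewrite invr_gt0; nra.
have d1 : d <= 12^-1 by rewrite lef_pV2 ?posrE; nra.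
have dA : d * (12 * (A + 1)) <= 1.
  by rewrite /d mulrC ler_pdivrMr; nra.
pose K2 := 288 * A + 8 * (6 * A) ^+ 2.
have K20 : 0 <= K2 by rewrite /K2; have := sqr_ge0 (6 * A); nra.
have hE u : cabs u <= d ->
    cabs (cexp (a * cln (1 - u)) - 1 + a * u) <= K2 * cabs u ^+ 2.
  move=> ud; have u0 := cabs_ge0 u.
  have l1 := @cln_1B_bound R u ltac:(lra).
  have l2 := @cln_1B_quad R u ltac:(lra).
  have small : cabs (a * cln (1 - u)) <= 6 * A * cabs u.
    rewrite cabsM -/A; have := cabs_ge0 (cln (1 - u)); nra.
  have q := @cexp_quad R (a * cln (1 - u)) ltac:(nra).
  have -> : cexp (a * cln (1 - u)) - 1 + a * u =
    (cexp (a * cln (1 - u)) - 1 - a * cln (1 - u)) + a * (cln (1 - u) + u) by ring.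
  apply: le_trans (cabsD _ _) _; rewrite cabsM -/A.
  have : cabs (a * cln (1 - u)) ^+ 2 <= (6 * A) ^+ 2 * cabs u ^+ 2.
    by rewrite -exprMn lerXn2r ?nnegrE ?cabs_ge0 //; nra.
  have : A * cabs (cln (1 - u) + u) <= A * (288 * cabs u ^+ 2) by rewrite ler_wpM2l.
  rewrite /K2; lra.
pose K := A ^+ 2 + K1 * (1 + A + K2) + K2 * (1 + A).
have p1 : 0 <= A ^+ 2 by exact: sqr_ge0.
have p2 : 0 <= K1 * (1 + A + K2) by rewrite mulr_ge0 //; lra.
have p3 : 0 <= K2 * (1 + A) by rewrite mulr_ge0 //; lra.
exists K; first by rewrite /K; lra.
exists d => // u ud; have u0 := cabs_ge0 u.
have b1 := hB u ltac:(lra); have b2 := hE u ud.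
set B := binseries a u in b1 *; set E := cexp _ in b2 *.
have -> : B * E - 1 = (B - 1 - a * u) * E + (1 + a * u) * (E - 1 + a * u)
   - (a * u) ^+ 2 by ring.
have u1 : cabs u <= 1 by lra.
have Au : A * cabs u <= A by rewrite ler_piMr.
have Ku : K2 * cabs u ^+ 2 <= K2 by rewrite ler_piMr // exprn_ile1.
have Eb : cabs E <= 1 + A + K2.
  have -> : E = (E - 1 + a * u) + 1 - a * u by ring.
  have := cabsB (E - 1 + a * u + 1) (a * u); have := cabsD (E - 1 + a * u) 1.
  rewrite cabs1 cabsM -/A; lra.
have ab : cabs (1 + a * u) <= 1 + A.
  by have := cabsD 1 (a * u); rewrite cabs1 cabsM -/A; lra.
apply: le_trans (cabsB _ _) _; rewrite cabsX [cabs (a * u)]cabsM -/A exprMn.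
have := cabsD ((B - 1 - a * u) * E) ((1 + a * u) * (E - 1 + a * u)).
rewrite (cabsM _ E) (cabsM (1 + a * u)) => h.
have k1 : cabs (B - 1 - a * u) * cabs E <= K1 * cabs u ^+ 2 * (1 + A + K2).
  by rewrite ler_pM ?cabs_ge0.
have k2 : cabs (1 + a * u) * cabs (E - 1 + a * u) <= (1 + A) * (K2 * cabs u ^+ 2).
  by rewrite ler_pM ?cabs_ge0.
rewrite /K; lra.
Qed.

(** Along the segment s t, 0 <= s <= 1, the product of the binomial series and
    (1 - s t)^a is multiplied, in a step of length q, by a factor 1 + O(q^2),
    because both are multiplicative in 1 - s t.  So N = 1 / q steps change its
    initial value 1 by O(q) only, and it is constant. *)
Theorem binomial_series a t : cabs t < 1 ->
  binseries a t = cexp (- a * cln (1 - t)).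
Proof.
move=> t1; have t0 := cabs_ge0 t.
have [K K0 [d d0 hK]] := binseries_cexp_quad a.
suff h : binseries a t * cexp (a * cln (1 - t)) = 1.
  apply: (mulIf (cexp_neq0 (a * cln (1 - t)))).
  by rewrite h -cexpD mulNr addNr cexp0.
apply/eqP; rewrite -subr_eq0; apply/eqP/cabs_small_eq0 => e e0.
pose phi (s : R) := binseries a (s%:C * t) * cexp (a * cln (1 - s%:C * t)).
pose B := (1 - cabs t)^-1.
have B0 : 0 < B by rewrite invr_gt0; lra.
(* X is a number of steps beyond which each u is small enough for
   binseries_cexp_quad and the accumulated error is below e *)
pose X := B / d + K * B ^+ 2 * 2 + K * B ^+ 2 * 2 / e + 1.
have KB0 : 0 <= K * B ^+ 2 by rewrite mulr_ge0 // sqr_ge0.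
have X0 : 0 < X.
  by rewrite ltr_wpDl // !addr_ge0 // ?divr_ge0 ?mulr_ge0 // ltW.
pose N := (Num.truncn X).+1.
have hN : X < N%:R by exact: truncnS_gt.
have N0 : 0 < N%:R :> R by lra.
pose q := N%:R^-1 : R.
have q0 : 0 < q by rewrite invr_gt0.
have qN : q * N%:R = 1 by rewrite mulVf // gt_eqF.
have q1 : q <= 1 by rewrite invf_le1 // ler1n.
have Bd : q * B <= d.
  rewrite /q mulrC ler_pdivrMr // mulrC -ler_pdivrMr //.
  have : 0 <= K * B ^+ 2 * 2 / e by rewrite divr_ge0 ?mulr_ge0 // ltW.
  by rewrite /X in hN; lra.
have Kq2 : K * B ^+ 2 * q * 2 <= 1.
  rewrite mulrAC ler_pdivrMr // mul1r.
  have : 0 <= K * B ^+ 2 * 2 / e by rewrite divr_ge0 ?mulr_ge0 // ltW.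
  have : 0 <= B / d by rewrite divr_ge0 // ltW.
  by rewrite /X in hN; lra.
have Kqe : K * B ^+ 2 * q * 2 <= e.
  rewrite mulrAC ler_pdivrMr // [leRHS]mulrC -ler_pdivrMr //.
  have : 0 <= B / d by rewrite divr_ge0 // ltW.
  by rewrite /X in hN; lra.
pose f (i : nat) := phi (i%:R * q).
have f0 : f 0%N = 1.
  rewrite /f /phi mul0r mul0r subr0.
  have -> : cln (1 : C) = 0.
    apply: cln_unique; rewrite ?oner_eq0 ?cexp0 //= normr0; exact: pi_gt0.
  rewrite mulr0 cexp0 mulr1 /binseries -taylor0 taylor_at0.
  exact: binc0.
have fN : f N = binseries a t * cexp (a * cln (1 - t)).
  by rewrite /f mulrC qN /phi mul1r.
have step i : (i < N)%N -> cabs (f i.+1 - f i) <= cabs (f i) * (K * (q * B) ^+ 2).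
  move=> iN; pose c := (i%:R * q)%:C * t.
  pose h := q%:C * t.
  have ci : cabs c + cabs h < 1.
    rewrite /c /h !cabsM !cabs_real !ger0_norm ?mulr_ge0 // ?ltW //.
    have -> : i%:R * q * cabs t + q * cabs t = (i.+1%:R * q) * cabs t.
      by rewrite -natr1; ring.
    have h1 : i.+1%:R * q <= 1.
      by rewrite -[leRHS]qN mulrC ler_wpM2l ?ler_nat // ltW.
    have h2 : 0 <= i.+1%:R * q by apply: mulr_ge0 => //; exact: ltW.
    by nra.
  have ct : cabs c <= cabs t.
    rewrite /c cabsM cabs_real ger0_norm; last by apply: mulr_ge0 => //; exact: ltW.
    have h1 : i%:R * q <= 1.
      by rewrite -[leRHS]qN mulrC ler_wpM2l ?ler_nat ?(ltnW iN) ?(ltW q0).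
    by nra.
  have c1 : cabs c < 1 by lra.
  have nc : 1 - c != 0 by rewrite -cabs_gt0 cabs_1B_gt0.
  pose u := h / (1 - c).
  have hu : cabs u <= q * B.
    rewrite /u cabsM cabsV /h cabsM cabs_real ger0_norm ?(ltW q0) //.
    rewrite -mulrA ler_wpM2l ?(ltW q0) // /B.
    rewrite ler_pdivrMr ?cabs_1B_gt0 // mulrC ler_pdivlMr ?subr_gt0 //.
    by have := cabsB_ge 1 c; rewrite cabs1; nra.
  have u1 : cabs u < 1.
    rewrite /u cabsM cabsV ltr_pdivrMr ?cabs_1B_gt0 // mul1r.
    by have := cabsB_ge 1 c; rewrite cabs1; lra.
  have ef : f i.+1 = f i * (binseries a u * cexp (a * cln (1 - u))).
    have e1 : (i.+1%:R * q)%:C * t = c + h.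
      by rewrite /c /h -natr1 mulrDl mul1r rmorphD /= mulrDl.
    rewrite /f /phi -/c e1 binseriesM // -/u.
    have -> : 1 - (c + h) = (1 - c) * (1 - u).
      by rewrite mulrBr mulr1 /u mulrCA divff // mulr1 opprD addrA.
    rewrite clnM ?Re_1B_gt0 // mulrDr cexpD.
    exact: mulrACA.
  rewrite ef -[X in _ - X]mulr1 -mulrBr cabsM ler_wpM2l ?cabs_ge0 //.
  apply: le_trans (hK u _) _; first by apply: le_trans Bd.
  rewrite ler_wpM2l // lerXn2r ?nnegrE ?cabs_ge0 //.
  by rewrite mulr_ge0 // ltW.
rewrite -fN.
have x0 : 0 <= K * (q * B) ^+ 2 by rewrite mulr_ge0 // sqr_ge0.
apply: le_trans (near_one_prod x0 f0 step) _.
have : (1 + K * (q * B) ^+ 2) ^+ N <= expR (K * B ^+ 2 * q).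
  have -> : K * B ^+ 2 * q = N%:R * (K * (q * B) ^+ 2).
    by rewrite -[LHS]mulr1 -[X in _ * X = _]qN; ring.
  rewrite expRM_natl.
  rewrite lerXn2r ?nnegrE ?expR_ge0 ?expR_ge1Dx //; lra.
have := @expR_quad_small (K * B ^+ 2 * q).
have p0 : 0 <= K * B ^+ 2 * q by rewrite mulr_ge0 // ltW.
move=> /(_ p0) => h1 h2; have := h1 ltac:(lra); lra.
Qed.

Lemma cln_real (x : R) : 0 < x -> cln (x%:C : C) = (ln x)%:C.
Proof.
move=> x0; apply: cln_unique.
- by rewrite -cabs_gt0 cabs_real normr_gt0 gt_eqF.
- rewrite /cexp /= cos0 sin0 lnK ?posrE //.
  by rewrite mulr1.
- by rewrite /= normr0 pi_gt0.
Qed.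

Lemma cexp_real (x : R) : cexp (x%:C : C) = (expR x)%:C.
Proof. by rewrite /cexp /= cos0 sin0 mulr1. Qed.

Lemma has_sum_real_ge (I : choiceType) (f : I -> R) (S : C) :
  (forall i, 0 <= f i) -> has_sum (fun i => (f i)%:C : C) S ->
  forall A : {fset I}, \sum_(i <- A) f i <= complex.Re S.
Proof.
move=> f0 h A; apply/ler_addgt0Pl => e e0; have [B hB] := h e e0.
have := hB (A `|` B)%fset (fsubsetUr _ _).
have := fsum_subset f0 (fsubsetUl A B).
set y := \sum_(i <- (A `|` B)%fset) f i.
have -> : \sum_(i <- (A `|` B)%fset) (f i)%:C = y%:C :> C by rewrite rmorph_sum.
move=> h1 h2; have := cabs_Re (y%:C - S); rewrite ReD ReN /= ler_norml.
by lra.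
Qed.

(** The source of all dominations: partial sums of a binomial series with
    nonnegative terms are at most its value (1 - r)^(- b). *)
Lemma rbinc_sum_le (b r : R) n : 0 <= b -> 0 <= r -> r < 1 ->
  \sum_(j < n) rbinc b j * r ^+ j <= expR (- b * ln (1 - r)).
Proof.
move=> b0 r0 r1.
have h : has_sum (fun j => (rbinc b j * r ^+ j)%:C : C) (binseries b%:C r%:C).
  have : absum (fun j => binc (b%:C : C) j * r%:C ^+ j).
    apply: absum_le (bounded_binc b%:C r0 r1) => j.
    by rewrite cabsM cabsX cabs_real ger0_norm.
  move/absum_has_sum; apply: has_sum_ext => j.
  by rewrite binc_real -rmorphXn -rmorphM.
have cr : cabs (r%:C : C) < 1 by rewrite cabs_real ger0_norm.
have nn j : 0 <= rbinc b j * r ^+ j by rewrite mulr_ge0 ?rbinc_ge0 ?exprn_ge0.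
have := has_sum_real_ge nn h (fset_below n).
rewrite sum_fset_below binomial_series //.
have -> : (1 - r%:C : C) = (1 - r)%:C by rewrite rmorphB.
by rewrite cln_real ?subr_gt0 // -rmorphN -rmorphM cexp_real.
Qed.

End BinomialTheorem.

(** * Abel's theorem in a Stolz angle *)

Section AbelStolz.
Variable R : realType.
Notation C := (Cplx R).

Lemma near_bounded (f : nat -> C) (S : C) :
  (forall e : R, 0 < e -> \forall n \near \oo, cabs (f n - S) < e) ->
  exists B : R, forall n, cabs (f n - S) <= B.
Proof.
move=> h; have [n0 _ hn] := h 1 ltr01.
exists (1 + \sum_(i < n0) cabs (f i - S)) => n.
have s0 m : 0 <= \sum_(i < m) cabs (f i - S) by apply: sumr_ge0 => i _; exact: cabs_ge0.
have [nn|nn] := leqP n0 n.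
  by have := hn n nn; have := s0 n0; lra.
rewrite (bigD1 (Ordinal nn)) //=.
have : 0 <= \sum_(i < n0 | i != Ordinal nn) cabs (f i - S).
  by apply: sumr_ge0 => i _; exact: cabs_ge0.
by lra.
Qed.

(** Summation by parts against the remainders of the series. *)
Lemma abel_summation (q : nat -> C) (S z : C) n :
  \sum_(j < n) q j * z ^+ j - S =
  (\sum_(j < n) q j - S) * z ^+ n +
  (1 - z) * \sum_(j < n) ((\sum_(i < j.+1) q i - S) * z ^+ j).
Proof.
elim: n => [|n IH].
  by rewrite !big_ord0 expr0; ring.
rewrite [in LHS]big_ord_recr /= addrAC IH.
rewrite [\sum_(j < n.+1) (_ * _)]big_ord_recr /= exprS.
by rewrite ![\sum_(i < n.+1) q i]big_ord_recr /=; ring.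
Qed.

Lemma absum_bounded_geometric (q : nat -> C) (B : R) (z : C) :
  (forall n, cabs (q n) <= B) -> cabs z < 1 ->
  absum (fun j => q j * z ^+ j).
Proof.
move=> hq z1.
have B0 : 0 <= B by exact: le_trans (cabs_ge0 _) (hq 0%N).
apply: absum_le (bounded_sumsZ B0 (bounded_geometric (cabs_ge0 z) z1)) => j.
by rewrite cabsM cabsX ler_wpM2r ?exprn_ge0 ?cabs_ge0.
Qed.

(** Abel's theorem for non-tangential approach to the circle of convergence:
    after summation by parts the weights (1 - z) z^j have total mass at most K
    by the Stolz condition, and those of the first n0 indices tend to 0. *)
Lemma abel_stolz (q : nat -> C) (S : C) (K : R) :
  (forall e : R, 0 < e -> \forall n \near \oo, cabs (\sum_(j < n) q j - S) < e) ->
  forall e : R, 0 < e -> exists2 d : R, 0 < d & forall z : C,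
    cabs z < 1 -> cabs (1 - z) <= K * (1 - cabs z) -> cabs (1 - z) <= d ->
    cabs (tsum (fun j => q j * z ^+ j) - S) <= e.
Proof.
move=> hS e e0.
have [B hB] := near_bounded hS.
have B0 : 0 <= B by exact: le_trans (cabs_ge0 _) (hB 0%N).
have hq n : cabs (q n) <= 2 * B.
  have := hB n; have := hB n.+1; rewrite big_ord_recr /=.
  set s := \sum_(i < n) q i => h1 h2.
  have -> : q n = (s + q n - S) - (s - S) by ring.
  by have := cabsB (s + q n - S) (s - S); lra.
pose K1 := `|K| + 1.
have K10 : 0 < K1 by rewrite ltr_wpDl.
pose e1 := e / 2 / K1.
have e10 : 0 < e1 by rewrite !divr_gt0.
have [n0 _ hn0] := hS e1 e10.
pose d := e / 2 / (n0%:R * B + 1).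
have dd : 0 < n0%:R * B + 1 by rewrite ltr_wpDl // mulr_ge0.
exists d; first by rewrite !divr_gt0.
move=> z z1 zK zd.
have habs := absum_bounded_geometric hq z1.
have z0 := cabs_ge0 z.
have key n : cabs ((1 - z) * \sum_(j < n) ((\sum_(i < j.+1) q i - S) * z ^+ j)) <= e.
  rewrite cabsM.
  have : cabs (\sum_(j < n) ((\sum_(i < j.+1) q i - S) * z ^+ j)) <=
      \sum_(j < n) ((if (j < n0)%N then B else 0) + e1 * cabs z ^+ j).
    apply: le_trans (cabs_sum _ _ _) _; apply: ler_sum => j _.
    rewrite cabsM cabsX; have p1 : 0 <= cabs z ^+ j by exact: exprn_ge0.
    have p2 : cabs z ^+ j <= 1 by rewrite exprn_ile1 // ltW.
    case: ifPn => jn.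
      have := hB j.+1; have := cabs_ge0 (\sum_(i < j.+1) q i - S).
      set x := cabs _ => x0 xB.
      have : x * cabs z ^+ j <= x by rewrite ler_piMr.
      have : 0 <= e1 * cabs z ^+ j by rewrite mulr_ge0 // ltW.
      by lra.
    rewrite add0r ler_wpM2r // ltW //; apply: hn0 => /=.
    by rewrite ltnW // ltnS leqNgt.
  rewrite big_split /= -mulr_sumr => h.
  have h1 : \sum_(j < n) (if (j < n0)%N then B else 0) <= n0%:R * B.
    have -> : \sum_(j < n) (if (j < n0)%N then B else 0) = (minn n n0)%:R * B.
      elim: (n) => [|m IH]; first by rewrite big_ord0 min0n mul0r.
      rewrite big_ord_recr IH /=; case: (boolP (m < n0)%N) => mn.
        by rewrite (minn_idPl mn) (minn_idPl (ltnW mn)) -natr1 mulrDl mul1r.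
      rewrite -leqNgt in mn.
      by rewrite addr0 (minn_idPr mn) (minn_idPr (leqW mn)).
    by rewrite ler_wpM2r // ler_nat geq_minr.
  have h2 := geometric_sum_le n z0 z1.
  have h3 : e1 * \sum_(j < n) cabs z ^+ j <= e1 * (1 - cabs z)^-1.
    by rewrite ler_wpM2l // ltW.
  have b1 : cabs (1 - z) * (n0%:R * B) <= e / 2.
    apply: (@le_trans _ _ (d * (n0%:R * B + 1))).
      by rewrite ler_pM ?cabs_ge0 ?mulr_ge0 ?lerDl.
    by rewrite /d divfK // gt_eqF.
  have b2 : cabs (1 - z) * (e1 * (1 - cabs z)^-1) <= e / 2.
    have zz : 0 < 1 - cabs z by lra.
    rewrite mulrCA mulrA ler_pdivrMr //.
    apply: (@le_trans _ _ (e1 * (K1 * (1 - cabs z)))).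
      rewrite ler_wpM2l ?(ltW e10) // (le_trans zK) // ler_wpM2r ?(ltW zz) //.
      by rewrite /K1 (le_trans (ler_norm K)) // lerDl.
    by rewrite mulrA /e1 divfK // gt_eqF.
  have c0 := cabs_ge0 (1 - z).
  apply: le_trans (ler_wpM2l c0 h) _.
  apply: (@le_trans _ _ (cabs (1 - z) * (n0%:R * B + e1 * (1 - cabs z)^-1))).
    by rewrite ler_wpM2l // lerD.
  by rewrite mulrDr; lra.
apply/ler_addgt0Pl => eta eta0.
have eta2 : 0 < eta / 2 by rewrite divr_gt0.
have [n1 _ h1] := has_sum_nat (absum_has_sum habs) eta2.
have eB : 0 < eta / 2 / (B + 1) by rewrite divr_gt0 // ltr_wpDl.
have [n2 _ h2] : \forall n \near \oo, cabs z ^+ n < eta / 2 / (B + 1).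
  have := @cvg_expr R (cabs z); rewrite ger0_norm // => /(_ z1).
  move/cvgrPdist_lt => /(_ _ eB); apply: filterS => n.
  by rewrite sub0r normrN ger0_norm // exprn_ge0.
have := h1 (maxn n1 n2) (leq_maxl _ _); have := h2 (maxn n1 n2) (leq_maxr _ _).
set n := maxn n1 n2; set T := tsum _ => k2 k1.
have k3 : cabs ((\sum_(j < n) q j - S) * z ^+ n) <= eta / 2.
  rewrite cabsM cabsX.
  apply: (@le_trans _ _ (B * (eta / 2 / (B + 1)))).
    by rewrite ler_pM ?cabs_ge0 ?exprn_ge0 // ltW.
  by rewrite mulrCA ler_piMr ?(ltW eta2) // ler_pdivrMr ?ltr_wpDl // mul1r lerDl.
have := abel_summation q S z n; have := key n.
set X := (1 - z) * _ => kX E.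
have -> : T - S = (\sum_(j < n) q j - S) * z ^+ n + X - (\sum_(j < n) q j * z ^+ j - T).
  by rewrite -E; ring.
apply: le_trans (cabsB _ _) _.
by have := cabsD ((\sum_(j < n) q j - S) * z ^+ n) X; lra.
Qed.

End AbelStolz.

(** * The path of powers of 1 - t *)

Section PowerPath.
Variable R : realType.
Notation C := (Cplx R).
Variable t : C.
Hypothesis t1 : cabs t < 1.

(** The branch of - log (1 - z) for which cexp (a * mlog z) is the principal
    value of (1 - z)^(- a). *)
Definition mlog (z : C) : C := - cln (1 - z).

(** 1 - (1 - t)^tau, a path from 0 at tau = 0 to t at tau = 1. *)
Definition ppath (tau : R) : C := 1 - cexp (- (tau%:C * mlog t)).

Lemma cexp_mlog : cexp (- mlog t) = 1 - t.
Proof. by rewrite opprK cexp_cln // -cabs_gt0 cabs_1B_gt0. Qed.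

Lemma ppath0 : ppath 0 = 0.
Proof. by rewrite /ppath mul0r oppr0 cexp0 subrr. Qed.

Lemma ppath1 : ppath 1 = t.
Proof. by rewrite /ppath mul1r cexp_mlog; ring. Qed.

Lemma rrising_sign (tau : R) n : 0 <= tau -> tau <= 1 ->
  rrising (- tau) n.+1 <= 0.
Proof.
move=> t0 tau1; elim: n => [|n IH].
  by rewrite /rrising big_ord_recl big_ord0 /= addr0 mulr1 oppr_le0.
rewrite rrisingS mulr_le0_ge0 // addrC subr_ge0 (le_trans tau1) //.
by rewrite ler1n.
Qed.

(** The coefficient of z^n in 1 - (1 - z)^tau. *)
Definition pcoef (tau : R) (n : nat) : R := (n == 0)%N%:R - rbinc (- tau) n.

Lemma pcoef_ge0 tau n : 0 <= tau -> tau <= 1 -> 0 <= pcoef tau n.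
Proof.
move=> t0 tau1; case: n => [|n].
  by rewrite /pcoef eqxx /rbinc /rrising big_ord0 fact0 divr1 subrr.
rewrite /pcoef /= sub0r oppr_ge0 /rbinc mulr_le0_ge0 ?invr_ge0 //.
exact: rrising_sign.
Qed.

Lemma has_sum_pcoef tau (z : C) : cabs z < 1 ->
  has_sum (fun n => (pcoef tau n)%:C * z ^+ n) (1 - cexp (tau%:C * cln (1 - z))).
Proof.
move=> z1.
have h1 : has_sum (fun n : nat => ((n == 0)%N%:R : R)%:C * z ^+ n) 1.
  move=> e e0; exists (fset_below 1) => B hB.
  rewrite (fsum_split _ hB) sum_fset_below big_ord1 /= mul1r expr0.
  rewrite big_seq big1 ?addr0 ?subrr ?cabs0 // => i.
  rewrite in_fsetD in_fset_below -leqNgt => /andP[i0 _].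
  by rewrite gtn_eqF // mul0r.
have h2 : has_sum (fun n : nat => binc (- tau%:C) n * z ^+ n)
    (cexp (tau%:C * cln (1 - z))).
  rewrite -[tau%:C in X in has_sum _ X]opprK -binomial_series //.
  apply: absum_has_sum; apply: absum_le (bounded_binc (- tau%:C) (cabs_ge0 z) z1) => j.
  by rewrite cabsM cabsX.
rewrite -[- cexp _]mulN1r.
apply: has_sum_ext (has_sumD h1 (has_sumZ (-1) h2)) => n.
by rewrite /pcoef rmorphB /= -binc_real rmorphN /= mulrBl mulN1r.
Qed.

(** The power series of 1 - (1 - z)^tau has nonnegative coefficients, so on
    the circle |z| = |t| its modulus is largest at |t|. *)
Lemma cabs_ppath tau : 0 <= tau -> tau <= 1 ->
  cabs (ppath tau) <= 1 - expR (tau * ln (1 - cabs t)).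
Proof.
move=> tau0 tau1; have t0 := cabs_ge0 t.
have h1 : has_sum (fun n => (pcoef tau n)%:C * t ^+ n) (ppath tau).
  by rewrite /ppath /mlog mulrN opprK; exact: has_sum_pcoef.
have ct : cabs ((cabs t)%:C : C) < 1 by rewrite cabs_real ger0_norm.
have := has_sum_pcoef tau ct.
have -> : (1 - (cabs t)%:C : C) = (1 - cabs t)%:C by rewrite rmorphB.
rewrite cln_real ?subr_gt0 // -rmorphM cexp_real.
have -> : (1 - (expR (tau * ln (1 - cabs t)))%:C : C) =
   (1 - expR (tau * ln (1 - cabs t)))%:C by rewrite rmorphB.
move=> h2; have {}h2 : has_sum (fun n => (pcoef tau n * cabs t ^+ n)%:C : C)
    (1 - expR (tau * ln (1 - cabs t)))%:C.
  by apply: has_sum_ext h2 => n; rewrite rmorphM rmorphXn.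
have nn n : 0 <= pcoef tau n * cabs t ^+ n.
  by rewrite mulr_ge0 ?exprn_ge0 // pcoef_ge0.
apply: (has_sum_cabs_le h1) => B.
apply: le_trans (has_sum_real_ge nn h2 B).
apply: ler_sum => i _.
by rewrite cabsM cabsX cabs_real ger0_norm // pcoef_ge0.
Qed.

Lemma Re_mlog : complex.Re (mlog t) = - ln (cabs (1 - t)).
Proof. by rewrite /mlog ReN Re_cln. Qed.

Lemma Im_mlog : `|complex.Im (mlog t)| < pi / 2.
Proof. by rewrite /mlog ImN normrN Im_cln_lt // Re_1B_gt0. Qed.

Lemma cabs_cexp_le (w : C) : cabs (cexp w) <= expR (cabs w).
Proof. by rewrite cabs_cexp ler_expR (le_trans (ler_norm _)) // cabs_Re. Qed.

Lemma ppath_lip tau tau' : 0 <= tau -> tau <= 1 ->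
  `|tau' - tau| * cabs (mlog t) <= 2^-1 ->
  cabs (ppath tau' - ppath tau) <=
  expR (cabs (mlog t)) * (5 * (`|tau' - tau| * cabs (mlog t))).
Proof.
move=> tau0 tau1 small.
have -> : ppath tau' - ppath tau =
   - (cexp (- (tau%:C * mlog t)) * (cexp (- ((tau' - tau)%:C * mlog t)) - 1)).
  have e : - (tau'%:C * mlog t) =
      - (tau%:C * mlog t) + - ((tau' - tau)%:C * mlog t) :> C.
    by rewrite rmorphB /=; ring.
  by rewrite /ppath e cexpD; set x := cexp _; set y := cexp _; ring.
have e : cabs (- ((tau' - tau)%:C * mlog t)) = `|tau' - tau| * cabs (mlog t).
  by rewrite cabsN cabsM cabs_real.
rewrite cabsN cabsM -e ler_pM ?cabs_ge0 //; last by rewrite cexp_lip // e.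
apply: le_trans (cabs_cexp_le _) _; rewrite ler_expR cabsN cabsM cabs_real.
by rewrite ger0_norm // ler_piMl ?cabs_ge0.
Qed.

Hypothesis t_neq0 : t != 0.

(** Near tau = 1 the distance to t is O(1 - tau) and, by cabs_ppath, the
    distance to the circle |z| = |t| is at least of the order of 1 - tau, so
    the path reaches t within a Stolz angle. *)
Lemma ppath_stolz : exists2 K : R, 0 < K & exists2 d : R, 0 < d &
  forall tau, 0 <= tau -> tau < 1 -> 1 - tau <= d ->
  cabs (ppath tau) < cabs t /\
  cabs (t - ppath tau) <= K * (cabs t - cabs (ppath tau)).
Proof.
have t0 : 0 < cabs t by rewrite cabs_gt0.
set w := mlog t.
pose b := 1 - cabs t; have b0 : 0 < b by rewrite subr_gt0.
pose l := - ln b.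
have l0 : 0 < l by rewrite oppr_gt0 ln_lt0 // b0 /b; lra.
have eb : expR (ln b) = b by rewrite lnK ?posrE.
have w0 : 0 <= cabs w by exact: cabs_ge0.
pose K := (5 * expR (cabs w) * cabs w + 1) / (b * l).
have E0 := expR_gt0 (cabs w).
have bl : 0 < b * l by rewrite mulr_gt0.
exists K.
  by rewrite divr_gt0 // ltr_wpDl // !mulr_ge0 // ltW.
exists (2 * (cabs w + 1))^-1; first by rewrite invr_gt0 mulr_gt0 // ltr_wpDl.
move=> tau tau0 tau1 small.
have d0 : 0 < 1 - tau by lra.
have gap : b * ((1 - tau) * l) <= cabs t - cabs (ppath tau).
  have := cabs_ppath tau0 (ltW tau1); rewrite -/b.
  have -> : tau * ln b = ln b + (1 - tau) * l by rewrite /l; ring.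
  rewrite expRD eb; have := expR_ge1Dx ((1 - tau) * l).
  set x := (1 - tau) * l; set y := expR x => hy h.
  have : b * (1 + x) <= b * y by rewrite ler_wpM2l // ltW.
  by move: h; rewrite /b; lra.
have gap0 : 0 < b * ((1 - tau) * l) by rewrite !mulr_gt0.
split; first by lra.
have small' : `|1 - tau| * cabs w <= 2^-1.
  rewrite ger0_norm ?(ltW d0) //.
  apply: (@le_trans _ _ ((2 * (cabs w + 1))^-1 * (cabs w + 1))).
    by rewrite ler_pM ?(ltW d0) // lerDl.
  by rewrite invfM -mulrA mulVf ?mulr1 // gt_eqF // ltr_wpDl.
rewrite -{1}ppath1; apply: le_trans (ppath_lip tau0 (ltW tau1) small') _.
rewrite -/w ger0_norm ?(ltW d0) //.
apply: (@le_trans _ _ (K * (b * ((1 - tau) * l)))); last first.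
  rewrite ler_wpM2l // divr_ge0 ?(ltW bl) // addr_ge0 // !mulr_ge0 // ltW //.
have -> : K * (b * ((1 - tau) * l)) =
    (5 * expR (cabs w) * cabs w + 1) * (1 - tau).
  have -> : b * ((1 - tau) * l) = (b * l) * (1 - tau) by ring.
  by rewrite mulrA /K divfK // gt_eqF.
by nra.
Qed.

End PowerPath.

(** * Analytic continuation along the path *)

Section Continuation.
Variable R : realType.
Notation C := (Cplx R).
Variables (I : choiceType) (A : I -> C) (N : I -> R) (lam t : C) (s : R).
Hypothesis t1 : cabs t < 1.
Hypothesis N0 : forall i, 0 <= N i.
Hypotheses (s0 : 0 < s) (s1 : s < 1) (s_le : s <= cabs (1 - t)).
Hypothesis summ : bounded_sums (fun i => cabs (A i) * expR (- (N i * ln s))).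

Let a i : C := lam + (N i)%:C.
Let w : C := mlog t.
Let L : R := - ln s.

Lemma neg_ln_gt0 : 0 < L.
Proof. by rewrite oppr_gt0 ln_lt0 // s0 s1. Qed.

Lemma Re_w_le : complex.Re w <= L.
Proof.
rewrite /w Re_mlog /L lerN2 ler_ln ?posrE //.
exact: lt_le_trans s_le.
Qed.

(** The term of index i in the n-th Taylor coefficient at ppath t tau of
    F(z) = sum_i A_i (1 - z)^(- lam - N_i). *)
Definition ptaylor_term (n : nat) (tau : R) (i : I) : C :=
  A i * (binc (a i) n * cexp ((a i + n%:R) * (tau%:C * w))).

Definition ptaylor n tau : C := tsum (ptaylor_term n tau).

Lemma cabs_a_le i : cabs (a i) <= cabs lam + N i.
Proof.
by rewrite (le_trans (cabsD _ _)) // lerD2l cabs_real ger0_norm.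
Qed.

Lemma cexp_a_le n tau i : 0 <= tau -> tau <= 1 ->
  cabs (cexp ((a i + n%:R) * (tau%:C * w))) <=
  expR ((cabs lam + n%:R) * cabs w) * expR (tau * (N i * L)).
Proof.
move=> tau0 tau1; rewrite cabs_cexp -expRD ler_expR.
have -> : (a i + n%:R) * (tau%:C * w) =
   tau%:C * ((lam + n%:R) * w) + (tau * N i)%:C * w :> C.
  by rewrite /a rmorphM /=; ring.
rewrite ReD !ReZ lerD //.
  apply: (@le_trans _ _ (tau * cabs ((lam + n%:R) * w))).
    by rewrite ler_wpM2l // (le_trans (ler_norm _)) // cabs_Re.
  rewrite (@le_trans _ _ (cabs ((lam + n%:R) * w))) //.
    by rewrite ler_piMl // cabs_ge0.
  rewrite cabsM ler_wpM2r ?cabs_ge0 // (le_trans (cabsD _ _)) //.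
  by rewrite cabs_nat.
by rewrite -mulrA !ler_wpM2l // Re_w_le.
Qed.

Section Step.
Variables (tau1 tau tau' : R).
Hypotheses (tau1_lt1 : tau1 < 1) (tau_ge0 : 0 <= tau) (tau_le : tau <= tau1).
Hypotheses (tau'_ge0 : 0 <= tau') (tau'_le : tau' <= tau1).

(* s^(1 - tau1) is the factor by which |1 - z| may still shrink. *)
Let v : R := 1 - expR (- ((1 - tau1) * L)).
Let h : C := ppath t tau' - ppath t tau.
Let u : C := h * cexp (tau%:C * w).

Lemma v_bounds : 0 < v /\ v < 1.
Proof.
split; last by rewrite /v ltrBlDr ltrDl expR_gt0.
by rewrite subr_gt0 expR_lt1 oppr_lt0 mulr_gt0 ?neg_ln_gt0 // subr_gt0.
Qed.

Hypothesis u_small : cabs u <= v / 2.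

(* |tau' - tau| <= 1 keeps the imaginary part of the exponent below pi. *)
Lemma cln_step : cln (1 - u) = - ((tau' - tau)%:C * w).
Proof.
have e : 1 - u = cexp (- ((tau' - tau)%:C * w)).
  have -> : - ((tau' - tau)%:C * w) = - (tau'%:C * w) + tau%:C * w :> C.
    by rewrite rmorphB /=; ring.
  rewrite cexpD /u /h /ppath -/w.
  have := cexpNK (tau%:C * w); set x := cexp _; set y := cexp _ => xy.
  by rewrite -[X in X - _ = _]xy; ring.
apply: cln_unique => //.
  by rewrite e cexp_neq0.
rewrite ImN normrN ImZ normrM.
have : `|tau' - tau| <= 1.
  move: tau1_lt1 tau_ge0 tau_le tau'_ge0 tau'_le => k1 k2 k3 k4 k5.
  by rewrite ler_norml; apply/andP; split; lra.
have := @Im_mlog R t t1; rewrite -/w => h1 h2.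
have := normr_ge0 (complex.Im w); have := normr_ge0 (tau' - tau).
have := pi_gt0 R; nra.
Qed.

Let f n i k : C := 'C(n + k, n)%:R * h ^+ k * ptaylor_term (n + k) tau i.

Lemma step_termE n i k : f n i k = A i * cexp ((a i + n%:R) * (tau%:C * w)) *
    ('C(n + k, n)%:R * binc (a i) (n + k) * u ^+ k).
Proof.
rewrite /f /ptaylor_term /u exprMn -cexpMn.
have -> : (a i + (n + k)%:R) * (tau%:C * w) =
  (a i + n%:R) * (tau%:C * w) + k%:R * (tau%:C * w) by rewrite natrD; ring.
by rewrite cexpD; set x := cexp _; set y := cexp _; ring.
Qed.

(** The room v between |1 - z| >= s^tau1 on the path and the bound s where F
    converges is shared by u and by an auxiliary v / 2, which pays for the
    binomial coefficient 'C(n + k, n) through bin_exp_le. *)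
Lemma step_dominated n : exists2 Kn : R, 0 <= Kn & forall i m,
  \sum_(k < m) cabs (f n i k) <= Kn * (cabs (A i) * expR (- (N i * ln s))).
Proof.
have [v0 v1] := v_bounds.
have e0 : 0 < v / 2 by rewrite divr_gt0.
have u0 := cabs_ge0 u.
pose Kn := expR ((cabs lam + n%:R) * cabs w) * ((v / 2) ^+ n)^-1 *
   expR (cabs lam * ((1 - tau1) * L)).
have Kn0 : 0 <= Kn by rewrite !mulr_ge0 ?expR_ge0 // invr_ge0 exprn_ge0 // ltW.
exists Kn => // i m.
have -> : \sum_(k < m) cabs (f n i k) =
    cabs (A i) * cabs (cexp ((a i + n%:R) * (tau%:C * w))) *
    \sum_(k < m) cabs ('C(n + k, n)%:R * binc (a i) (n + k) * u ^+ k).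
  rewrite mulr_sumr; apply: eq_bigr => k _.
  by rewrite step_termE cabsM [cabs (A i * _)]cabsM.
have inner : \sum_(k < m) cabs ('C(n + k, n)%:R * binc (a i) (n + k) * u ^+ k)
   <= ((v / 2) ^+ n)^-1 * expR ((cabs lam + N i) * ((1 - tau1) * L)).
  rewrite ler_pdivlMl ?exprn_gt0 // mulr_sumr.
  apply: (@le_trans _ _ (\sum_(k < m) rbinc (cabs (a i)) (n + k) * v ^+ (n + k))).
    apply: ler_sum => k _; rewrite cabsM (cabsM _ (binc _ _)) cabs_nat cabsX.
    have := bin_exp_le u0 (ltW e0) (leq_addr k n); rewrite addKn => hb.
    have hv : (cabs u + v / 2) ^+ (n + k) <= v ^+ (n + k).
      by move: u_small => us; rewrite lerXn2r ?nnegrE //; lra.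
    have hc := cabs_binc (a i) (n + k).
    have -> : (v / 2) ^+ n * ('C(n + k, n)%:R * cabs (binc (a i) (n + k)) * cabs u ^+ k)
      = cabs (binc (a i) (n + k)) * ('C(n + k, n)%:R * cabs u ^+ k * (v / 2) ^+ n) by ring.
    rewrite ler_pM ?cabs_ge0 //; last exact: le_trans hv.
    by rewrite !mulr_ge0 ?exprn_ge0 // ltW.
  apply: (@le_trans _ _ (\sum_(j < n + m) rbinc (cabs (a i)) j * v ^+ j)).
    rewrite big_split_ord /= lerDr; apply: sumr_ge0 => j _.
    by rewrite mulr_ge0 ?rbinc_ge0 ?cabs_ge0 ?exprn_ge0 // ltW.
  apply: le_trans (rbinc_sum_le _ (cabs_ge0 _) (ltW v0) v1) _.
  rewrite ler_expR /v subKr expRK mulrNN ler_wpM2r ?cabs_a_le //.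
  by rewrite mulr_ge0 ?(ltW neg_ln_gt0) // subr_ge0 ltW.
apply: le_trans (ler_wpM2l _ inner) _.
  by rewrite mulr_ge0 ?cabs_ge0.
have hcexp := @cexp_a_le n tau i tau_ge0 (ltW (le_lt_trans tau_le tau1_lt1)).
have e1 : expR (- (N i * ln s)) = expR (tau1 * (N i * L)) * expR (N i * ((1 - tau1) * L)).
  by rewrite -expRD; congr expR; rewrite /L; ring.
have e2 : expR ((cabs lam + N i) * ((1 - tau1) * L)) =
   expR (cabs lam * ((1 - tau1) * L)) * expR (N i * ((1 - tau1) * L)).
  by rewrite -expRD; congr expR; ring.
rewrite e1 e2 /Kn.
have h3 : expR (tau * (N i * L)) <= expR (tau1 * (N i * L)).
  by rewrite ler_expR ler_wpM2r // mulr_ge0 // ltW // neg_ln_gt0.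
have h4 : cabs (cexp ((a i + n%:R) * (tau%:C * w))) <=
   expR ((cabs lam + n%:R) * cabs w) * expR (tau1 * (N i * L)).
  by apply: le_trans hcexp _; rewrite ler_wpM2l // expR_ge0.
set X := expR ((cabs lam + n%:R) * cabs w) in h4 *.
set Y := expR (tau1 * _) in h4 *.
set Z := expR (cabs lam * _); set W := expR (N i * _).
set V := ((v / 2) ^+ n)^-1.
have -> : X * V * Z * (cabs (A i) * (Y * W)) = cabs (A i) * (X * Y) * (V * (Z * W)) by ring.
rewrite ler_wpM2r ?ler_wpM2l ?cabs_ge0 //.
by rewrite !mulr_ge0 ?expR_ge0 // invr_ge0 exprn_ge0 // ltW.
Qed.

Lemma absum_ptaylor n : absum (ptaylor_term n tau).
Proof.
have [K K0 hK] := step_dominated n.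
apply: absum_le (bounded_sumsZ K0 summ) => i.
have := hK i 1%N; rewrite big_ord1 /f addn0 binn expr0 !mul1r.
by [].
Qed.

(** The counterpart of taylor_shift for F: termwise it is the binomial theorem
    for 1 - u = (1 - z') / (1 - z), z and z' being consecutive points of the
    path. *)
Lemma ptaylor_step n :
  ptaylor n tau' = tsum (fun k => 'C(n + k, n)%:R * h ^+ k * ptaylor (n + k) tau).
Proof.
have [v0 v1] := v_bounds.
have u0 := cabs_ge0 u.
have u1 : cabs u < 1 by move: u_small => us; lra.
have [K K0 hK] := step_dominated n.
have [h1 h2 h3] := sum_exchange (bounded_sumsZ K0 summ) hK.
have ek k : tsum (f n ^~ k) = 'C(n + k, n)%:R * h ^+ k * ptaylor (n + k) tau.
  by apply: has_sum_tsum; apply: has_sumZ; exact: absum_has_sum (absum_ptaylor _).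
have ei i : tsum (f n i) = ptaylor_term n tau' i.
  apply: has_sum_tsum.
  have hb : has_sum (fun k => binc (a i + n%:R) k * u ^+ k)
      (cexp ((a i + n%:R) * ((tau' - tau)%:C * w))).
    rewrite -[_ * _ in X in has_sum _ X]mulrNN -cln_step -binomial_series //.
    apply: absum_has_sum; apply: absum_le (bounded_binc _ u0 u1) => k.
    by rewrite cabsM cabsX.
  have := has_sumZ (A i * cexp ((a i + n%:R) * (tau%:C * w)) * binc (a i) n) hb.
  have -> : A i * cexp ((a i + n%:R) * (tau%:C * w)) * binc (a i) n *
     cexp ((a i + n%:R) * ((tau' - tau)%:C * w)) = ptaylor_term n tau' i.
    have -> : ptaylor_term n tau' i = A i * binc (a i) n *
       (cexp ((a i + n%:R) * (tau%:C * w)) * cexp ((a i + n%:R) * ((tau' - tau)%:C * w))).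
      have e : tau'%:C * w = tau%:C * w + (tau' - tau)%:C * w by rewrite rmorphB /=; ring.
      by rewrite /ptaylor_term e mulrDr cexpD mulrA.
    by set x := cexp _; set y := cexp _; ring.
  apply: has_sum_ext => k; rewrite step_termE bincD.
  by set x := cexp _; ring.
rewrite /ptaylor -(funext ei) -h3.
by congr tsum; apply/funext => k; rewrite ek.
Qed.

End Step.

Let p n : C := tsum (fun i => A i * binc (a i) n).

Hypothesis t_neq0 : t != 0.
Variable S : C.
Hypothesis p_cvg : forall e : R, 0 < e ->
  \forall n \near \oo, cabs (\sum_(j < n) p j * t ^+ j - S) < e.

Lemma ptaylor_at0 n : ptaylor n 0 = p n.
Proof.
congr tsum; apply/funext => i.
by rewrite /ptaylor_term mul0r mulr0 cexp0 mulr1.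
Qed.

Lemma bounded_p (r : R) : 0 <= r -> r < cabs t ->
  bounded_sums (fun j => cabs (p j) * r ^+ j).
Proof.
move=> r0 rt; have t0 : 0 < cabs t by rewrite cabs_gt0.
have [B hB] := near_bounded p_cvg.
have B0 : 0 <= B by exact: le_trans (cabs_ge0 _) (hB 0%N).
have hq n : cabs (p n * t ^+ n) <= 2 * B.
  have := hB n; have := hB n.+1; rewrite big_ord_recr /=.
  set x := \sum_(i < n) _ => h1 h2.
  have -> : p n * t ^+ n = (x + p n * t ^+ n - S) - (x - S) by ring.
  by have := cabsB (x + p n * t ^+ n - S) (x - S); lra.
have q0 : 0 <= r / cabs t by rewrite divr_ge0 // ltW.
have q1 : r / cabs t < 1 by rewrite ltr_pdivrMr // mul1r.
have B2 : 0 <= 2 * B by rewrite mulr_ge0.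
apply: bounded_sums_le (bounded_sumsZ B2 (bounded_geometric q0 q1)) => j.
have -> : cabs (p j) * r ^+ j = cabs (p j * t ^+ j) * (r / cabs t) ^+ j.
  rewrite cabsM cabsX expr_div_n -mulrA [cabs t ^+ j * _]mulrC divfK //.
  by rewrite expf_neq0 // gt_eqF.
by rewrite ler_wpM2r // exprn_ge0.
Qed.

(** The two expansions keep the same Taylor coefficients along the path, in
    steps that are short compared with the distance to the boundary of either
    domain of convergence. *)
Lemma taylor_ppath tau1 n : 0 <= tau1 -> tau1 < 1 ->
  taylor p n (ppath t tau1) = ptaylor n tau1.
Proof.
move=> tau10 tau11; have t0 : 0 < cabs t by rewrite cabs_gt0.
pose b := 1 - cabs t.
have b0 : 0 < b by rewrite subr_gt0.
have lb : ln b < 0 by rewrite ln_lt0 // b0 /b; lra.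
pose r0 := 1 - expR (tau1 * ln b).
have r0t : r0 < cabs t.
  have : expR (ln b) < expR (tau1 * ln b) by rewrite ltr_expR; nra.
  by rewrite lnK ?posrE // /r0 /b; lra.
have r00 : 0 <= r0 by rewrite subr_ge0 expR_le1; nra.
pose r := (r0 + cabs t) / 2.
have hr : bounded_sums (fun j => cabs (p j) * r ^+ j).
  by apply: bounded_p; rewrite /r; lra.
have path_r tau : 0 <= tau -> tau <= tau1 -> cabs (ppath t tau) <= r0.
  move=> k1 k2; apply: le_trans (cabs_ppath t1 k1 _) _; first by lra.
  by rewrite -/b /r0 lerB // ler_expR; nra.
pose v := 1 - expR (- ((1 - tau1) * L)).
have [v0 v1] := v_bounds tau11; rewrite -/v in v0 v1.
pose W := cabs w.
have W0 : 0 <= W by exact: cabs_ge0.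
pose E := expR W.
have E0 : 0 < E by exact: expR_gt0.
pose gap := r - r0.
have gap0 : 0 < gap by rewrite /gap /r; lra.
(* with more than X steps, each one stays within the gap on the side of the
   power series and within v / 2 on the side of F *)
pose X := 2 * W + E * (5 * W) / gap * 2 + E * E * (5 * W) / (v / 2) + 1.
have X1 : 0 <= E * (5 * W) / gap by rewrite divr_ge0 ?(ltW gap0) // !mulr_ge0 // ltW.
have X2 : 0 <= E * E * (5 * W) / (v / 2).
  by rewrite divr_ge0 ?divr_ge0 ?(ltW v0) // !mulr_ge0 // ltW.
pose M := (Num.truncn X).+1.
have hM : X < M%:R by exact: truncnS_gt.
have M0 : 0 < M%:R :> R by move: hM; rewrite /X; lra.
pose q := tau1 / M%:R.
have q0 : 0 <= q by rewrite divr_ge0.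
have qM : q * M%:R = tau1 by rewrite /q divfK // gt_eqF.
have q1 : q * M%:R <= 1 by lra.
suff : forall j, (j <= M)%N -> forall n,
    taylor p n (ppath t (j%:R * q)) = ptaylor n (j%:R * q).
  by move=> /(_ M (leqnn M) n); rewrite mulrC qM.
elim=> [|j IH] jM m; first by rewrite mul0r ppath0 taylor_at0 ptaylor_at0.
have {}IH := IH (ltnW jM).
set tau := j%:R * q in IH; set tau' := j.+1%:R * q.
have dtau : tau' - tau = q by rewrite /tau /tau' -natr1; ring.
have tau0 : 0 <= tau by rewrite mulr_ge0.
have tau'0 : 0 <= tau' by rewrite mulr_ge0.
have tau'1 : tau' <= tau1 by rewrite -qM /tau' mulrC ler_wpM2l ?ler_nat.
have tau1' : tau <= tau1 by lra.
have qW : q * W <= 2^-1.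
  have : q * (2 * W) <= q * M%:R by rewrite ler_wpM2l //; move: hM; rewrite /X; lra.
  by lra.
have hlip : cabs (ppath t tau' - ppath t tau) <= E * (5 * (q * W)).
  have nq : `|tau' - tau| = q by rewrite dtau ger0_norm.
  have := @ppath_lip R t tau tau' tau0; rewrite nq -/w -/W -/E.
  by apply => //; lra.
set h := ppath t tau' - ppath t tau in hlip.
have small1 : E * (5 * (q * W)) < gap.
  have : q * (E * (5 * W) / gap * 2) <= q * M%:R.
    by rewrite ler_wpM2l //; move: hM; rewrite /X; lra.
  have -> : q * (E * (5 * W) / gap * 2) = E * (5 * (q * W)) / gap * 2 by ring.
  have e2 : E * (5 * (q * W)) = E * (5 * (q * W)) / gap * gap by rewrite divfK // gt_eqF.
  by rewrite [in X in _ -> X]e2; nra.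
have small2 : cabs (h * cexp (tau%:C * w)) <= v / 2.
  rewrite cabsM; apply: (@le_trans _ _ (E * (5 * (q * W)) * E)).
    rewrite ler_pM ?cabs_ge0 //; apply: le_trans (cabs_cexp_le _) _.
    rewrite ler_expR cabsM cabs_real ger0_norm // ler_piMl //; lra.
  have : q * (E * E * (5 * W) / (v / 2)) <= q * M%:R.
    by rewrite ler_wpM2l //; move: hM; rewrite /X; lra.
  have -> : q * (E * E * (5 * W) / (v / 2)) = E * (5 * (q * W)) * E / (v / 2) by ring.
  move=> /le_trans /(_ q1); rewrite ler_pdivrMr ?divr_gt0 // mul1r.
  by [].
have e : ppath t tau' = ppath t tau + h by rewrite /h; ring.
have hcr : cabs (ppath t tau) + cabs h < r.
  by have := path_r tau tau0 tau1'; rewrite /gap in small1; lra.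
rewrite e; have [_ <-] := taylor_shift m hcr hr; rewrite -?e.
rewrite (@ptaylor_step tau1 tau tau' tau11 tau0 tau1' tau'0 tau'1 small2).
by congr tsum; apply/funext => k; rewrite -IH.
Qed.

Lemma ptaylor0_le tau i : 0 <= tau -> tau <= 1 ->
  cabs (ptaylor_term 0 tau i) <=
  expR (cabs lam * cabs w) * (cabs (A i) * expR (- (N i * ln s))).
Proof.
move=> tau0 tau1; rewrite /ptaylor_term binc0 mul1r cabsM.
have := cexp_a_le 0 i tau0 tau1; rewrite !addr0 => h.
rewrite [leRHS]mulrCA ler_wpM2l ?cabs_ge0 // (le_trans h) // ler_wpM2l ?expR_ge0 //.
rewrite ler_expR -mulrN -/L ler_piMl // mulr_ge0 //.
exact: ltW neg_ln_gt0.
Qed.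

(** The equality of the values at ppath t tau passes to the limit tau -> 1, on
    the left by Abel's theorem and on the right by Tannery's. *)
Lemma power_series_continuation : S = tsum (fun i => A i * cexp (a i * w)).
Proof.
have -> : (fun i => A i * cexp (a i * w)) = ptaylor_term 0 1.
  apply/funext => i.
  by rewrite /ptaylor_term binc0 mul1r addr0 mul1r.
have t0 : 0 < cabs t by rewrite cabs_gt0.
pose tau (k : nat) : R := 1 - k.+1%:R^-1.
have tau0 k : 0 <= tau k by rewrite subr_ge0 invf_le1 ?ler1n // ltr0n.
have tau1 k : tau k < 1 by rewrite /tau ltrBlDr ltrDl invr_gt0 ltr0n.
have tauE k : 1 - tau k = k.+1%:R^-1 by rewrite /tau; ring.
have near_tau (d : R) : 0 < d -> \forall k \near \oo, 1 - tau k <= d.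
  move=> d0; exists (Num.truncn d^-1) => // k /= hk.
  rewrite tauE invf_ple ?posrE ?ltr0n // ltW //.
  by apply: lt_le_trans (truncnS_gt _) _; rewrite ler_nat ltnS.
apply: (@near_unique R nat \oo _ (fun k => ptaylor 0 (tau k))) => e e0.
  have [K K0 [d d0 hK]] := ppath_stolz t1 t_neq0.
  have e2 : 0 < e / 2 by rewrite divr_gt0.
  have [d' d'0 hd'] := @abel_stolz R (fun j => p j * t ^+ j) S K p_cvg _ e2.
  pose E := expR (cabs w) * (5 * cabs w) / cabs t + 1.
  have E0 : 0 < E.
    by rewrite ltr_wpDl // divr_ge0 ?mulr_ge0 ?expR_ge0 ?cabs_ge0.
  have small0 : 0 < (2 * (cabs w + 1))^-1 :> R.
    by rewrite invr_gt0 mulr_gt0 // ltr_wpDl // cabs_ge0.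
  have dE : 0 < d' / E by rewrite divr_gt0.
  apply: filterS (filterI (filterI (near_tau _ d0) (near_tau _ dE)) (near_tau _ small0)).
  move=> k [[k1 k2] k3].
  have [c1 c2] := hK (tau k) (tau0 k) (tau1 k) k1.
  rewrite -(taylor_ppath 0 (tau0 k) (tau1 k)) taylor0.
  set c := ppath t (tau k) in c1 c2 *.
  pose z := c / t.
  have -> : (fun j => p j * c ^+ j) = (fun j => p j * t ^+ j * z ^+ j).
    apply/funext => j; rewrite /z expr_div_n -mulrA; congr (_ * _).
    by rewrite mulrCA divff ?mulr1 // expf_neq0.
  have cz : cabs z = cabs c / cabs t by rewrite cabsM cabsV.
  have ez : 1 - z = (t - c) / t by rewrite /z [RHS]mulrBl mulfV.
  apply: le_lt_trans (hd' z _ _ _) _.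
  - by rewrite cz ltr_pdivrMr // mul1r.
  - rewrite ez cabsM cabsV ler_pdivrMr // -mulrA mulrBl mul1r cz divfK //.
    by rewrite gt_eqF.
  - rewrite ez cabsM cabsV -[X in X - c](ppath1 t1).
    have small : `|1 - tau k| * cabs w <= 2^-1.
      rewrite ger0_norm; last by have := tau1 k; lra.
      apply: (@le_trans _ _ ((2 * (cabs w + 1))^-1 * (cabs w + 1))).
        by rewrite ler_pM ?cabs_ge0 ?lerDl //; have := tau1 k; lra.
      by rewrite invfM -mulrA mulVf ?mulr1 // gt_eqF // ltr_wpDl // cabs_ge0.
    have := ppath_lip (tau0 k) (ltW (tau1 k)) small; rewrite -/c -/w.
    rewrite ger0_norm; last by have := tau1 k; lra.
    move=> h; rewrite ler_pdivrMr // (le_trans h) //.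
    have : (1 - tau k) * E <= d' by rewrite -ler_pdivlMr.
    move=> h2; apply: (@le_trans _ _ ((1 - tau k) * E * cabs t)); last by rewrite ler_wpM2r // ltW.
    have -> : expR (cabs w) * (5 * ((1 - tau k) * cabs w)) =
      (1 - tau k) * (expR (cabs w) * (5 * cabs w)) by ring.
    rewrite -mulrA ler_wpM2l //; first by have := tau1 k; lra.
    by rewrite /E [leRHS]mulrDl mul1r divfK ?gt_eqF // lerDl ltW.
  - by lra.
have hb := bounded_sumsZ (expR_ge0 (cabs lam * cabs w)) summ.
apply: (@tannery R I nat \oo _ (fun k => ptaylor_term 0 (tau k)) (ptaylor_term 0 1) _ hb) => //.
- by move=> k i; apply: ptaylor0_le => //; exact: ltW.
- by move=> i; apply: ptaylor0_le.
move=> i d d0; rewrite /ptaylor_term.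
pose y := a i * w.
pose E := cabs (A i) * cabs (cexp y) * (5 * cabs y) + 1.
have E0 : 0 < E by rewrite ltr_wpDl // !mulr_ge0 // cabs_ge0.
have dE : 0 < d / 2 / E by rewrite !divr_gt0.
have small0 : 0 < (2 * (cabs y + 1))^-1 :> R.
  by rewrite invr_gt0 mulr_gt0 // ltr_wpDl // cabs_ge0.
apply: filterS (filterI (near_tau _ dE) (near_tau _ small0)) => k [k1 k2].
rewrite binc0 !mul1r addr0 -mulrBr.
have pos : 0 <= 1 - tau k by have := tau1 k; lra.
have -> : a i * ((tau k)%:C * w) = y + - ((1 - tau k)%:C * y) :> C.
  by move: (tau k) => x; rewrite /y rmorphB /= rmorph1; ring.
rewrite -/y cexpD -[X in _ - X]mulr1 -mulrBr (cabsM (A i)) (cabsM (cexp y)).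
have small : cabs (- ((1 - tau k)%:C * y)) <= 2^-1.
  rewrite cabsN cabsM cabs_real ger0_norm //.
  apply: (@le_trans _ _ ((2 * (cabs y + 1))^-1 * (cabs y + 1))).
    by rewrite ler_pM ?cabs_ge0 ?lerDl.
  by rewrite invfM -mulrA mulVf ?mulr1 // gt_eqF // ltr_wpDl // cabs_ge0.
have := cexp_lip small; rewrite cabsN cabsM cabs_real ger0_norm // => h.
apply: (@le_lt_trans _ _ ((1 - tau k) * E)).
  apply: (@le_trans _ _ (cabs (A i) * (cabs (cexp y) * (5 * ((1 - tau k) * cabs y))))).
    by rewrite ler_wpM2l ?cabs_ge0 // ler_wpM2l ?cabs_ge0.
  by rewrite /E; lra.
apply: (@le_lt_trans _ _ (d / 2)); first by rewrite -ler_pdivlMr.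
by lra.
Qed.

End Continuation.

(** * Convergence of Euler's product for Gamma *)

Section Gamma.
Variable R : realType.
Notation C := (Cplx R).
Implicit Types z : C.

Lemma sum_inv_sq_le (m n : nat) : (1 < m)%N ->
  \sum_(k < n) ((m + k)%:R ^- 2 : R) <= (m.-1)%:R^-1 - (m.-1 + n)%:R^-1.
Proof.
move=> m1; have m0 : 0 < m.-1%:R :> R by rewrite ltr0n -subn1 subn_gt0.
have em : (m = m.-1.+1)%N by rewrite prednK // ltnW.
elim: n => [|n IH]; first by rewrite big_ord0 addn0 subrr.
rewrite big_ord_recr /=.
have x0 : 0 < (m.-1 + n)%:R :> R by rewrite natrD ltr_wpDr.
have e1 : (m + n)%:R = (m.-1 + n)%:R + 1 :> R by rewrite natr1 {1}em addSn.
have e2 : (m.-1 + n.+1)%:R = (m.-1 + n)%:R + 1 :> R by rewrite natr1 addnS.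
rewrite e1 e2; set x := (m.-1 + n)%:R in x0 IH *.
suff : (x + 1) ^- 2 <= x^-1 - (x + 1)^-1 by lra.
have -> : x^-1 - (x + 1)^-1 = (x * (x + 1))^-1 by field; lra.
rewrite lef_pV2 ?posrE ?exprn_gt0 ?mulr_gt0 //; nra.
Qed.

(** An infinite product whose factors are 1 + O(1 / n^2): from an index m on,
    the sequence stays within |f m| / 2 of f m, and its increments are
    absolutely summable. *)
Lemma quadratic_ratio_cvg (f : nat -> C) (K : R) (n0 : nat) : 0 <= K ->
  (forall n, (n0 <= n)%N -> (0 < n)%N ->
     cabs (f n.+1 - f n) <= cabs (f n) * (K * n%:R ^- 2)) ->
  (forall n, f n != 0) ->
  exists2 l : C, l != 0 &
    forall e : R, 0 < e -> \forall n \near \oo, cabs (f n - l) < e.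
Proof.
move=> K0 hf fn0.
pose m := maxn n0 (Num.truncn (3 * K)).+3.
have m1 : (1 < m)%N by rewrite leq_max ltnS orbT.
have m0n : (n0 <= m)%N by rewrite leq_max leqnn.
have mK : 3 * K * (m.-1)%:R^-1 <= 1.
  have mp : 0 < m.-1%:R :> R by rewrite ltr0n -subn1 subn_gt0.
  rewrite ler_pdivrMr // mul1r (le_trans (ltW (truncnS_gt _))) // ler_nat.
  have : ((Num.truncn (3 * K)).+3 <= m)%N by rewrite leq_max leqnn orbT.
  by case: (m) => // m' /= h; exact: leq_trans (leqnSn _) h.
have F0 : 0 < cabs (f m) by rewrite cabs_gt0.
have mp : 0 < m.-1%:R^-1 :> R by rewrite invr_gt0 ltr0n -subn1 subn_gt0.
have tele n : \sum_(k < n) (f (m + k).+1 - f (m + k)%N) = f (m + n)%N - f m.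
  elim: n => [|n IH]; first by rewrite big_ord0 addn0 subrr.
  by rewrite big_ord_recr /= IH addnS; ring.
pose D n := \sum_(k < n) cabs (f (m + k).+1 - f (m + k)%N).
pose G n := cabs (f m) * (3 / 2) * K * \sum_(k < n) (m + k)%:R ^- 2.
have half n : D n <= G n -> D n <= cabs (f m) / 2.
  move=> DG; apply: le_trans DG _.
  have h1 := sum_inv_sq_le n m1.
  have h2 : 0 <= (m.-1 + n)%:R^-1 :> R by rewrite invr_ge0.
  have h3 : 0 <= cabs (f m) * (3 / 2) * K by rewrite !mulr_ge0 ?cabs_ge0.
  apply: (@le_trans _ _ (cabs (f m) * (3 / 2) * K * m.-1%:R^-1)).
    by rewrite /G ler_wpM2l //; lra.
  have -> : cabs (f m) * (3 / 2) * K * m.-1%:R^-1 =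
    cabs (f m) / 2 * (3 * K * m.-1%:R^-1) by ring.
  by rewrite ler_piMr // divr_ge0 // cabs_ge0.
have DG n : D n <= G n.
  elim: n => [|n IH]; first by rewrite /D /G !big_ord0 mulr0.
  have fb : cabs (f (m + n)%N) <= cabs (f m) * (3 / 2).
    have := half n IH; have := cabs_sum (index_enum 'I_n) predT
      (fun k : 'I_n => f (m + k).+1 - f (m + k)%N).
    rewrite tele -/(D n); have := cabsD (f (m + n)%N - f m) (f m).
    by rewrite subrK; lra.
  rewrite /D /G !big_ord_recr /= mulrDr -/(D n) -/(G n) lerD //.
  have k0 : (0 < m + n)%N by rewrite (leq_trans _ (leq_addr _ _)) // ltnW.
  have := hf (m + n)%N (leq_trans m0n (leq_addr _ _)) k0.
  move=> /le_trans; apply; rewrite -[leRHS]mulrA ler_wpM2r //.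
  by rewrite mulr_ge0 // invr_ge0 exprn_ge0.
pose d k := f (m + k).+1 - f (m + k)%N.
have bd (B : {fset nat}) : \sum_(k <- B) cabs (d k) <= cabs (f m) / 2.
  apply: (bounded_sums_nat (f := fun k => cabs (d k))) => [i|n].
    exact: cabs_ge0.
  exact: half (DG n).
have hs : has_sum d (tsum d) by apply: absum_has_sum; exists (cabs (f m) / 2).
exists (f m + tsum d).
  have := has_sum_cabs_le hs bd; rewrite -cabs_gt0.
  by have := cabsB_ge (f m) (- tsum d); rewrite opprK cabsN; lra.
move=> e e0; have [n1 _ h1] := has_sum_nat hs e0.
exists (m + n1)%N => // n /= hn.
have mn : (m <= n)%N by rewrite (leq_trans _ hn) // leq_addr.
have := h1 (n - m)%N; rewrite /= leq_subRL // hn => /(_ isT).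
rewrite tele subnKC // => h2.
by have -> : f n - (f m + tsum d) = f n - f m - tsum d by ring.
Qed.

Lemma cln_nat n : (0 < n)%N -> cln (n%:R : C) = (ln n%:R)%:C.
Proof.
move=> n0; have -> : (n%:R : C) = (n%:R : R)%:C by rewrite rmorph_nat.
apply: cln_unique.
- by rewrite -cabs_gt0 cabs_real normr_gt0 pnatr_eq0 -lt0n.
- by rewrite /cexp /= cos0 sin0 lnK ?posrE ?ltr0n // mulr1.
- by rewrite /= normr0 pi_gt0.
Qed.

(** Euler's sequence, whose limit is the Gamma function. *)
Definition euler z (n : nat) : C := n`!%:R * cpow n%:R z / rising z n.+1.

Lemma rising_neq0 z n : ~ nonpos_int z -> rising z n != 0.
Proof.
move=> hz; apply/prodf_neq0 => i _; apply/eqP => h; apply: hz.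
by exists i; apply/eqP; rewrite -addr_eq0 h.
Qed.

Lemma euler_neq0 z n : ~ nonpos_int z -> euler z n != 0.
Proof.
move=> hz; rewrite /euler mulf_neq0 ?invr_neq0 ?rising_neq0 //.
by rewrite mulf_neq0 ?fact_neq0 // /cpow cexp_neq0.
Qed.

Lemma eulerS z n : (0 < n)%N -> ~ nonpos_int z ->
  euler z n.+1 = euler z n *
   (n.+1%:R * cexp ((ln (1 + n%:R^-1))%:C * z) / (z + n.+1%:R)).
Proof.
move=> n0 hz.
have n0r : 0 < n%:R :> R by rewrite ltr0n.
have e : (ln n.+1%:R)%:C = (ln n%:R)%:C + (ln (1 + n%:R^-1))%:C :> C.
  rewrite -rmorphD -lnM ?posrE ?addr_gt0 ?invr_gt0 //.
  by rewrite mulrDr mulr1 divff ?gt_eqF // natr1.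
rewrite /euler /cpow !cln_nat // e factS natrM risingS mulrDr cexpD.
rewrite [z * (ln (1 + _))%:C]mulrC invfM.
by set x := cexp _; set y := cexp _; ring.
Qed.

Lemma ln_1p_inv_bounds n : (0 < n)%N ->
  0 <= ln (1 + n%:R^-1 : R) <= n%:R^-1 /\ `|ln (1 + n%:R^-1 : R) - n%:R^-1| <= n%:R ^- 2.
Proof.
move=> n0; have y0 : 0 < n%:R^-1 :> R by rewrite invr_gt0 ltr0n.
rewrite -exprVn; set y := n%:R^-1 in y0 *.
have l0 : expR (ln (1 + y)) = 1 + y by rewrite lnK // posrE addr_gt0.
set x := ln _ in l0 *.
have x1 := expR_ge1Dx x; have x2 := expR_ge1Dx (- x).
have p0 := expR_gt0 (- x).
have pp : expR x * expR (- x) = 1 by rewrite -expRD subrr expR0.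
rewrite l0 in x1 pp.
have x3 : 0 <= x by rewrite -ler_expR expR0 l0 lerDl ltW.
have x4 : x <= y by lra.
have x5 : y - y ^+ 2 <= x.
  have x6 : (1 + y) * (1 - x) <= 1 by rewrite -[leRHS]pp ler_wpM2l //; lra.
  rewrite -(ler_pM2r (_ : 0 < 1 + y)); last by lra.
  have -> : (y - y ^+ 2) * (1 + y) = y - y * y ^+ 2 by ring.
  have x7 : 0 <= y * y ^+ 2 by rewrite mulr_ge0 ?sqr_ge0 // ltW.
  by lra.
by split; [rewrite x3 x4 | rewrite ler_norml; have := sqr_ge0 y; lra].
Qed.

(** The ratio is (1 + 1 / n)^z (n + 1) / (z + n + 1), where the terms of order
    1 / n cancel. *)
Lemma euler_ratio z : ~ nonpos_int z ->
  exists2 K : R, 0 <= K & exists n0 : nat, forall n, (n0 <= n)%N -> (0 < n)%N ->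
  cabs (euler z n.+1 - euler z n) <= cabs (euler z n) * (K * n%:R ^- 2).
Proof.
move=> hz; set Z := cabs z; have Z0 : 0 <= Z by exact: cabs_ge0.
pose K := 2 * Z + 4 * (8 * Z ^+ 2 + Z).
have K0 : 0 <= K by rewrite /K; have := sqr_ge0 Z; lra.
exists K => //; exists (Num.truncn (2 * Z)).+1 => n hn n0.
have nr : 0 < n%:R :> R by rewrite ltr0n.
have nZ : 2 * Z <= n%:R.
  by rewrite (le_trans (ltW (truncnS_gt _))) // ler_nat.
rewrite eulerS // -[X in _ - X]mulr1 -mulrBr cabsM ler_wpM2l ?cabs_ge0 //.
have [/andP[x0 x1] x2] := ln_1p_inv_bounds n0.
set x := ln _ in x0 x1 x2 *.
have y0 : 0 < n%:R^-1 :> R by rewrite invr_gt0.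
have ny : n%:R * n%:R^-1 = 1 :> R by rewrite divff // gt_eqF.
rewrite -exprVn in x2 *; set y := n%:R^-1 in x1 x2 y0 ny *.
have Zy : Z * y <= 2^-1.
  have zy : 2 * Z * y <= n%:R * y by rewrite ler_wpM2r // ltW.
  by lra.
have zx : cabs (x%:C * z) <= Z * y.
  by rewrite cabsM cabs_real ger0_norm // mulrC ler_wpM2l.
have q := cexp_quad (le_trans zx Zy).
pose eta := cexp (x%:C * z) - 1 - y%:C * z.
have heta : cabs eta <= (8 * Z ^+ 2 + Z) * y ^+ 2.
  have -> : eta = (cexp (x%:C * z) - 1 - x%:C * z) + (x - y)%:C * z.
    by rewrite /eta rmorphB /=; ring.
  apply: le_trans (cabsD _ _) _; rewrite [cabs (_ * z)]cabsM cabs_real -/Z mulrDl lerD //.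
    apply: le_trans q _; rewrite -mulrA ler_wpM2l // -exprMn.
    by rewrite lerXn2r ?nnegrE ?cabs_ge0 // mulr_ge0 // ltW.
  by rewrite mulrC ler_wpM2l.
have den : n%:R / 2 <= cabs (z + n.+1%:R).
  have := cabsB_ge (n.+1%:R) (- z); rewrite opprK cabsN cabs_nat -/Z [_ + z]addrC.
  by rewrite -natr1 => h; lra.
have den0 : 0 < cabs (z + n.+1%:R) by lra.
have dn0 : z + n.+1%:R != 0 by rewrite -cabs_gt0.
have -> : n.+1%:R * cexp (x%:C * z) / (z + n.+1%:R) - 1 =
    (y%:C * z + n.+1%:R * eta) / (z + n.+1%:R).
  have nyC : n%:R * y%:C = 1 :> C.
    by rewrite -(rmorph_nat (real_complex R)) -rmorphM ny rmorph1.
  apply: (mulIf dn0); rewrite mulrBl !divfK // mul1r /eta -natr1.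
  have -> : (n%:R + 1) * (cexp (x%:C * z) - 1 - y%:C * z) =
    (n%:R + 1) * cexp (x%:C * z) - (n%:R + 1) - (n%:R * y%:C) * z - y%:C * z by ring.
  by rewrite nyC; set E := cexp _; ring.
rewrite cabsM cabsV ler_pdivrMr //.
apply: (@le_trans _ _ (K * y ^+ 2 * (n%:R / 2))); last first.
  by rewrite ler_wpM2l // mulr_ge0 // sqr_ge0.
have -> : K * y ^+ 2 * (n%:R / 2) = (n%:R * y) * (K * y / 2) by ring.
rewrite ny mul1r; apply: le_trans (cabsD _ _) _.
rewrite !cabsM cabs_real (ger0_norm (ltW y0)) cabs_nat -/Z.
have n2 : n.+1%:R <= 2 * n%:R :> R.
  have n1 : 1 <= n%:R :> R by rewrite ler1n.
  by rewrite -natr1; lra.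
have : n.+1%:R * cabs eta <= 2 * n%:R * ((8 * Z ^+ 2 + Z) * y ^+ 2).
  by rewrite ler_pM ?cabs_ge0.
have -> : 2 * n%:R * ((8 * Z ^+ 2 + Z) * y ^+ 2) = (n%:R * y) * (2 * (8 * Z ^+ 2 + Z) * y) by ring.
rewrite ny mul1r /K; lra.
Qed.

Lemma euler_cvg z : ~ nonpos_int z -> cGamma z != 0 /\ forall e : R, 0 < e -> \forall n \near \oo, cabs (euler z n - cGamma z) < e.
Proof.
move=> hz; have [K K0 [n0 hK]] := euler_ratio hz.
have [l l0 hl] := quadratic_ratio_cvg K0 hK (fun n => euler_neq0 n hz).
suff -> : cGamma z = l by [].
have : euler z @ \oo --> l by apply/cvg_cabsP.
by move=> h; apply: (cvg_lim _ h); exact: norm_hausdorff.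
Qed.

Lemma nonpos_intS z : ~ nonpos_int z -> ~ nonpos_int (z + 1).
Proof.
move=> hz [n hn]; apply: hz; exists n.+1.
by rewrite -natr1 opprD -hn addrK.
Qed.

Lemma cGammaS z : ~ nonpos_int z -> cGamma (z + 1) = z * cGamma z.
Proof.
move=> hz; have [G0 hG] := euler_cvg hz.
have [_ hG1] := euler_cvg (nonpos_intS hz).
apply: (@near_unique R nat \oo _ (euler (z + 1))) => // e e0.
have z0 : z != 0.
  by apply/eqP => h; apply: hz; exists 0%N; rewrite oppr0.
have E n : (0 < n)%N ->
    euler (z + 1) n = z * euler z n * (1 - (z + 1) / (z + n.+1%:R)).
  move=> n0.
  have zn : z + n.+1%:R != 0.
    by apply/eqP => h; apply: hz; exists n.+1; apply/eqP; rewrite -addr_eq0 h.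
  have -> : 1 - (z + 1) / (z + n.+1%:R) = n%:R / (z + n.+1%:R).
    by apply: (mulIf zn); rewrite mulrBl !divfK // mul1r -natr1; ring.
  have er : z * rising (z + 1) n.+1 = rising z n.+1 * (z + n.+1%:R).
    by rewrite -risingS -[n.+2]add1n risingD (risingS z 0) rising0 mul1r addr0.
  have r1 : rising z n.+1 != 0 by exact: rising_neq0.
  have r2 : rising (z + 1) n.+1 != 0 by apply: rising_neq0; exact: nonpos_intS.
  have cp : cpow n%:R (z + 1) = cpow n%:R z * n%:R :> C.
    rewrite /cpow mulrDl mul1r cexpD cexp_cln //.
    by rewrite pnatr_eq0 -lt0n.
  rewrite /euler cp; move: (cpow n%:R z) => p.
  apply: (mulIf r2); rewrite divfK //.
  have -> : z * (n`!%:R * p / rising z n.+1) * (n%:R / (z + n.+1%:R)) * rising (z + 1) n.+1 =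
     n`!%:R * p / rising z n.+1 * (n%:R / (z + n.+1%:R)) * (z * rising (z + 1) n.+1) by ring.
  rewrite er.
  set r := rising z n.+1 in r1 *.
  have h1 : r^-1 * r = 1 by rewrite mulVf.
  have h2 : (z + n.+1%:R)^-1 * (z + n.+1%:R) = 1 by rewrite mulVf.
  transitivity (n`!%:R * p * n%:R * (r^-1 * r) * ((z + n.+1%:R)^-1 * (z + n.+1%:R))).
    by rewrite h1 h2; ring.
  by ring.
pose Z := cabs z; set G := cGamma z in hG *.
pose B := Z * (cabs G + 1) * (Z + 1).
have B0 : 0 <= B by rewrite /B !mulr_ge0 ?addr_ge0 ?cabs_ge0.
have e1 : 0 < Num.min 1 (e / 2 / (Z + 1)).
  by rewrite lt_min ltr01 !divr_gt0 // ltr_wpDl // cabs_ge0.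
have [n1 _ h1] := hG _ e1.
exists (maxn n1 (Num.truncn (2 * B / e + Z)).+1) => // n /=.
rewrite geq_max => /andP[k1 k2].
have n0 : (0 < n)%N by exact: leq_trans k2.
have := h1 n k1; rewrite lt_min => /andP[g1 g2].
rewrite E //.
have nB : 2 * B / e + Z < n%:R.
  by apply: lt_le_trans (truncnS_gt _) _; rewrite ler_nat.
move: (euler z n) g1 g2 => g g1 g2.
have gb : cabs g <= cabs G + 1.
  by have := cabsD (g - G) G; rewrite subrK; lra.
have -> : z * g * (1 - (z + 1) / (z + n.+1%:R)) - z * G =
   z * (g - G) - z * g * (z + 1) / (z + n.+1%:R) by ring.
have den : n%:R - Z <= cabs (z + n.+1%:R).
  have := cabsB_ge (n.+1%:R) (- z); rewrite opprK cabsN cabs_nat -/Z [_ + z]addrC.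
  by rewrite -natr1; lra.
have Be : 0 <= 2 * B / e by apply: divr_ge0; [exact: mulr_ge0|exact: ltW].
have den0 : 0 < cabs (z + n.+1%:R) by lra.
have b1 : cabs (z * (g - G)) < e / 2.
  rewrite cabsM -/Z; move: g2; rewrite ltr_pdivlMr; last by rewrite ltr_wpDl // cabs_ge0.
  by have := cabs_ge0 (g - G); lra.
have b2 : cabs (z * g * (z + 1) / (z + n.+1%:R)) <= e / 2.
  rewrite cabsM cabsV ler_pdivrMr // !cabsM -/Z.
  apply: (@le_trans _ _ B).
    rewrite /B ler_pM ?mulr_ge0 ?cabs_ge0 //; first by rewrite ler_wpM2l ?cabs_ge0.
    by rewrite (le_trans (cabsD _ _)) // cabs1.
  have : 2 * B <= cabs (z + n.+1%:R) * e by rewrite -ler_pdivrMr //; lra.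
  by lra.
apply: le_lt_trans (cabsB _ _) _.
by lra.
Qed.

Lemma nonpos_intD z n : ~ nonpos_int z -> ~ nonpos_int (z + n%:R).
Proof.
elim: n => [|n IH] hz; first by rewrite addr0.
by rewrite -natr1 addrA; exact: nonpos_intS (IH hz).
Qed.

Lemma cGammaD z n : ~ nonpos_int z ->
  cGamma (z + n%:R) = rising z n * cGamma z.
Proof.
move=> hz; elim: n => [|n IH]; first by rewrite addr0 rising0 mul1r.
rewrite -natr1 addrA cGammaS; last exact: nonpos_intD.
by rewrite IH risingS; ring.
Qed.

End Gamma.

(** * Growth of Gamma to the right *)

Section GammaGrowth.
Variable R : realType.
Notation C := (Cplx R).
Implicit Types z : C.

Lemma Re_gt0_nonpos_int z : 0 < complex.Re z -> ~ nonpos_int z.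
Proof.
move=> z0 [n hn]; move: z0; rewrite hn ReN.
have -> : (n%:R : C) = (n%:R : R)%:C by rewrite rmorph_nat.
by rewrite /= oppr_gt0 ltNge ler0n.
Qed.

Lemma ln_le_sub1 (y : R) : 0 < y -> ln y <= y - 1.
Proof. by move=> y0; have := expR_ge1Dx (ln y); rewrite lnK ?posrE //; lra. Qed.

Lemma cabs_shift_le z (X tau : R) : 0 < X -> X <= cabs z -> 0 <= tau ->
  cabs (z + tau%:C) <= cabs z * expR (tau / X).
Proof.
move=> X0 Xz tau0; apply: le_trans (cabsD _ _) _.
rewrite cabs_real ger0_norm //.
apply: (@le_trans _ _ (cabs z * (1 + tau / X))).
  rewrite mulrDr mulr1 lerD2l mulrA ler_pdivlMr // mulrC ler_wpM2r //.
by rewrite ler_wpM2l ?cabs_ge0 // expR_ge1Dx.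
Qed.

(** Each factor obeys |z + j + tau| <= |z + j| exp (tau / (X + j)), X = Re z,
    and sum_j 1 / (X + j) is compared with log ((X + n) / X). *)
Lemma rising_shift_le z (tau : R) n : 0 < complex.Re z -> 0 <= tau ->
  cabs (rising (z + tau%:C) n.+1) * expR (tau * ln (complex.Re z)) <=
  cabs (rising z n.+1) * expR (tau / complex.Re z) *
    expR (tau * ln (complex.Re z + n%:R)).
Proof.
set X := complex.Re z => X0 tau0.
have zj j : X + j%:R <= cabs (z + j%:R).
  apply: le_trans (ler_norm _) _.
  have -> : X + j%:R = complex.Re (z + j%:R).
    have -> : (j%:R : C) = (j%:R : R)%:C by rewrite rmorph_nat.
    by rewrite ReD.
  exact: cabs_Re.
elim: n => [|n IH].
  rewrite !risingS !rising0 !mul1r !addr0 ler_wpM2r ?expR_ge0 //.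
  by apply: cabs_shift_le => //; have := zj 0%N; rewrite !addr0.
rewrite risingS (risingS z) !cabsM.
set V := X + n.+1%:R.
have V0 : 0 < V by rewrite addr_gt0.
have V1 : 0 < V - 1 by rewrite /V -natr1 addrA addrK ltr_wpDr.
have eV : V - 1 = X + n%:R by rewrite /V -natr1; ring.
have s1 : cabs (z + tau%:C + n.+1%:R) <= cabs (z + n.+1%:R) * expR (tau / V).
  by rewrite addrAC; exact: cabs_shift_le (zj _) tau0.
have s2 : expR (tau / V) * expR (tau * ln (X + n%:R)) <= expR (tau * ln V).
  rewrite -expRD ler_expR -mulrDr ler_wpM2l // -eV.
  have -> : V - 1 = V * (1 - V^-1) by rewrite mulrBr mulr1 divff // gt_eqF.
  have V2 : 0 < 1 - V^-1.
    by rewrite subr_gt0 invf_lt1 // -subr_gt0.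
  by rewrite lnM ?posrE //; have := ln_le_sub1 V2; lra.
set P' := cabs (rising (z + tau%:C) n.+1) in IH *.
set P := cabs (rising z n.+1) in IH *.
set c := cabs (z + n.+1%:R) in s1 *.
apply: (@le_trans _ _ ((P' * expR (tau * ln X)) * (c * expR (tau / V)))).
  by rewrite mulrAC ler_wpM2l // mulr_ge0 ?expR_ge0 ?cabs_ge0.
apply: (@le_trans _ _ (P * expR (tau / X) * expR (tau * ln (X + n%:R)) * (c * expR (tau / V)))).
  by rewrite ler_wpM2r // mulr_ge0 ?expR_ge0 ?cabs_ge0.
have -> : P * expR (tau / X) * expR (tau * ln (X + n%:R)) * (c * expR (tau / V)) =
  (P * c * expR (tau / X)) * (expR (tau / V) * expR (tau * ln (X + n%:R))) by ring.
by rewrite ler_wpM2l // !mulr_ge0 ?expR_ge0 ?cabs_ge0.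
Qed.

Lemma euler_shift_le z (tau : R) n : 0 < complex.Re z -> 0 <= tau ->
  (0 < n)%N -> complex.Re z <= n%:R ->
  cabs (euler z n) * expR (tau * ln (complex.Re z)) <=
  expR (tau / complex.Re z + tau) * cabs (euler (z + tau%:C) n).
Proof.
set X := complex.Re z => X0 tau0 n0 Xn.
have nr : 0 < n%:R :> R by rewrite ltr0n.
have := rising_shift_le n X0 tau0; rewrite -/X.
have r1 : 0 < cabs (rising z n.+1).
  by rewrite cabs_gt0 rising_neq0 //; exact: Re_gt0_nonpos_int.
have r2 : 0 < cabs (rising (z + tau%:C) n.+1).
  rewrite cabs_gt0 rising_neq0 //; apply: Re_gt0_nonpos_int.
  by rewrite ReD /= ltr_wpDr.
have e1 : cabs (cpow n%:R (z + tau%:C)) = cabs (cpow n%:R z) * expR (tau * ln n%:R) :> R.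
  by rewrite /cpow mulrDl cexpD cabsM cln_nat // -rmorphM cexp_real cabs_real ger0_norm ?expR_ge0.
have s : expR (tau * ln (X + n%:R)) <= expR tau * expR (tau * ln n%:R).
  rewrite -expRD ler_expR.
  have -> : tau + tau * ln n%:R = tau * (1 + ln n%:R) by ring.
  rewrite ler_wpM2l //.
  have -> : X + n%:R = n%:R * (1 + X / n%:R) by rewrite mulrDr mulr1 mulrC divfK ?gt_eqF // addrC.
  have p0 : 0 < 1 + X / n%:R by rewrite addr_gt0 // divr_gt0.
  rewrite lnM ?posrE //; have := ln_le_sub1 p0.
  have : X / n%:R <= 1 by rewrite ler_pdivrMr // mul1r.
  by lra.
rewrite /euler (cabsM _ (rising z n.+1)^-1) (cabsM _ (rising (z + _) n.+1)^-1) !cabsV.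
rewrite (cabsM _ (cpow _ z)) (cabsM _ (cpow _ (z + _))) e1 expRD.
move: (cabs (cpow n%:R z)) (cabs_ge0 (cpow n%:R z)) => p p0.
move: (cabs (rising z n.+1)) r1 => r r0.
move: (cabs (rising (z + tau%:C) n.+1)) r2 => r' r'0 h.
move: (cabs n`!%:R) (cabs_ge0 (n`!%:R : C)) => f f0.
set Y := expR (tau * ln X) in h *; set W := expR (tau / X) in h *.
rewrite mulrAC ler_pdivrMr //.
have -> : W * expR tau * (f * (p * expR (tau * ln n%:R)) / r') * r =
  W * expR tau * (f * (p * expR (tau * ln n%:R))) * r / r' by ring.
rewrite ler_pdivlMr //.
have -> : f * p * Y * r' = f * p * (r' * Y) by ring.
have -> : W * expR tau * (f * (p * expR (tau * ln n%:R))) * r =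
  f * p * (r * W * (expR tau * expR (tau * ln n%:R))) by ring.
rewrite ler_wpM2l ?mulr_ge0 // (le_trans h) // ler_wpM2l //.
by rewrite mulr_ge0 ?expR_ge0 // ltW.
Qed.

Lemma cGamma_shift_le z (tau : R) : 0 < complex.Re z -> 0 <= tau ->
  cabs (cGamma z) * expR (tau * ln (complex.Re z)) <=
  expR (tau / complex.Re z + tau) * cabs (cGamma (z + tau%:C)).
Proof.
set X := complex.Re z => X0 tau0.
have h1 := (euler_cvg (Re_gt0_nonpos_int X0)).2.
have h2 : forall e : R, 0 < e ->
    \forall n \near \oo, cabs (euler (z + tau%:C) n - cGamma (z + tau%:C)) < e.
  by apply: (euler_cvg _).2; apply: Re_gt0_nonpos_int; rewrite ReD /= ltr_wpDr.
set K := expR (tau / X + tau); set Y := expR (tau * ln X).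
have K0 : 0 < K by exact: expR_gt0.
have Y0 : 0 < Y by exact: expR_gt0.
apply/ler_addgt0Pl => e e0.
have d0 : 0 < e / (K + Y) by rewrite divr_gt0 // addr_gt0.
have [n1 _ k1] := h1 _ d0; have [n2 _ k2] := h2 _ d0.
pose n := maxn (maxn n1 n2) (Num.truncn X).+1.
have hn1 : (n1 <= n)%N by rewrite !leq_max leqnn.
have hn2 : (n2 <= n)%N by rewrite !leq_max leqnn orbT.
have hn3 : ((Num.truncn X).+1 <= n)%N by rewrite leq_max leqnn orbT.
have n0 : (0 < n)%N by exact: leq_trans hn3.
have Xn : X <= n%:R.
  by rewrite (le_trans (ltW (truncnS_gt _))) // ler_nat.
have := euler_shift_le X0 tau0 n0 Xn; rewrite -/X -/K -/Y.
have := k1 n hn1; have := k2 n hn2 => /=.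
have := cabsB_ge (cGamma z) (euler z n); rewrite [cabs (cGamma z - _)]cabsBC.
have := cabsB_ge (euler (z + tau%:C) n) (cGamma (z + tau%:C)).
set d := e / (K + Y) in d0 *.
have ed : e = d * (K + Y) by rewrite /d divfK // gt_eqF // addr_gt0.
rewrite ed.
set a := cabs (cGamma z); set b := cabs (euler z n).
set c := cabs (cGamma (z + tau%:C)); set f := cabs (euler (z + tau%:C) n).
move=> i1 i2 i3 i4 i5.
have j1 : a <= b + d by lra.
have j2 : f <= c + d by lra.
have : a * Y <= (b + d) * Y by rewrite ler_wpM2r // ltW.
have : K * f <= K * (c + d) by rewrite ler_wpM2l // ltW.
by lra.
Qed.

(** By cGamma_shift_le the ratio of the moduli is at least of the order of
    (Re z)^tau.  This one-sided bound gives both growth results below: with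
    tau = 2 - rho an upper bound, with tau = rho - 2 a lower bound, for the
    step rho compared with the step 2, where the functional equation is
    exact. *)
Lemma cGamma_ratio_large (tau K : R) : 0 < tau -> 0 < K ->
  exists X0 : R, forall z, X0 <= complex.Re z ->
  K * cabs (cGamma z) <= cabs (cGamma (z + tau%:C)).
Proof.
move=> tau0 K0.
exists (1 + expR ((ln K + (tau + tau)) / tau)) => z hz.
have E0 := expR_gt0 ((ln K + (tau + tau)) / tau).
have X0 : 0 < complex.Re z by lra.
have := cGamma_shift_le X0 (ltW tau0).
set X := complex.Re z in hz X0 *.
set G := cabs (cGamma z); set G' := cabs (cGamma _) => h.
have h1 : K * expR (tau + tau) <= expR (tau * ln X).
  rewrite -{1}(lnK (_ : K \is Num.pos)) ?posrE // -expRD ler_expR.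
  rewrite mulrC -ler_pdivrMr // -ler_expR [expR (ln X)]lnK ?posrE //; lra.
have h2 : expR (tau / X + tau) <= expR (tau + tau).
  rewrite ler_expR lerD2r ler_pdivrMr // ler_peMr ?(ltW tau0) //; lra.
have G0 : 0 <= G by exact: cabs_ge0.
have G0' : 0 <= G' by exact: cabs_ge0.
have : G * (K * expR (tau + tau)) <= expR (tau + tau) * G'.
  apply: le_trans (ler_wpM2l G0 h1) _; apply: le_trans h _.
  by rewrite ler_wpM2r.
have e0 := expR_gt0 (tau + tau).
move=> h3; rewrite -(ler_pM2l e0); apply: le_trans h3.
by rewrite le_eqVlt; apply/orP; left; apply/eqP; ring.
Qed.

End GammaGrowth.

(** * Multinomial, factorial and Gamma bounds *)

Section Bounds.
Variable R : realType.
Notation C := (Cplx R).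

(** One term of the multinomial expansion of a power of a sum. *)
Lemma multinomial_le (I : Type) (s : seq I) (e : I -> nat) (v : I -> R) :
  (forall i, 0 <= v i) ->
  (\sum_(i <- s) e i)%N`!%:R * \prod_(i <- s) (v i ^+ e i / (e i)`!%:R) <=
  (\sum_(i <- s) v i) ^+ (\sum_(i <- s) e i)%N.
Proof.
move=> v0; elim: s => [|i s IH]; first by rewrite !big_nil fact0 expr0 mulr1.
rewrite !big_cons; set E := (\sum_(j <- s) e j)%N in IH *.
set V := \sum_(j <- s) v j in IH *; set P := \prod_(j <- s) _ in IH *.
have V0 : 0 <= V by exact: sumr_ge0.
have h := bin_exp_le V0 (v0 i) (leq_addr E (e i)).
rewrite addrC; apply: le_trans h; rewrite addKn.
have -> : (e i + E)`!%:R * (v i ^+ e i / (e i)`!%:R * P) =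
   'C(e i + E, e i)%:R * v i ^+ e i * (E`!%:R * P).
  rewrite -(bin_fact (leq_addr E (e i))) addKn !natrM.
  by have := fact_neq0 R (e i) => f0; field.
by rewrite [leRHS]mulrAC ler_wpM2l ?mulr_ge0 ?exprn_ge0.
Qed.

(** A finite set of multi-indices lies in a cube, over which the sum is a
    product of finite geometric sums. *)
Lemma bounded_sums_ffun (r : nat) (s : R) : 0 <= s -> s < 1 ->
  bounded_sums (fun m : {ffun 'I_r -> nat} => s ^+ (\sum_i m i)%N).
Proof.
move=> s0 s1; exists (\prod_(i < r) (1 - s)^-1) => J.
have [B hB] : exists B, forall m, m \in J -> forall i, (m i < B)%N.
  exists (\max_(m <- J) \max_i m i).+1 => m mJ i.
  rewrite ltnS (big_fsetD1 m) //= leq_max; apply/orP; left.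
  exact: leq_bigmax.
pose psi (g : {ffun 'I_r -> 'I_B}) : {ffun 'I_r -> nat} := [ffun i => val (g i)].
have psi_inj : injective psi.
  move=> g g' /ffunP h; apply/ffunP => i; apply/val_inj.
  by have := h i; rewrite !ffunE.
have sub : (J `<=` [fset psi g | g in {ffun 'I_r -> 'I_B}])%fset.
  apply/fsubsetP => m mJ; apply/imfsetP.
  exists [ffun i => Ordinal (hB m mJ i)] => //.
  by apply/ffunP => i; rewrite !ffunE.
apply: le_trans (fsum_subset _ sub) _; first by move=> m; exact: exprn_ge0.
rewrite big_imfset /=; last by move=> g g' _ _; exact: psi_inj.
rewrite big_enum /=.
under eq_bigr => g _ do rewrite -prodrXr.
have -> : \sum_(g : {ffun 'I_r -> 'I_B}) \prod_(i < r) s ^+ psi g i =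
   \sum_(g : {ffun 'I_r -> 'I_B}) \prod_i s ^+ g i.
  by apply: eq_bigr => g _; apply: eq_bigr => i _; rewrite ffunE.
rewrite -(bigA_distr_bigA (fun i (j : 'I_B) => s ^+ j)).
apply: ler_prod => i _; rewrite geometric_sum_le // andbT.
by apply: sumr_ge0 => j _; exact: exprn_ge0.
Qed.

(** Comparison of y with D by their ratios; the finitely many early terms go
    into the constant. *)
Lemma eventual_ratio_bound (y c D : nat -> R) (n0 : nat) :
  (forall n, 0 <= y n) -> (forall n, 0 < D n) ->
  (forall n, (n0 <= n)%N -> y n.+1 <= y n * c n) ->
  (forall n, 0 <= c n) -> (forall n, D n.+1 = D n * c n) ->
  exists2 K : R, 0 <= K & forall n, y n <= K * D n.
Proof.
move=> y0 D0 hy c0 hD.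
have yD j : 0 <= y j / D j by rewrite divr_ge0 // ltW.
pose K := \sum_(j < n0.+1) y j / D j.
exists K; first exact: sumr_ge0.
have small n : (n <= n0)%N -> y n <= K * D n.
  rewrite -ltnS => nn; rewrite -ler_pdivrMr // /K (bigD1 (Ordinal nn)) //= lerDl.
  exact: sumr_ge0.
elim=> [|n IH]; first exact: small.
have [h|h] := leqP n.+1 n0; first exact: small.
by rewrite hD mulrA (le_trans (hy n _)) // ler_wpM2r.
Qed.

Lemma nat_large (X : R) : exists n0 : nat, forall n, (n0 <= n)%N -> X <= n%:R.
Proof.
exists (Num.truncn X).+1 => n hn.
by rewrite (le_trans (ltW (truncnS_gt _))) // ler_nat.
Qed.

Lemma rising_upper (b : R) (q : R) : 0 <= b -> 1 < q ->
  exists2 K : R, 0 <= K & forall (a : C) n, cabs a <= b ->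
  cabs (rising a n) <= K * q ^+ n * n`!%:R.
Proof.
move=> b0 q1; have [K K0 hK] := rrising_range b0 q1.
exists K => [|a n ab]; first exact: ltW.
have := hK 0%N n; rewrite addr0 fact0 mulr1 add0n; apply: le_trans.
apply: le_trans (cabs_rising _ _) _.
by apply: ler_prod => i _; rewrite addr_ge0 ?cabs_ge0 //= lerD2r.
Qed.

Lemma rising_lower (a : C) (q : R) : 1 < q -> (forall n, rising a n != 0) ->
  exists2 K : R, 0 <= K & forall n, (cabs (rising a n))^-1 <= K * (q ^+ n / n`!%:R).
Proof.
move=> q1 ha; have q0 : 0 < q by lra.
have r0 n : 0 < cabs (rising a n) by rewrite cabs_gt0.
have [n0 hn0] := nat_large ((1 + q * cabs a) / (q - 1)).
have [K K0 hK] : exists2 K : R, 0 <= K & forall n,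
    n`!%:R / cabs (rising a n) <= K * q ^+ n.
  apply: (@eventual_ratio_bound _ (fun=> q) _ n0) => //.
  - by move=> n; rewrite divr_ge0 ?cabs_ge0.
  - by move=> n; exact: exprn_gt0.
  - move=> n /hn0; rewrite ler_pdivrMr ?subr_gt0 // => h.
    have d0 : 0 < cabs (a + n%:R).
      by have := r0 n.+1; rewrite risingS cabsM pmulr_rgt0.
    rewrite risingS cabsM factS natrM invfM.
    have -> : n.+1%:R * n`!%:R * ((cabs (rising a n))^-1 / cabs (a + n%:R)) =
      n`!%:R / cabs (rising a n) * (n.+1%:R / cabs (a + n%:R)) by ring.
    rewrite ler_wpM2l ?divr_ge0 ?cabs_ge0 // ler_pdivrMr //.
    have := cabsB_ge (n%:R) (- a); rewrite opprK cabsN cabs_nat [_ + a]addrC.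
    move=> h1; have : q * (n%:R - cabs a) <= q * cabs (a + n%:R) by rewrite ler_wpM2l // ltW.
    by rewrite -natr1; lra.
  - by move=> n; exact: ltW.
  - by move=> n; rewrite exprSr.
exists K => // n.
by rewrite mulrA ler_pdivlMr ?fact_gt0R // mulrC.
Qed.

(** The ratio of consecutive values is compared with that of (2 n)!.  For
    rho < 2 the missing 2 - rho makes it smaller by any prescribed factor,
    which is what theta records; at rho = 2 there is no such gain. *)
Lemma cGamma_upper (lam : C) (rho q theta : R) :
  0 <= rho -> rho <= 2 -> 1 < q -> 0 < theta -> (rho = 2 -> 1 <= theta) ->
  (forall n : nat, ~ nonpos_int (lam + (rho * n%:R)%:C)) ->
  exists2 K : R, 0 <= K & forall n : nat,
    cabs (cGamma (lam + (rho * n%:R)%:C)) <=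
    K * ((q * theta) ^+ 2) ^+ n * (2 * n)`!%:R.
Proof.
move=> rho0 rho2 q1 th0 hth hnp.
have q0 : 0 < q by lra.
pose y n := cabs (cGamma (lam + (rho * n%:R)%:C)).
pose c n : R := (q * theta) ^+ 2 * ((2 * n).+1%:R * (2 * n).+2%:R).
pose D n : R := ((q * theta) ^+ 2) ^+ n * (2 * n)`!%:R.
have [n0 hn0] : exists n0, forall n, (n0 <= n)%N -> y n.+1 <= y n * c n.
  have zS n : lam + (rho * n.+1%:R)%:C = lam + (rho * n%:R)%:C + rho%:C :> C.
    by rewrite -natr1 mulrDr mulr1 rmorphD /= addrA.
  have Rez n : complex.Re (lam + (rho * n%:R)%:C) = complex.Re lam + rho * n%:R by rewrite ReD.
  have G2 n : cGamma (lam + (rho * n%:R)%:C + 2) =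
      (lam + (rho * n%:R)%:C) * (lam + (rho * n%:R)%:C + 1) *
      cGamma (lam + (rho * n%:R)%:C) by rewrite cGammaD // !risingS rising0 addr0 mul1r.
  have [n1 hn1] := nat_large ((cabs lam + 1) / (q - 1)).
  have zb n : (n1 <= n)%N -> cabs (lam + (rho * n%:R)%:C) <= q * (2 * n).+1%:R /\
      cabs (lam + (rho * n%:R)%:C + 1) <= q * (2 * n).+2%:R.
    move=> /hn1; rewrite ler_pdivrMr ?subr_gt0 // => h.
    have h1 : cabs (lam + (rho * n%:R)%:C) <= cabs lam + 2 * n%:R.
      rewrite (le_trans (cabsD _ _)) // lerD2l cabs_real ger0_norm ?mulr_ge0 //.
      by rewrite ler_wpM2r.
    have n0 : 0 <= n%:R :> R by [].
    have := cabsD (lam + (rho * n%:R)%:C) 1; rewrite cabs1 => h2.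
    by rewrite -[(2 * n).+2%:R]natr1 -[(2 * n).+1%:R]natr1 natrM; split; nra.
  have [rz|rpos] : rho = 0 \/ 0 < rho by move: rho0; rewrite le_eqVlt => /orP[/eqP <-|]; [left|right].
    have [n2 hn2] := nat_large (((q * theta) ^+ 2)^-1).
    exists n2 => n /hn2 h; rewrite /y rz !mul0r ler_peMr ?cabs_ge0 // /c.
    have p0 : 0 < (q * theta) ^+ 2 by rewrite exprn_gt0 // mulr_gt0.
    rewrite -ler_pdivrMl // mulr1 (le_trans h) // -natrM ler_nat.
    by lia.
  have [rl|re] : rho < 2 \/ rho = 2.
    by move: rho2; rewrite le_eqVlt => /orP[/eqP|]; [right|left].
    have t0 : 0 < 2 - rho by lra.
    have K0 : 0 < theta ^- 2 by rewrite invr_gt0 exprn_gt0.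
    have [X0 hX] := cGamma_ratio_large t0 K0.
    have [n2 hn2] := nat_large ((X0 - complex.Re lam) / rho).
    exists (maxn n1 n2) => n; rewrite geq_max => /andP[h1 h2].
    have [z1 z2] := zb n h1.
    have := hX (lam + (rho * n.+1%:R)%:C).
    have -> : lam + (rho * n.+1%:R)%:C + (2 - rho)%:C = lam + (rho * n%:R)%:C + 2 :> C.
      by rewrite zS rmorphB /= rmorph_nat; ring.
    rewrite Rez G2 !cabsM -/(y n) -/(y n.+1) => h.
    have {}h : theta ^- 2 * y n.+1 <= cabs (lam + (rho * n%:R)%:C) *
       cabs (lam + (rho * n%:R)%:C + 1) * y n.
      apply: h; have := hn2 n.+1 (leqW h2); rewrite ler_pdivrMr //; lra.
    move: h; rewrite mulrC ler_pdivrMr ?exprn_gt0 // => h.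
    apply: le_trans h _; rewrite /c mulrC exprMn.
    have -> : y n * (q ^+ 2 * theta ^+ 2 * ((2 * n).+1%:R * (2 * n).+2%:R)) =
      theta ^+ 2 * ((q * (2 * n).+1%:R) * (q * (2 * n).+2%:R) * y n) by ring.
    rewrite ler_wpM2l ?sqr_ge0 // ler_wpM2r ?cabs_ge0 //.
    by rewrite ler_pM ?cabs_ge0.
  exists n1 => n /zb [z1 z2].
  rewrite /y zS re rmorph_nat -re G2 !cabsM -/(y n) mulrC ler_wpM2l ?cabs_ge0 //.
  rewrite /c exprMn.
  apply: (@le_trans _ _ ((q * (2 * n).+1%:R) * (q * (2 * n).+2%:R))).
    by rewrite ler_pM ?cabs_ge0.
  have -> : q ^+ 2 * theta ^+ 2 * ((2 * n).+1%:R * (2 * n).+2%:R) =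
     theta ^+ 2 * ((q * (2 * n).+1%:R) * (q * (2 * n).+2%:R)) by ring.
  by rewrite ler_peMl ?exprn_ege1 ?hth // !mulr_ge0 ?(ltW q0).
have [K K0 hK] : exists2 K : R, 0 <= K & forall n, y n <= K * D n.
  apply: (@eventual_ratio_bound y c D n0) => //.
  - by move=> n; exact: cabs_ge0.
  - by move=> n; rewrite mulr_gt0 ?fact_gt0R ?exprn_gt0 // mulr_gt0.
  - by move=> n; rewrite /c mulr_ge0 ?sqr_ge0.
  - move=> n; rewrite /D /c mulnS !addSn add0n !factS exprSr !natrM.
    by ring.
by exists K => // n; rewrite -mulrA; exact: hK.
Qed.

End Bounds.

(** * Pochhammer symbols of real index *)

Section Pochhammer.
Variable R : realType.
Notation C := (Cplx R).
Implicit Types (a : C) (nu : R).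

Lemma poch_nat a n : poch a n%:R = rising a n.
Proof. by rewrite /poch natr_nat natrK. Qed.

Lemma nat_truncn nu : nu \is a Num.nat -> nu = (Num.truncn nu)%:R.
Proof. by move=> h; rewrite truncnK. Qed.

(** For integral nu the two clauses of the definition agree because Gamma a is
    a nonzero number satisfying the functional equation. *)
Lemma poch_cGamma a nu : ~ nonpos_int a ->
  poch a nu = cGamma (a + nu%:C) / cGamma a.
Proof.
move=> ha; rewrite /poch; case: ifP => // /nat_truncn hn.
have [G0 _] := euler_cvg ha.
by rewrite {2}hn rmorph_nat cGammaD // mulfK.
Qed.

Lemma poch_defined_shift a nu : ~ nonpos_int a -> poch_defined a nu ->
  ~ nonpos_int (a + nu%:C).
Proof.
move=> ha [/nat_truncn ->|[]//]; rewrite rmorph_nat.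
exact: nonpos_intD.
Qed.

Lemma rising_nonpos n N : (n < N)%N -> rising (- n%:R : C) N = 0.
Proof.
move=> nN; rewrite /rising (bigD1 (Ordinal nN)) //=.
by rewrite addrC subrr mul0r.
Qed.

End Pochhammer.

(** * Domination of the hypergeometric series *)

Section Region.
Variables (R : realType) (r k : nat) (rho : R).
Notation C := (Cplx R).
Variables (lam : C) (beta gamma x : 'I_r -> C).
Implicit Types m : {ffun 'I_r -> nat}.

Definition head_deg m : nat := \sum_(i < r | (i < k)%N) m i.
Definition tail_deg m : nat := \sum_(i < r | (k <= i)%N) m i.

Lemma hyperE_indexE m :
  hyperE_index k rho m = rho * (head_deg m)%:R + (tail_deg m)%:R.
Proof. by []. Qed.

Lemma sum_degE m : (\sum_i m i)%N = (head_deg m + tail_deg m)%N.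
Proof.
rewrite (bigID (fun i : 'I_r => (i < k)%N)) /=; congr (_ + _)%N.
by apply: eq_bigl => i; rewrite -leqNgt.
Qed.

Definition hyperE_tail m : C :=
  (\prod_(i < r | (k <= i)%N) rising (beta i) (m i)
   / \prod_(i < r) rising (gamma i) (m i))
  * \prod_(i < r) (x i ^+ m i / (m i)`!%:R).

Lemma hyperE_termE m : hyperE_term k rho lam beta gamma x m =
  poch lam (hyperE_index k rho m) * hyperE_tail m.
Proof. by rewrite /hyperE_term /hyperE_tail [RHS]mulrA. Qed.

(** What is left of the tail of a term when each beta and gamma factor is
    replaced by a factorial. *)
Definition weight m : R :=
  \prod_(i < r | (i < k)%N) (cabs (x i) ^+ m i / (m i)`!%:R ^+ 2)
  * \prod_(i < r | (k <= i)%N) (cabs (x i) ^+ m i / (m i)`!%:R).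

Lemma weight_ge0 m : 0 <= weight m.
Proof.
by apply: mulr_ge0; apply: prodr_ge0 => i _; rewrite divr_ge0 ?exprn_ge0 ?cabs_ge0.
Qed.

Hypothesis gamma_ok : forall i n, rising (gamma i) n != 0.

Lemma hyperE_tail_le (q : R) : 1 < q -> exists2 K : R, 0 <= K & forall m,
  cabs (hyperE_tail m) <= K * q ^+ (2 * \sum_i m i)%N * weight m.
Proof.
move=> q1; have q0 : 0 < q by lra.
have /fin_all_exists [Kg hKg] : forall i : 'I_r, exists Ki : R, 0 <= Ki /\ forall n,
    (cabs (rising (gamma i) n))^-1 <= Ki * (q ^+ n / n`!%:R).
  by move=> i; have [K K0 hK] := rising_lower q1 (gamma_ok i); exists K.
have /fin_all_exists [Kb hKb] : forall i : 'I_r, exists Ki : R, 0 <= Ki /\ forall n,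
    cabs (rising (beta i) n) <= Ki * q ^+ n * n`!%:R.
  move=> i; have [K K0 hK] := rising_upper (cabs_ge0 (beta i)) q1.
  by exists K; split=> // n; exact: hK.
pose K (i : 'I_r) := Kg i * (Kb i + 1).
have K0 i : 0 <= K i by rewrite mulr_ge0 ?(hKg i).1 // addr_ge0 ?(hKb i).1.
exists (\prod_i K i) => [|m]; first by apply: prodr_ge0.
pose w (i : 'I_r) : R := if (i < k)%N then cabs (x i) ^+ m i / (m i)`!%:R ^+ 2
           else cabs (x i) ^+ m i / (m i)`!%:R.
have -> : weight m = \prod_i w i.
  rewrite /weight (bigID (fun i : 'I_r => (i < k)%N) predT) /=; congr (_ * _).
    by apply: eq_bigr => i ik; rewrite /w ik.
  rewrite [RHS](eq_bigl (fun i : 'I_r => (k <= i)%N)).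
    by apply: eq_bigr => i; rewrite leqNgt /w => /negPf ->.
  by move=> i; rewrite -leqNgt.
pose f (i : 'I_r) : C := (if (k <= i)%N then rising (beta i) (m i) else 1)
   / rising (gamma i) (m i) * (x i ^+ m i / (m i)`!%:R).
have -> : hyperE_tail m = \prod_i f i.
  rewrite /hyperE_tail /f [RHS]big_split /=; congr (_ * _).
  by rewrite [RHS]big_split /= prodfV; congr (_ / _); rewrite big_mkcond.
rewrite cabs_prod big_distrr /= -prodrXr -!big_split /=.
apply: ler_prod => i _; rewrite cabs_ge0 /=.
have [Kg0 hg] := hKg i; have [Kb0 hb] := hKb i.
have F0 := fact_gt0R R (m i).
rewrite /f cabsM (cabsM _ (rising (gamma i) (m i))^-1) (cabsM _ (_^-1)) !cabsV.
rewrite cabsX cabs_nat.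
have qn : 1 <= q ^+ m i by rewrite exprn_ege1 // ltW.
have num : cabs (if (k <= i)%N then rising (beta i) (m i) else 1) <=
    (Kb i + 1) * q ^+ m i * (if (i < k)%N then 1 else (m i)`!%:R).
  case: leqP => ki.
    by rewrite (le_trans (hb _)) // ler_wpM2r // ler_wpM2r ?lerDl //; lra.
  by rewrite cabs1 mulr1; nra.
have X0 : 0 <= cabs (x i) ^+ m i / (m i)`!%:R by rewrite divr_ge0 ?exprn_ge0 ?cabs_ge0.
apply: (@le_trans _ _ ((Kb i + 1) * q ^+ m i * (if (i < k)%N then 1 else (m i)`!%:R) *
   (Kg i * (q ^+ m i / (m i)`!%:R)) * (cabs (x i) ^+ m i / (m i)`!%:R))).
  rewrite ler_wpM2r // ler_pM ?cabs_ge0 ?invr_ge0 ?cabs_ge0 //.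
rewrite /K /w mulnC exprM expr2; case: ifP => _; rewrite le_eqVlt; apply/orP; left; apply/eqP.
  by field; rewrite gt_eqF.
by field; rewrite gt_eqF.
Qed.

Let A : R := \sum_(i < r | (i < k)%N) Num.sqrt (cabs (x i)).
Let B : R := \sum_(i < r | (k <= i)%N) cabs (x i).

(** The left-hand side is a single term of the multinomial expansion of
    (2 theta A + B)^(2 M + L): each of the first k variables is used twice,
    with theta sqrt |x_i|, to account for the square of its factorial. *)
Lemma weight_le (theta : R) m : 0 <= theta ->
  (2 * head_deg m + tail_deg m)`!%:R * (theta ^+ 2) ^+ head_deg m * weight m <=
  (2 * theta * A + B) ^+ (2 * head_deg m + tail_deg m).
Proof.
move=> th0.
pose v (i : 'I_r) := if (i < k)%N then theta * Num.sqrt (cabs (x i)) else cabs (x i).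
pose h := [seq i : 'I_r <- index_enum 'I_r | (i < k)%N].
pose l := [seq i : 'I_r <- index_enum 'I_r | (k <= i)%N].
have v0 i : 0 <= v i by rewrite /v; case: ifP; rewrite ?mulr_ge0 ?sqrtr_ge0 ?cabs_ge0.
have := multinomial_le (h ++ h ++ l) m v0.
rewrite !big_cat /= !big_filter.
have -> : (\sum_(i < r | (i < k)%N) m i + (\sum_(i < r | (i < k)%N) m i +
   \sum_(i < r | (k <= i)%N) m i) = 2 * head_deg m + tail_deg m)%N.
  by rewrite addnA addnn mul2n.
have -> : \sum_(i < r | (i < k)%N) v i = theta * A.
  by rewrite /A mulr_sumr; apply: eq_bigr => i ik; rewrite /v ik.
have -> : \sum_(i < r | (k <= i)%N) v i = B.
  by apply: eq_bigr => i; rewrite leqNgt /v => /negPf ->.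
have -> : theta * A + (theta * A + B) = 2 * theta * A + B by ring.
apply: le_trans; rewrite -mulrA ler_wpM2l // le_eqVlt; apply/orP; left; apply/eqP.
rewrite /weight mulrA [RHS]mulrA; congr (_ * _); last first.
  by apply: eq_bigr => i; rewrite leqNgt /v => /negPf ->.
rewrite -prodrXr -!big_split /=; apply: eq_bigr => i ik; rewrite /v ik.
rewrite [(theta * _) ^+ _]exprMn.
have -> : cabs (x i) ^+ m i =
    Num.sqrt (cabs (x i)) ^+ m i * Num.sqrt (cabs (x i)) ^+ m i.
  by rewrite -exprMn -expr2 sqr_sqrtr ?cabs_ge0.
have -> : (theta ^+ 2) ^+ m i = theta ^+ m i * theta ^+ m i by rewrite -exprMn expr2.
by have := fact_neq0 R (m i) => f0; field.
Qed.

(** Four powers of q are spent: on the Pochhammer symbol, on beta, on gamma and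
    on the enlargement exp (N_m ln q); what remains is a geometric series. *)
Lemma hyperE_dominated (theta q K : R) : 1 < q -> 0 <= theta -> 0 <= K ->
  q ^+ 4 * (2 * theta * A + B) < 1 ->
  (forall m, weight m != 0 ->
    hyperE_index k rho m <= (2 * head_deg m + tail_deg m)%:R /\
    cabs (poch lam (hyperE_index k rho m)) <=
      K * q ^+ (2 * head_deg m + tail_deg m) * (theta ^+ 2) ^+ head_deg m *
      (2 * head_deg m + tail_deg m)`!%:R) ->
  bounded_sums (fun m => cabs (hyperE_term k rho lam beta gamma x m) *
     expR (hyperE_index k rho m * ln q)).
Proof.
move=> q1 th0 K0 hs hm; have q0 : 0 < q by lra.
set s := q ^+ 4 * (2 * theta * A + B) in hs.
have A0 : 0 <= A by apply: sumr_ge0 => i _; exact: sqrtr_ge0.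
have B0 : 0 <= B by apply: sumr_ge0 => i _; exact: cabs_ge0.
have S0 : 0 <= 2 * theta * A + B by rewrite addr_ge0 // !mulr_ge0.
have s0 : 0 <= s by rewrite mulr_ge0 // exprn_ge0 // ltW.
have [Kt Kt0 ht] := hyperE_tail_le q1.
apply: bounded_sums_le (bounded_sumsZ (mulr_ge0 K0 Kt0) (bounded_sums_ffun r s0 hs)) => m.
have rhs0 : 0 <= K * Kt * s ^+ (\sum_i m i)%N by rewrite !mulr_ge0 ?exprn_ge0.
rewrite hyperE_termE cabsM; have htm := ht m.
have [w0|w0] := eqVneq (weight m) 0.
  have -> : cabs (hyperE_tail m) = 0.
    by apply/eqP; rewrite eq_le cabs_ge0 andbT; move: htm; rewrite w0 mulr0.
  by rewrite mulr0 mul0r.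
have [h1 h2] := hm m w0.
set D := (2 * head_deg m + tail_deg m)%N in h1 h2 *.
have dD : (\sum_i m i <= D)%N.
  by rewrite sum_degE leq_add2r leq_pmull.
have h3 : expR (hyperE_index k rho m * ln q) <= q ^+ D.
  rewrite -[q in q ^+ D](lnK (_ : q \is Num.pos)) ?posrE // -expRM_natl ler_expR.
  by rewrite ler_wpM2r // ln_ge0 // ltW.
have h4 : cabs (hyperE_tail m) <= Kt * (q ^+ D * q ^+ D) * weight m.
  apply: le_trans htm _; rewrite ler_wpM2r ?weight_ge0 // ler_wpM2l //.
  by rewrite -exprD addnn -mul2n ler_eXn2l // leq_mul2l.
have h5 := weight_le m th0; rewrite -/D in h5; clearbody D.
apply: (@le_trans _ _ (K * q ^+ D * (theta ^+ 2) ^+ head_deg m * D`!%:R *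
   (Kt * (q ^+ D * q ^+ D) * weight m) * q ^+ D)).
  by rewrite ler_pM ?mulr_ge0 ?cabs_ge0 ?expR_ge0 // ler_pM ?cabs_ge0.
have -> : K * q ^+ D * (theta ^+ 2) ^+ head_deg m * D`!%:R *
   (Kt * (q ^+ D * q ^+ D) * weight m) * q ^+ D =
   K * Kt * (q ^+ 4) ^+ D * (D`!%:R * (theta ^+ 2) ^+ head_deg m * weight m).
  have -> : (q ^+ 4) ^+ D = q ^+ D * q ^+ D * q ^+ D * q ^+ D.
    by rewrite -exprM mulnC exprM; ring.
  by ring.
apply: (@le_trans _ _ (K * Kt * (q ^+ 4) ^+ D * (2 * theta * A + B) ^+ D)).
  by rewrite ler_wpM2l // !mulr_ge0 // !exprn_ge0 // ltW.
rewrite -[leLHS]mulrA -exprMn -/s ler_wpM2l ?mulr_ge0 //.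
by rewrite ler_wiXn2l // ltW.
Qed.

End Region.

(** * Convergence beyond the given variables *)

Section RegionSummable.
Variables (R : realType) (r k : nat) (rho : R).
Notation C := (Cplx R).
Variables (lam : C) (beta gamma x : 'I_r -> C).
Implicit Types m : {ffun 'I_r -> nat}.

Notation term := (hyperE_term k rho lam beta gamma x).
Notation idx := (hyperE_index k rho).

Hypothesis rho0 : 0 <= rho.
Hypothesis pdef : forall m, poch_defined lam (idx m).
Hypothesis gamma_ok : forall i n, rising (gamma i) n != 0.
Hypothesis reg : hyperE_region k rho x.
Hypothesis summable_term : absum term.

Let A : R := \sum_(i < r | (i < k)%N) Num.sqrt (cabs (x i)).
Let B : R := \sum_(i < r | (k <= i)%N) cabs (x i).

Lemma sqrt_sum_ge0 : 0 <= A. Proof. by apply: sumr_ge0 => i _; exact: sqrtr_ge0. Qed.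
Lemma tail_sum_ge0 : 0 <= B. Proof. by apply: sumr_ge0 => i _; exact: cabs_ge0. Qed.

Lemma slack (sigma : R) : 0 <= sigma -> sigma < 1 ->
  exists2 q : R, 1 < q & q ^+ 4 * sigma < 1.
Proof.
move=> s0 s1; pose d := (1 - sigma) / 16.
have d0 : 0 < d by rewrite divr_gt0 // subr_gt0.
have d1 : d <= 1 by rewrite /d; lra.
exists (1 + d); first by rewrite ltrDl.
have q4 : (1 + d) ^+ 4 <= 1 + 15 * d.
  have -> : (1 + d) ^+ 4 = 1 + 4 * d + 6 * d ^+ 2 + 4 * d ^+ 3 + d ^+ 4 by ring.
  have e2 : d ^+ 2 <= d by rewrite expr2 ler_piMr // ltW.
  have e3 : d ^+ 3 <= d by rewrite exprS ler_piMr ?(ltW d0) // exprn_ile1 // ltW.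
  have e4 : d ^+ 4 <= d by rewrite exprS ler_piMr ?(ltW d0) // exprn_ile1 // ltW.
  by lra.
apply: (@le_lt_trans _ _ ((1 + 15 * d) * sigma)); first by rewrite ler_wpM2r.
by rewrite /d; nra.
Qed.

(** If lam = - n, every index is a natural number, and the terms of index larger
    than n vanish. *)
Lemma region_summable_poly : nonpos_int lam ->
  bounded_sums (fun m => cabs (term m) * expR (idx m)).
Proof.
move=> [n hn]; have hl : nonpos_int lam by exists n.
apply: bounded_sums_le (bounded_sumsZ (expR_ge0 n%:R) summable_term) => m.
rewrite mulrC; have [hm|hm] := lerP (idx m) n%:R.
  by rewrite ler_wpM2r ?cabs_ge0 // ler_expR.
have hnat : idx m \is a Num.nat by case: (pdef m) => // -[].
rewrite (_ : term m = 0) ?cabs0 ?mulr0 //.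
rewrite hyperE_termE /poch hnat hn rising_nonpos ?mul0r //.
by rewrite -(ltr_nat R) truncnK.
Qed.

(** Only the last r - k variables occur, as in the Lauricella series F_A, and
    the index is the degree. *)
Lemma region_summable_tail : (forall i : 'I_r, (i < k)%N -> x i = 0) ->
  exists2 c : R, 0 < c & bounded_sums (fun m => cabs (term m) * expR (idx m * c)).
Proof.
move=> x0.
have eA : A = 0.
  by apply: big1 => i ik; rewrite x0 // cabs0 sqrtr0.
have B1 : B < 1.
  by have := reg; rewrite /hyperE_region -/A -/B eA mulr0 add0r.
have [q q1 hq] := slack tail_sum_ge0 B1.
exists (ln q); first by rewrite ln_gt0.
have [K K0 hK] := rising_upper (cabs_ge0 lam) q1.
apply: (@hyperE_dominated R r k rho lam beta gamma x gamma_ok 1 q K) => //.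
  by rewrite -/A -/B eA mulr0 add0r.
move=> m w0.
have h0 : head_deg k m = 0%N.
  apply/eqP; rewrite /head_deg sum_nat_eq0; apply/forall_inP => i ik.
  apply: contraNT w0 => mi; rewrite /weight (bigD1 i) //= x0 // cabs0.
  by rewrite expr0n (negPf mi) !mul0r.
rewrite hyperE_indexE h0 mulr0 add0r muln0 add0n; split=> //.
by rewrite poch_nat expr1n expr0 mulr1; exact: hK.
Qed.

Section Head.
Variable i0 : 'I_r.
Hypotheses (i0k : (i0 < k)%N) (xi0 : x i0 != 0).
Hypothesis lam_ok : ~ nonpos_int lam.

Definition monom (n : nat) : {ffun 'I_r -> nat} := [ffun i => if i == i0 then n else 0%N].

Lemma idx_monom n : idx (monom n) = rho * n%:R.
Proof.
rewrite hyperE_indexE /head_deg /tail_deg (bigD1 i0) //= !ffunE eqxx big1; last first.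
  by move=> i /andP[_ /negPf ii]; rewrite ffunE ii.
rewrite big1 ?addr0 ?addn0 // => i ki; rewrite ffunE; case: eqP => // ii.
by move: ki; rewrite ii leqNgt i0k.
Qed.

Lemma lam_step_ok n : ~ nonpos_int (lam + (rho * n%:R)%:C).
Proof. by rewrite -idx_monom; exact: poch_defined_shift. Qed.

(** With a nonzero variable among the first k, every lam + rho n is an argument
    of Gamma.  The factor theta is 1 for rho = 2, where the region is exactly
    2 A + B < 1, and small enough for 2 theta A + B < 1 otherwise. *)
Lemma region_summable_head_le2 : rho <= 2 ->
  exists2 c : R, 0 < c & bounded_sums (fun m => cabs (term m) * expR (idx m * c)).
Proof.
move=> rho2; have A0 := sqrt_sum_ge0; have B0 := tail_sum_ge0.
have rAB : rho * A + B < 1 by exact: reg.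
have [theta [th0 hth hs]] : exists theta : R,
    [/\ 0 < theta, (rho = 2 -> 1 <= theta) & 2 * theta * A + B < 1].
  have rA : 0 <= rho * A by exact: mulr_ge0.
  have [re|rl] : rho = 2 \/ rho < 2.
    by move: rho2; rewrite le_eqVlt => /orP[/eqP|]; [left|right].
    by exists 1; split=> //; rewrite mulr1 -re.
  pose th := (1 - B) / (4 * (A + 1)).
  have d0 : 0 < 4 * (A + 1) by lra.
  have th0 : 0 < th by rewrite divr_gt0 //; lra.
  exists th; split => //; first by move=> e; move: rl; rewrite e ltxx.
  have e : th * (4 * (A + 1)) = 1 - B by rewrite /th divfK // gt_eqF.
  by nra.
have S0 : 0 <= 2 * theta * A + B by rewrite addr_ge0 // !mulr_ge0 // ltW.
have [q q1 hq] := slack S0 hs.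
have q0 : 0 < q by lra.
exists (ln q); first by rewrite ln_gt0.
have [K1 K10 hK1] := cGamma_upper rho0 rho2 q1 th0 hth lam_step_ok.
have [K2 K20 hK2] := rrising_range (cabs_ge0 lam) q1.
have [G0 _] := euler_cvg lam_ok.
have g0 : 0 < cabs (cGamma lam) by rewrite cabs_gt0.
have KK : 0 <= K1 * K2 / cabs (cGamma lam) by rewrite divr_ge0 ?mulr_ge0 // ltW.
apply: (@hyperE_dominated R r k rho lam beta gamma x gamma_ok theta q _ q1 (ltW th0) KK hq).
move=> m _; split.
  rewrite hyperE_indexE natrD natrM lerD2r ler_wpM2r //.
rewrite poch_cGamma // hyperE_indexE.
set M := head_deg k m; set L := tail_deg k m.
rewrite rmorphD /= rmorph_nat addrA cGammaD; last exact: lam_step_ok.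
rewrite cabsM cabsV (cabsM (rising _ _)).
rewrite [leRHS](_ : _ = K1 * K2 * q ^+ (2 * M + L) * (theta ^+ 2) ^+ M * (2 * M + L)`!%:R / cabs (cGamma lam)); last by ring.
rewrite ler_wpM2r ?invr_ge0 ?cabs_ge0 //.
have r1 : cabs (rising (lam + (rho * M%:R)%:C) L) <= rrising (cabs lam + (2 * M)%:R) L.
  apply: le_trans (cabs_rising _ _) _; apply: ler_prod => i _.
  rewrite addr_ge0 ?cabs_ge0 //= lerD2r (le_trans (cabsD _ _)) // lerD2l.
  by rewrite cabs_real ger0_norm ?mulr_ge0 // natrM ler_wpM2r.
have r2 := hK2 (2 * M)%N L.
have r3 := hK1 M.
have F0 := fact_gt0R R (2 * M).
apply: (@le_trans _ _ (rrising (cabs lam + (2 * M)%:R) L * (K1 * ((q * theta) ^+ 2) ^+ M * (2 * M)`!%:R))).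
  by rewrite ler_pM ?cabs_ge0.
have -> : rrising (cabs lam + (2 * M)%:R) L * (K1 * ((q * theta) ^+ 2) ^+ M * (2 * M)`!%:R)
  = (rrising (cabs lam + (2 * M)%:R) L * (2 * M)`!%:R) * (K1 * ((q * theta) ^+ 2) ^+ M) by ring.
have p0 : 0 <= K1 * ((q * theta) ^+ 2) ^+ M.
  by rewrite mulr_ge0 // exprn_ge0 // sqr_ge0.
apply: le_trans (ler_wpM2r p0 r2) _.
rewrite le_eqVlt; apply/orP; left; apply/eqP.
have -> : ((q * theta) ^+ 2) ^+ M = q ^+ (2 * M) * (theta ^+ 2) ^+ M.
  by rewrite [(q * theta) ^+ 2]exprMn [LHS]exprMn -exprM.
rewrite exprD; move: (q ^+ (2 * M)) (q ^+ L) ((theta ^+ 2) ^+ M) => a b d.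
by move: ((2 * M + L)`!%:R) => F; ring.
Qed.

(** Along the axis of x_i0 consecutive terms have a ratio of the order of
    n^(rho - 2), so they are unbounded, against the convergence of the
    series. *)
Lemma region_head_gt2 : 2 < rho -> False.
Proof.
move=> rho2.
have [G0 _] := euler_cvg lam_ok.
pose X := cabs (x i0); have X0 : 0 < X by rewrite cabs_gt0.
pose y n := cabs (term (monom n)).
have yE n : y n = cabs (cGamma (lam + (rho * n%:R)%:C)) / cabs (cGamma lam)
    * (X ^+ n / (cabs (rising (gamma i0) n) * n`!%:R)).
  rewrite /y hyperE_termE poch_cGamma // idx_monom /hyperE_tail.
  rewrite big1; last first.
    move=> i ki; rewrite ffunE; case: eqP => [ii|_]; last exact: rising0.
    by move: ki; rewrite ii leqNgt i0k.
  have -> : \prod_(i < r) rising (gamma i) (monom n i) = rising (gamma i0) n.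
    rewrite (bigD1 i0) //= big1 ?mulr1 ?ffunE ?eqxx // => i /negPf ii.
    by rewrite ffunE ii rising0.
  have -> : \prod_(i < r) (x i ^+ monom n i / (monom n i)`!%:R) = x i0 ^+ n / n`!%:R.
    rewrite (bigD1 i0) //= big1 ?mulr1 ?ffunE ?eqxx // => i /negPf ii.
    by rewrite ffunE ii expr0 fact0 divr1.
  rewrite (cabsM (_ / _)) (cabsM (cGamma _)) cabsV mul1r.
  rewrite cabsM cabsV (cabsM _ (_^-1)) cabsX cabsV cabs_nat -/X invfM.
  by congr (_ * _); rewrite mulrCA mulrA.
have y0 n : 0 < y n.
  have [Gn _] := euler_cvg (lam_step_ok (n := n)).
  by rewrite yE !mulr_gt0 ?invr_gt0 ?mulr_gt0 ?exprn_gt0 ?fact_gt0R ?cabs_gt0.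
pose Z := cabs lam; have Z0 : 0 <= Z by exact: cabs_ge0.
have t0 : 0 < rho - 2 by lra.
have K0 : 0 < 8 / X by rewrite divr_gt0.
have [X1 hX1] := cGamma_ratio_large t0 K0.
have [n1 hn1] := nat_large (Z + 1 + cabs (gamma i0)).
have [n2 hn2] := nat_large ((X1 - complex.Re lam) / rho).
pose n0 := (maxn n1 n2).+1.
have step n : (n0 <= n)%N -> 2 * y n <= y n.+1.
  move=> hn; have npos : (0 < n)%N by exact: leq_trans hn.
  have k1 : Z + 1 + cabs (gamma i0) <= n%:R.
    by apply: hn1; rewrite (leq_trans _ hn) // /n0 leqW // leq_maxl.
  have k2 : (X1 - complex.Re lam) / rho <= n%:R.
    by apply: hn2; rewrite (leq_trans _ hn) // /n0 leqW // leq_maxr.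
  pose z := lam + (rho * n%:R)%:C.
  have nr : 1 <= n%:R :> R by rewrite ler1n.
  have zS : lam + (rho * n.+1%:R)%:C = z + 2 + (rho - 2)%:C :> C.
    by rewrite /z -natr1 mulrDr mulr1 rmorphD /= rmorphB /= rmorph_nat; ring.
  have G2 : cGamma (z + 2) = z * (z + 1) * cGamma z.
    rewrite cGammaD; last exact: lam_step_ok.
    by rewrite !risingS rising0 addr0 mul1r.
  have big : 8 / X * (cabs z * cabs (z + 1) * cabs (cGamma z)) <=
      cabs (cGamma (lam + (rho * n.+1%:R)%:C)).
    have -> : cabs z * cabs (z + 1) * cabs (cGamma z) = cabs (cGamma (z + 2)).
      by rewrite G2 !cabsM.
    rewrite zS; apply: hX1.
    have -> : complex.Re (z + 2) = complex.Re lam + rho * n%:R + 2.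
      have -> : (2 : C) = (2 : R)%:C by rewrite rmorph_nat.
      by rewrite !ReD.
    by move: k2; rewrite ler_pdivrMr //; lra.
  have rn : 2 * n%:R <= rho * n%:R by rewrite ler_wpM2r // ltW.
  have zb : n%:R <= cabs z.
    have := cabsB_ge ((rho * n%:R)%:C : C) (- lam); rewrite opprK cabsN -/Z.
    have -> : (rho * n%:R)%:C + lam = z by rewrite /z addrC.
    rewrite cabs_real ger0_norm ?mulr_ge0 //.
    by have := cabs_ge0 (gamma i0); lra.
  have zb1 : n%:R <= cabs (z + 1).
    have := cabsB_ge ((rho * n%:R)%:C : C) (- (lam + 1)); rewrite opprK cabsN.
    have -> : (rho * n%:R)%:C + (lam + 1) = z + 1 :> C by rewrite /z; ring.
    rewrite cabs_real ger0_norm ?mulr_ge0 //.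
    have := cabsD lam 1; rewrite cabs1 -/Z.
    by have := cabs_ge0 (gamma i0); lra.
  have gpos : 0 < cabs (gamma i0 + n%:R).
    have : 0 < cabs (rising (gamma i0) n.+1) by rewrite cabs_gt0.
    by rewrite risingS cabsM pmulr_rgt0 // cabs_gt0.
  have gb : cabs (gamma i0 + n%:R) <= 2 * n%:R.
    by have := cabsD (gamma i0) n%:R; rewrite cabs_nat; lra.
  rewrite !yE risingS cabsM factS natrM exprS -/z.
  set g := cabs (cGamma z) in big *; set g' := cabs (cGamma (lam + _)) in big *.
  set h := cabs (cGamma lam).
  set p := cabs (rising (gamma i0) n); set F := n`!%:R : R.
  set c := cabs (gamma i0 + n%:R) in gpos gb *.
  have h0 : 0 < h by rewrite cabs_gt0.
  have p0 : 0 < p by rewrite cabs_gt0.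
  have F0 : 0 < F by exact: fact_gt0R.
  have g0 : 0 <= g by exact: cabs_ge0.
  have N0 : 0 < n.+1%:R :> R by [].
  have -> : g' / h * (X * X ^+ n / (p * c * (n.+1%:R * F))) =
     (g' * X / (c * n.+1%:R)) * (h^-1 * (X ^+ n / (p * F))).
    by field; rewrite ?gt_eqF.
  have -> : 2 * (g / h * (X ^+ n / (p * F))) = 2 * g * (h^-1 * (X ^+ n / (p * F))) by ring.
  rewrite ler_wpM2r //.
    by rewrite mulr_ge0 ?divr_ge0 ?exprn_ge0 ?mulr_ge0 ?invr_ge0 // ltW.
  rewrite ler_pdivlMr ?mulr_gt0 //.
  have b1 : 8 * (n%:R * n%:R * g) <= g' * X.
    rewrite -ler_pdivrMr // mulrAC; apply: le_trans big.
    rewrite ler_wpM2l ?(ltW K0) // ler_wpM2r // ler_pM //.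
  have b2 : c * n.+1%:R <= 2 * n%:R * (2 * n%:R).
    by rewrite ler_pM ?(ltW gpos) // -natr1; lra.
  have : 2 * g * (c * n.+1%:R) <= 2 * g * (2 * n%:R * (2 * n%:R)).
    by rewrite ler_wpM2l // mulr_ge0.
  by lra.
have [Bd hB] := summable_term.
have yB n : y n <= Bd by have := hB [fset monom n]%fset; rewrite big_seq_fset1.
have grow n : n.+1%:R * y n0 <= y (n0 + n)%N.
  elim: n => [|n IH]; first by rewrite mul1r addn0.
  have := step (n0 + n)%N (leq_addr _ _); rewrite addnS; apply: le_trans.
  apply: le_trans (_ : 2 * (n.+1%:R * y n0) <= _); last by rewrite ler_wpM2l.
  rewrite mulrA ler_wpM2r ?(ltW (y0 _)) // -[n.+2%:R]natr1 mulrDl mul1r lerD2l.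
  by rewrite ler1n.
have [n3 hn3] := nat_large (Bd / y n0).
have := grow n3; have := yB (n0 + n3)%N; have := hn3 n3 (leqnn _).
by rewrite ler_pdivrMr // -natr1; have := y0 n0; lra.
Qed.

End Head.

(** Convergence with every variable slightly enlarged; it fails in general at
    boundary points of the region. *)
Lemma region_summable :
  exists2 c : R, 0 < c & bounded_sums (fun m => cabs (term m) * expR (idx m * c)).
Proof.
have [lnp|lnp] := pselect (nonpos_int lam).
  exists 1 => //; have := region_summable_poly lnp; apply: bounded_sums_le => m.
  by rewrite mulr1.
have [hx|] := pselect (forall i : 'I_r, (i < k)%N -> x i = 0).
  exact: region_summable_tail.
move=> /existsNP[i0] /not_implyP[i0k /eqP xi0].
have [rho2|rho2] := lerP rho 2; first exact: region_summable_head_le2 i0k lnp rho2.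
by case: (region_head_gt2 i0k xi0 lnp rho2).
Qed.

End RegionSummable.

(** * The generating relation *)

Section Assembly.
Variable R : realType.
Notation C := (Cplx R).

(** Both sides are (lam)_(nu + n), by splitting a product for integral nu and by
    the functional equation of Gamma otherwise. *)
Lemma rising_poch_swap (lam : C) (nu : R) n :
  poch_defined lam nu ->
  rising lam n * poch (lam + n%:R) nu = poch lam nu * rising (lam + nu%:C) n.
Proof.
rewrite /poch_defined /poch; case: ifP => [/nat_truncn hnu _|_ [//|[h1 h2]]].
  set N := Num.truncn nu in hnu *.
  by rewrite hnu rmorph_nat -!risingD addnC.
rewrite addrAC !cGammaD //.
have r0 : rising lam n != 0 by exact: rising_neq0.
have [G0 _] := euler_cvg h1.
rewrite invfM; have := mulVf r0; set a := rising lam n; set b := rising _ n => e.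
set g := cGamma _; set g' := cGamma _.
transitivity ((a^-1 * a) * (b * g * g'^-1)); first by ring.
by rewrite e mul1r; ring.
Qed.

Variables (r k : nat) (rho : R) (lam t : C) (beta gamma x : 'I_r -> C).
Hypothesis t1 : cabs t < 1.

Lemma hyperE_term_rescale (m : {ffun 'I_r -> nat}) :
  hyperE_term k rho lam beta gamma (hyperE_rescale k rho x t) m =
  hyperE_term k rho lam beta gamma x m *
  cexp ((hyperE_index k rho m)%:C * mlog t).
Proof.
suff e : \prod_(i < r) (hyperE_rescale k rho x t i ^+ m i / (m i)`!%:R) =
    \prod_(i < r) (x i ^+ m i / (m i)`!%:R) *
    cexp ((hyperE_index k rho m)%:C * mlog t).
  by rewrite !hyperE_termE /hyperE_tail e; move: (cexp _) => E; rewrite !mulrA.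
have nz : 1 - t != 0 by rewrite -cabs_gt0 cabs_1B_gt0.
have -> : cexp ((hyperE_index k rho m)%:C * mlog t) =
  \prod_(i < r) cexp ((if (i < k)%N then rho%:C * mlog t else mlog t) *+ m i).
  rewrite -cexp_sum; congr cexp.
  rewrite hyperE_indexE (bigID (fun i : 'I_r => (i < k)%N)) /=.
  have -> : \sum_(i < r | (i < k)%N)
      (if (i < k)%N then rho%:C * mlog t else mlog t) *+ m i =
      (rho%:C * mlog t) *+ head_deg k m.
    by rewrite -sumrMnr; apply: eq_bigr => i ->.
  have -> : \sum_(i < r | ~~ (i < k)%N)
      (if (i < k)%N then rho%:C * mlog t else mlog t) *+ m i =
      mlog t *+ tail_deg k m.
    rewrite -sumrMnr [RHS](eq_bigl (fun i : 'I_r => ~~ (i < k)%N)).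
      by apply: eq_bigr => i /negPf ->.
    by move=> i; rewrite -leqNgt.
  rewrite rmorphD rmorphM /= !rmorph_nat mulrDl mulr_natl mulrAC.
  by rewrite -[(_ * _) *+ _]mulr_natr.
rewrite -big_split /=; apply: eq_bigr => i _.
rewrite -[X in cexp X]mulr_natl cexpMn /hyperE_rescale; case: ifP => _.
  have -> : cexp (rho%:C * mlog t) = (cpow (1 - t) rho%:C)^-1.
    by rewrite /cpow /mlog mulrN cexpN.
  by rewrite exprMn mulrAC.
have -> : cexp (mlog t) = (1 - t)^-1 by rewrite -cexp_mlog // cexpN invrK.
by rewrite exprMn mulrAC.
Qed.

End Assembly.

Theorem theorem1 (R : realType) (r k : nat) (rho : R)
    (lambda t : Cplx R) (beta gamma x : 'I_r -> Cplx R) :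
  (1 <= r)%N -> (k <= r)%N -> 0 <= rho ->
  `|t| < 1 ->
  (forall n : nat, hyperE_defined k rho (lambda + n%:R) beta gamma x) ->
  hyperE_defined k rho lambda beta gamma (hyperE_rescale k rho x t) ->
  let u : nat -> Cplx R := fun n =>
    rising lambda n / n`!%:R
    * hyperE k rho (lambda + n%:R) beta gamma x * t ^+ n in
  cvgn (series u) ->
  limn (series u)
    = cpow (1 - t) (- lambda)
      * hyperE k rho lambda beta gamma (hyperE_rescale k rho x t).
Proof.
move=> _ _ rho0; rewrite normC_cabs ltcR => t1 hE hE' u ucvg.
have := hE 0%N; rewrite addr0 => -[pdef gamma_ok reg cvg0].
have [_ _ _ cvg'] := hE'.
have idx0 (m : {ffun 'I_r -> nat}) : 0 <= hyperE_index k rho m by rewrite addr_ge0 // mulr_ge0.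
pose A := hyperE_term k rho lambda beta gamma x.
pose N := hyperE_index k rho : {ffun 'I_r -> nat} -> R.
pose p n := tsum (fun m => A m * binc (lambda + (N m)%:C) n).
have up n : u n = p n * t ^+ n.
  have [_ _ _ /has_sum_cvgn hn] := hE n.
  rewrite /u; congr (_ * _); apply/esym/has_sum_tsum.
  apply: has_sum_ext (has_sumZ (rising lambda n / n`!%:R) hn) => m.
  rewrite !hyperE_termE /A hyperE_termE /binc.
  have := rising_poch_swap n (pdef m); rewrite -/(N m).
  set P := poch _ _; set P' := poch _ _ => e.
  transitivity ((rising lambda n * P) * (hyperE_tail k beta gamma x m / n`!%:R)); first by ring.
  by rewrite e; ring.
clearbody u.
set S := limn (series u).
have hS : forall e : R, 0 < e ->
    \forall n \near \oo, cabs (\sum_(j < n) p j * t ^+ j - S) < e.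
  have h := (cvg_cabsP _ (series u) S).1 ucvg.
  have su n : \sum_(j < n) p j * t ^+ j = series u n.
    by rewrite /series /= big_mkord; apply: eq_bigr => j _; rewrite -up.
  by move=> e /h; apply: filterS => n; rewrite su.
have SE : S = tsum (fun m => A m * cexp ((lambda + (N m)%:C) * mlog t)).
  have [t0|t0] := eqVneq t 0.
    have -> : (fun m => A m * cexp ((lambda + (N m)%:C) * mlog t)) =
        (fun m => A m * binc (lambda + (N m)%:C) 0).
      apply/funext => m; rewrite binc0 t0.
      have -> : mlog (0 : Cplx R) = 0.
        rewrite /mlog subr0 -[1]/((1 : R)%:C) cln_real // ln1.
        by rewrite oppr0.
      by rewrite mulr0 cexp0.
    apply: (@near_unique R nat \oo _ (fun n => \sum_(j < n) p j * t ^+ j)) => // e e0.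
    exists 1%N => // -[//|n] _ /=.
    rewrite big_ord_recl expr0 mulr1 big1 ?addr0 ?subrr ?cabs0 // => i _.
    by rewrite t0 expr0n /= mulr0.
  have [s [s0 s1 sle hs]] : exists s : R, [/\ 0 < s, s < 1, s <= cabs (1 - t)
      & bounded_sums (fun m => cabs (A m) * expR (- (N m * ln s)))].
    have [h|h] := ltP (cabs (1 - t)) 1.
      exists (cabs (1 - t)); split=> //; first exact: cabs_1B_gt0.
      apply: bounded_sums_le (cvg_absum cvg') => m.
      rewrite hyperE_term_rescale // cabsM cabs_cexp ReZ Re_mlog.
      by rewrite mulrN.
    have [c c0 hc] := region_summable rho0 pdef gamma_ok reg (cvg_absum cvg0).
    exists (expR (- c)); split; first exact: expR_gt0.
    - by rewrite expR_lt1 oppr_lt0.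
    - by rewrite (le_trans _ h) // expR_le1 oppr_le0 ltW.
    apply: bounded_sums_le hc => m.
    by rewrite expRK mulrN opprK.
  exact: (power_series_continuation t1 idx0 s0 s1 sle hs t0 hS).
rewrite SE; apply: has_sum_tsum.
apply: has_sum_ext (has_sumZ (cpow (1 - t) (- lambda)) (has_sum_cvgn cvg')) => m.
rewrite hyperE_term_rescale // mulrDl cexpD /cpow mulNr -mulrN -/(mlog t).
by rewrite -/(A m) -/(N m); set a := cexp _; set b := cexp _; ring.
Qed.
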